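(* Let $0<\theta<1$ and let $\varphi_\theta$ be the lens map. There exist positive constants $b_\theta,c_\theta,\beta_\theta,\gamma_\theta$, depending only on $\theta$, with $b_\theta=\pi\sqrt{\frac{2(1-\theta)}{\theta}}$, such that the approximation numbers of $C_{\varphi_\theta}:H^2\to H^2$ satisfy, for all $n\ge1$, $$c_\theta\,e^{-b_\theta\sqrt n}\ \le\ a_n(C_{\varphi_\theta})\ \le\ \gamma_\theta\,e^{-\beta_\theta\sqrt n}.$$ In particular, $\beta(C_{\varphi_\theta})=1$ and $C_{\varphi_\theta}$ belongs to all Schatten classes $S_p$, $p>0$, but its approximation numbers do not decrease exponentially.
   Context: $\mathbb{D}$ is the open unit disk, $\mathbb{H}=\{z\in\mathbb{C}:\operatorname{Re}z>0\}$, $T(z)=\frac{1-z}{1+z}$ (an involution mapping $\mathbb{D}$ onto $\mathbb{H}$), $\tau_\theta(z)=z^\theta$ on $\mathbb{H}$ (principal branch), and the lens map is $\varphi_\theta=T\circ\tau_\theta\circ T:\mathbb{D}\to\mathbb{D}$. $H^2$ is the Hardy space of the disk and $C_\varphi f=f\circ\varphi$. For a bounded operator $S$ between Hilbert spaces, $a_n(S)=\inf\{\|S-R\|:\ \operatorname{rank}R<n\}$, $n\ge1$; $\beta(S)=\liminf_{n\to\infty}[a_n(S)]^{1/n}$; and $S\in S_p$ means $(a_n(S))_n\in\ell_p$. *)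

(* Defs.v *)
From Stdlib Require Import Reals Lra Lia FunctionalExtensionality
  ProofIrrelevance IndefiniteDescription.
From Coquelicot Require Export Coquelicot.

Open Scope R_scope.

Definition disk : Type := {z : C | Cmod z < 1}.

Definition square_summable (a : nat -> C) : Prop :=
  ex_series (fun n => Cmod (a n) ^ 2).

Definition is_taylor (f : disk -> C) (a : nat -> C) : Prop :=
  forall z : disk, is_pseries a (proj1_sig z) (f z).

Record H2 : Type := mkH2 {
  H2_fun :> disk -> C;
  H2_prop : exists a, square_summable a /\ is_taylor H2_fun a }.

(* The choice is harmless by [is_taylor_unique] below. *)
Definition taylor_coef (f : H2) : nat -> C :=
  proj1_sig (constructive_indefinite_description _ (H2_prop f)).

Definition H2_norm (f : H2) : R :=
  sqrt (Series (fun n => Cmod (taylor_coef f n) ^ 2)).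

Lemma H2_ext (f g : H2) : (forall z, f z = g z) -> f = g.
Proof.
  destruct f as [f Pf], g as [g Pg]; simpl; intros E.
  assert (f = g) as -> by (apply functional_extensionality; exact E).
  now rewrite (proof_irrelevance _ Pf Pg).
Qed.

Lemma taylor_coef_l2 (f : H2) : square_summable (taylor_coef f).
Proof. unfold taylor_coef; now destruct constructive_indefinite_description as [a [Ha Ta]]. Qed.

Lemma taylor_coef_is_taylor (f : H2) : is_taylor f (taylor_coef f).
Proof. unfold taylor_coef; now destruct constructive_indefinite_description as [a [Ha Ta]]. Qed.

Lemma is_series_C_proj (a : nat -> C) (l : C) :
  is_series a l ->
  is_series (fun n => fst (a n)) (fst l) /\ is_series (fun n => snd (a n)) (snd l).
Proof.
  assert (S1 : forall n, fst (sum_n a n) = sum_n (fun n => fst (a n)) n).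
  { induction n; [now rewrite !sum_O|]. rewrite !sum_Sn, <- IHn. reflexivity. }
  assert (S2 : forall n, snd (sum_n a n) = sum_n (fun n => snd (a n)) n).
  { induction n; [now rewrite !sum_O|]. rewrite !sum_Sn, <- IHn. reflexivity. }
  intros H; split; intros P HP.
  - unfold filtermap; apply (filter_imp (fun n => P (fst (sum_n a n)))).
    { intros n; now rewrite S1. }
    apply (H (fun z => P (fst z))). destruct HP as [e He].
    exists e; intros y [Hy _]; now apply He.
  - unfold filtermap; apply (filter_imp (fun n => P (snd (sum_n a n)))).
    { intros n; now rewrite S2. }
    apply (H (fun z => P (snd z))). destruct HP as [e He].
    exists e; intros y [_ Hy]; now apply He.
Qed.

Lemma pow_n_RtoC (x : R) (n : nat) : pow_n (RtoC x : C_AbsRing) n = RtoC (x ^ n).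
Proof.
  induction n; [reflexivity|]. simpl. rewrite IHn.
  unfold mult; simpl. now rewrite <- RtoC_mult.
Qed.

Lemma is_taylor_real (f : disk -> C) (a : nat -> C) (x : R) (Hx : Cmod (RtoC x) < 1) :
  is_taylor f a ->
  is_pseries (fun n => fst (a n)) x (fst (f (exist _ (RtoC x) Hx))) /\
  is_pseries (fun n => snd (a n)) x (snd (f (exist _ (RtoC x) Hx))).
Proof.
  intros H. specialize (H (exist _ (RtoC x) Hx)); simpl in H.
  apply is_series_C_proj in H. destruct H as [H1 H2].
  split; apply is_pseries_R.
  - eapply is_series_ext; [|exact H1]. intros n; cbv beta. rewrite pow_n_RtoC.
    unfold scal; simpl; unfold mult; simpl. ring.
  - eapply is_series_ext; [|exact H2]. intros n; cbv beta. rewrite pow_n_RtoC.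
    unfold scal; simpl; unfold mult; simpl. ring.
Qed.

Lemma CV_radius_pos (a : nat -> R) (x l : R) :
  0 < x -> is_pseries a x l -> Rbar_lt 0 (CV_radius a).
Proof.
  intros Hx H. apply Rbar_lt_le_trans with (Finite x); [exact Hx|].
  destruct (Rbar_le_lt_dec (Finite x) (CV_radius a)) as [h|h]; [exact h|].
  exfalso. apply (CV_disk_outside a x).
  - rewrite Rabs_pos_eq; [exact h|lra].
  - apply is_pseries_R in H.
    apply (ex_series_lim_0 (fun n => a n * x ^ n)). now exists l.
Qed.

Lemma is_taylor_unique (f : disk -> C) (a b : nat -> C) :
  is_taylor f a -> is_taylor f b -> forall n, a n = b n.
Proof.
  intros Ha Hb n.
  assert (D : forall x, Rabs x < 1 -> Cmod (RtoC x) < 1)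
    by (intros x; now rewrite Cmod_R).
  assert (h : Rabs (1/2) < 1) by (rewrite Rabs_pos_eq; lra).
  assert (L : locally 0 (fun x : R => Rabs x < 1)).
  { exists (mkposreal 1 Rlt_0_1); intros y Hy.
    unfold ball in Hy; simpl in Hy; unfold AbsRing_ball, abs, minus, plus, opp in Hy.
    simpl in Hy. now rewrite Ropp_0, Rplus_0_r in Hy. }
  destruct (is_taylor_real f a _ (D _ h) Ha) as [a1 a2].
  destruct (is_taylor_real f b _ (D _ h) Hb) as [b1 b2].
  apply injective_projections.
  - apply (PSeries_ext_recip (fun n => fst (a n)) (fun n => fst (b n))).
    1,2: eapply CV_radius_pos; [|eassumption]; lra.
    revert L; apply filter_imp; intros x Hx.
    rewrite (is_pseries_unique _ _ _ (proj1 (is_taylor_real f a x (D x Hx) Ha))).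
    now rewrite (is_pseries_unique _ _ _ (proj1 (is_taylor_real f b x (D x Hx) Hb))).
  - apply (PSeries_ext_recip (fun n => snd (a n)) (fun n => snd (b n))).
    1,2: eapply CV_radius_pos; [|eassumption]; lra.
    revert L; apply filter_imp; intros x Hx.
    rewrite (is_pseries_unique _ _ _ (proj2 (is_taylor_real f a x (D x Hx) Ha))).
    now rewrite (is_pseries_unique _ _ _ (proj2 (is_taylor_real f b x (D x Hx) Hb))).
Qed.

Lemma H2_norm_eq (f : H2) (a : nat -> C) :
  is_taylor f a -> H2_norm f = sqrt (Series (fun n => Cmod (a n) ^ 2)).
Proof.
  intros H. unfold H2_norm. f_equal. apply Series_ext; intros n.
  now rewrite (is_taylor_unique f _ a (taylor_coef_is_taylor f) H).
Qed.

Lemma young_sq (t u v : R) : 0 < t ->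
  (u + v) ^ 2 <= (1 + t) * u ^ 2 + (1 + / t) * v ^ 2.
Proof.
  intros Ht.
  assert (E : (1 + t) * u ^ 2 + (1 + / t) * v ^ 2 - (u + v) ^ 2
              = / t * (t * u - v) ^ 2) by (field; lra).
  assert (0 <= / t * (t * u - v) ^ 2).
  { apply Rmult_le_pos; [left; now apply Rinv_0_lt_compat | apply pow2_ge_0]. }
  lra.
Qed.

Lemma Cmod_add_sq (t : R) (x y : C) : 0 < t ->
  Cmod (x + y) ^ 2 <= (1 + t) * Cmod x ^ 2 + (1 + / t) * Cmod y ^ 2.
Proof.
  intros Ht. eapply Rle_trans; [|now apply young_sq].
  apply pow_incr; split; [apply Cmod_ge_0 | apply Cmod_triangle].
Qed.

Lemma square_summable_plus (a b : nat -> C) :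
  square_summable a -> square_summable b ->
  square_summable (fun n => a n + b n)%C.
Proof.
  intros Ha Hb.
  apply (@ex_series_le R_AbsRing R_CompleteNormedModule _
    (fun n => (1 + 1) * Cmod (a n) ^ 2 + (1 + / 1) * Cmod (b n) ^ 2)).
  - intros n. change (Rabs (Cmod (a n + b n) ^ 2) <=
      (1 + 1) * Cmod (a n) ^ 2 + (1 + / 1) * Cmod (b n) ^ 2).
    rewrite Rabs_pos_eq by apply pow2_ge_0. apply Cmod_add_sq; lra.
  - apply (ex_series_plus (fun n => (1 + 1) * Cmod (a n) ^ 2)
                          (fun n => (1 + / 1) * Cmod (b n) ^ 2)).
    + now apply (ex_series_scal_l (1 + 1) (fun n => Cmod (a n) ^ 2)).
    + now apply (ex_series_scal_l (1 + / 1) (fun n => Cmod (b n) ^ 2)).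
Qed.

Lemma square_summable_scal (c : C) (a : nat -> C) :
  square_summable a -> square_summable (fun n => c * a n)%C.
Proof.
  intros Ha. unfold square_summable.
  apply ex_series_ext with (fun n => Cmod c ^ 2 * Cmod (a n) ^ 2).
  - intros n. rewrite Cmod_mult. symmetry; apply Rpow_mult_distr.
  - now apply (ex_series_scal_l (Cmod c ^ 2) (fun n => Cmod (a n) ^ 2)).
Qed.

Lemma Series_sq_nonneg (a : nat -> C) :
  square_summable a -> 0 <= Series (fun n => Cmod (a n) ^ 2).
Proof.
  intros Ha. replace 0 with (Series (fun _ => 0 * 0)).
  - apply Series_le; [|exact Ha]. intros n.
    split; [lra|]. rewrite Rmult_0_l. apply pow2_ge_0.
  - rewrite Series_scal_l. ring.
Qed.

Lemma Series_sq_zero (a : nat -> C) :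
  square_summable a -> Series (fun n => Cmod (a n) ^ 2) = 0 -> forall n, a n = RtoC 0.
Proof.
  intros Ha E n. apply Cmod_eq_0.
  assert (H : is_series (fun n => Cmod (a n) ^ 2) 0).
  { rewrite <- E. now apply Series_correct. }
  assert (Hn : Cmod (a n) ^ 2 <= 0).
  { apply Rle_trans with (sum_n (fun k => Cmod (a k) ^ 2) n).
    - destruct n; [rewrite sum_O; lra|]. rewrite sum_Sn.
      unfold plus; simpl plus.
      assert (0 <= sum_n (fun k => Cmod (a k) ^ 2) n).
      { clear. induction n; [rewrite sum_O; apply pow2_ge_0|].
        rewrite sum_Sn. apply Rplus_le_le_0_compat; [exact IHn|apply pow2_ge_0]. }
      simpl in *; lra.
    - apply (is_lim_seq_incr_compare (sum_n (fun k => Cmod (a k) ^ 2))); [exact H|].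
      intros k. rewrite sum_Sn. unfold plus; simpl.
      assert (0 <= Cmod (a (S k)) ^ 2) by apply pow2_ge_0. simpl in *; lra. }
  assert (0 <= Cmod (a n)) by apply Cmod_ge_0. nra.
Qed.

Lemma l2_triangle (a b : nat -> C) :
  square_summable a -> square_summable b ->
  sqrt (Series (fun n => Cmod (a n + b n) ^ 2)) <=
  sqrt (Series (fun n => Cmod (a n) ^ 2)) + sqrt (Series (fun n => Cmod (b n) ^ 2)).
Proof.
  intros Ha Hb.
  assert (Pa := Series_sq_nonneg a Ha). assert (Pb := Series_sq_nonneg b Hb).
  assert (Hab := square_summable_plus a b Ha Hb).
  set (A := sqrt (Series (fun n => Cmod (a n) ^ 2))).
  set (B := sqrt (Series (fun n => Cmod (b n) ^ 2))).
  assert (A2 : A * A = Series (fun n => Cmod (a n) ^ 2)) by now apply sqrt_sqrt.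
  assert (B2 : B * B = Series (fun n => Cmod (b n) ^ 2)) by now apply sqrt_sqrt.
  assert (A0 : 0 <= A) by apply sqrt_pos. assert (B0 : 0 <= B) by apply sqrt_pos.
  destruct (Req_dec A 0) as [EA|NA].
  { assert (Za : forall n, a n = RtoC 0).
    { apply Series_sq_zero; [exact Ha|]. rewrite <- A2, EA; ring. }
    rewrite EA, Rplus_0_l. right. unfold B. f_equal. apply Series_ext; intros n.
    now rewrite Za, Cplus_0_l. }
  destruct (Req_dec B 0) as [EB|NB].
  { assert (Zb : forall n, b n = RtoC 0).
    { apply Series_sq_zero; [exact Hb|]. rewrite <- B2, EB; ring. }
    rewrite EB, Rplus_0_r. right. unfold A. f_equal. apply Series_ext; intros n.
    now rewrite Zb, Cplus_0_r. }
  assert (Ht : 0 < B / A) by (apply Rdiv_lt_0_compat; lra).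
  rewrite <- (sqrt_Rsqr (A + B)) by lra.
  apply sqrt_le_1_alt.
  apply Rle_trans with
    (Series (fun n => (1 + B / A) * Cmod (a n) ^ 2 + (1 + / (B / A)) * Cmod (b n) ^ 2)).
  - apply Series_le.
    + intros n; split; [apply pow2_ge_0 | now apply Cmod_add_sq].
    + apply (ex_series_plus (fun n => (1 + B / A) * Cmod (a n) ^ 2)
                            (fun n => (1 + / (B / A)) * Cmod (b n) ^ 2)).
      * now apply (ex_series_scal_l (1 + B / A) (fun n => Cmod (a n) ^ 2)).
      * now apply (ex_series_scal_l (1 + / (B / A)) (fun n => Cmod (b n) ^ 2)).
  - rewrite Series_plus.
    + rewrite !Series_scal_l, <- A2, <- B2. right; unfold Rsqr; field; lra.
    + now apply (ex_series_scal_l (1 + B / A) (fun n => Cmod (a n) ^ 2)).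
    + now apply (ex_series_scal_l (1 + / (B / A)) (fun n => Cmod (b n) ^ 2)).
Qed.

Lemma is_taylor_plus (f g : disk -> C) (a b : nat -> C) :
  is_taylor f a -> is_taylor g b ->
  is_taylor (fun z => f z + g z)%C (fun n => a n + b n)%C.
Proof. intros Hf Hg z. exact (is_pseries_plus a b _ _ _ (Hf z) (Hg z)). Qed.

Lemma is_taylor_scal (c : C) (f : disk -> C) (a : nat -> C) :
  is_taylor f a -> is_taylor (fun z => c * f z)%C (fun n => c * a n)%C.
Proof.
  intros Hf z.
  apply (@is_pseries_scal C_AbsRing C_NormedModule c a _ _ (Cmult_comm _ _) (Hf z)).
Qed.

Lemma H2_plus_prop (f g : H2) :
  exists a, square_summable a /\ is_taylor (fun z => f z + g z)%C a.
Proof.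
  exists (fun n => taylor_coef f n + taylor_coef g n)%C. split.
  - apply square_summable_plus; apply taylor_coef_l2.
  - apply is_taylor_plus; apply taylor_coef_is_taylor.
Qed.

Lemma H2_scal_prop (c : C) (f : H2) :
  exists a, square_summable a /\ is_taylor (fun z => c * f z)%C a.
Proof.
  exists (fun n => c * taylor_coef f n)%C. split.
  - apply square_summable_scal; apply taylor_coef_l2.
  - apply is_taylor_scal; apply taylor_coef_is_taylor.
Qed.

Lemma is_series_zero {K : AbsRing} {V : NormedModule K} :
  is_series (fun _ : nat => (zero : V)) zero.
Proof.
  apply (filterlim_ext (fun _ : nat => (zero : V))).
  - induction x; [now rewrite sum_O|]. now rewrite sum_Sn, <- IHx, plus_zero_l.
  - apply filterlim_const.
Qed.

Lemma H2_zero_prop :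
  exists a, square_summable a /\ is_taylor (fun _ => RtoC 0) a.
Proof.
  exists (fun _ => RtoC 0).
  split.
  - exists 0. apply is_series_ext with (fun _ => 0); 
      [|exact (is_series_zero (V := R_NormedModule))].
    intros n; rewrite Cmod_0. symmetry; apply Rmult_0_l.
  - intros z.
    apply (is_series_ext (fun _ : nat => (zero : C_NormedModule))).
    { intros n. symmetry. apply (scal_zero_r (V := C_NormedModule)). }
    apply (is_series_zero (V := C_NormedModule)).
Qed.

Definition H2_plus (f g : H2) : H2 := mkH2 (fun z => f z + g z)%C (H2_plus_prop f g).
Definition H2_scal (c : C) (f : H2) : H2 := mkH2 (fun z => c * f z)%C (H2_scal_prop c f).
Definition H2_zero : H2 := mkH2 (fun _ => RtoC 0) H2_zero_prop.
Definition H2_opp (f : H2) : H2 := H2_scal (RtoC (-1)) f.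

Lemma H2_plus_comm (f g : H2) : H2_plus f g = H2_plus g f.
Proof. apply H2_ext; intros z; simpl; ring. Qed.
Lemma H2_plus_assoc (f g h : H2) : H2_plus f (H2_plus g h) = H2_plus (H2_plus f g) h.
Proof. apply H2_ext; intros z; simpl; ring. Qed.
Lemma H2_plus_zero (f : H2) : H2_plus f H2_zero = f.
Proof. apply H2_ext; intros z; simpl; ring. Qed.
Lemma H2_plus_opp (f : H2) : H2_plus f (H2_opp f) = H2_zero.
Proof.
  apply H2_ext; intros z; simpl.
  apply injective_projections; simpl; ring.
Qed.

Definition H2_AbelianMonoid_mixin :=
  AbelianMonoid.Mixin H2 H2_plus H2_zero H2_plus_comm H2_plus_assoc H2_plus_zero.
Canonical H2_AbelianMonoid := AbelianMonoid.Pack H2 H2_AbelianMonoid_mixin H2.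

Definition H2_AbelianGroup_mixin :=
  AbelianGroup.Mixin H2_AbelianMonoid H2_opp H2_plus_opp.
Canonical H2_AbelianGroup :=
  AbelianGroup.Pack H2 (AbelianGroup.Class _ _ H2_AbelianGroup_mixin) H2.

Lemma H2_scal_assoc (x y : C) (f : H2) :
  H2_scal x (H2_scal y f) = H2_scal (x * y)%C f.
Proof. apply H2_ext; intros z; simpl; ring. Qed.
Lemma H2_scal_one (f : H2) : H2_scal (RtoC 1) f = f.
Proof. apply H2_ext; intros z; simpl; ring. Qed.
Lemma H2_scal_distr_l (x : C) (f g : H2) :
  H2_scal x (H2_plus f g) = H2_plus (H2_scal x f) (H2_scal x g).
Proof. apply H2_ext; intros z; simpl; ring. Qed.
Lemma H2_scal_distr_r (x y : C) (f : H2) :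
  H2_scal (x + y)%C f = H2_plus (H2_scal x f) (H2_scal y f).
Proof. apply H2_ext; intros z; simpl; ring. Qed.

Definition H2_ModuleSpace_mixin :=
  ModuleSpace.Mixin C_Ring H2_AbelianGroup H2_scal
    H2_scal_assoc H2_scal_one H2_scal_distr_l H2_scal_distr_r.
Canonical H2_ModuleSpace :=
  ModuleSpace.Pack C_Ring H2 (ModuleSpace.Class _ _ _ H2_ModuleSpace_mixin) H2.

Lemma H2_norm_triangle (f g : H2) : H2_norm (H2_plus f g) <= H2_norm f + H2_norm g.
Proof.
  rewrite (H2_norm_eq (H2_plus f g) (fun n => taylor_coef f n + taylor_coef g n)%C).
  - apply l2_triangle; apply taylor_coef_l2.
  - apply is_taylor_plus; apply taylor_coef_is_taylor.
Qed.

Lemma H2_norm_scal (c : C) (f : H2) : H2_norm (H2_scal c f) = Cmod c * H2_norm f.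
Proof.
  rewrite (H2_norm_eq (H2_scal c f) (fun n => c * taylor_coef f n)%C).
  - rewrite (Series_ext _ (fun n => Cmod c ^ 2 * Cmod (taylor_coef f n) ^ 2)).
    + rewrite Series_scal_l, sqrt_mult.
      * rewrite sqrt_pow2 by apply Cmod_ge_0. reflexivity.
      * apply pow2_ge_0.
      * apply Series_sq_nonneg, taylor_coef_l2.
    + intros n. rewrite Cmod_mult; ring.
  - apply is_taylor_scal; apply taylor_coef_is_taylor.
Qed.

Lemma H2_norm_definite (f : H2) : H2_norm f = 0 -> f = H2_zero.
Proof.
  intros H. apply sqrt_eq_0 in H; [|apply Series_sq_nonneg, taylor_coef_l2].
  assert (Z := Series_sq_zero _ (taylor_coef_l2 f) H).
  apply H2_ext; intros z; simpl.
  assert (T := taylor_coef_is_taylor f z).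
  apply (is_series_ext _ (fun _ : nat => (zero : C_NormedModule))) in T.
  2:{ intros n. rewrite Z. apply (scal_zero_r (V := C_NormedModule)). }
  apply (filterlim_locally_unique (F := eventually) _ _ _ T).
  apply (is_series_zero (V := C_NormedModule)).
Qed.

Definition H2_ball (f : H2) (e : R) (g : H2) : Prop := H2_norm (minus g f) < e.

Lemma H2_ball_center (f : H2) (e : posreal) : H2_ball f e f.
Proof.
  unfold H2_ball. rewrite minus_eq_zero. change (H2_norm H2_zero < e).
  replace H2_zero with (H2_scal (RtoC 0) H2_zero).
  - rewrite H2_norm_scal, Cmod_0, Rmult_0_l. apply cond_pos.
  - apply H2_ext; intros z; simpl; ring.
Qed.

Lemma H2_ball_sym (f g : H2) (e : R) : H2_ball f e g -> H2_ball g e f.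
Proof.
  unfold H2_ball. replace (minus f g) with (H2_opp (minus g f)).
  - unfold H2_opp; rewrite H2_norm_scal, Cmod_R, Rabs_left by lra.
    now replace (- (-1) * H2_norm (minus g f)) with (H2_norm (minus g f)) by ring.
  - exact (opp_minus g f).
Qed.

Lemma H2_ball_triangle (f g h : H2) (e1 e2 : R) :
  H2_ball f e1 g -> H2_ball g e2 h -> H2_ball f (e1 + e2) h.
Proof.
  unfold H2_ball; intros h1 h2. rewrite (minus_trans g h f).
  assert (T := H2_norm_triangle (minus h g) (minus g f)).
  change (H2_norm (H2_plus (minus h g) (minus g f)) < e1 + e2). lra.
Qed.

Definition H2_UniformSpace_mixin :=
  UniformSpace.Mixin H2 H2_zero H2_ball
    H2_ball_center H2_ball_sym H2_ball_triangle.
Canonical H2_UniformSpace := UniformSpace.Pack H2 H2_UniformSpace_mixin H2.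

Canonical H2_NormedModuleAux :=
  NormedModuleAux.Pack C_AbsRing H2
    (NormedModuleAux.Class C_AbsRing H2
       (ModuleSpace.class _ H2_ModuleSpace) H2_UniformSpace_mixin) H2.

Lemma H2_norm_scal_le (c : C) (f : H2) : H2_norm (H2_scal c f) <= Cmod c * H2_norm f.
Proof. right; apply H2_norm_scal. Qed.

Lemma H2_norm_ball1 (f g : H2) (e : R) : H2_norm (minus g f) < e -> H2_ball f e g.
Proof. exact (fun h => h). Qed.

Lemma H2_norm_ball2 (f g : H2) (e : posreal) :
  H2_ball f e g -> H2_norm (minus g f) < 1 * e.
Proof. now rewrite Rmult_1_l. Qed.

Definition H2_NormedModule_mixin :=
  NormedModule.Mixin C_AbsRing H2_NormedModuleAux H2_norm 1
    H2_norm_triangle H2_norm_scal_le H2_norm_ball1 H2_norm_ball2 H2_norm_definite.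
Canonical H2_NormedModule :=
  NormedModule.Pack C_AbsRing H2
    (NormedModule.Class C_AbsRing H2 _ H2_NormedModule_mixin) H2.

Section Approximation.

Context {U V : NormedModule C_AbsRing}.

(* Finite whenever [S] is bounded; [real] would send an infinite supremum to 0. *)
Definition op_norm (S : U -> V) : R :=
  real (Lub_Rbar (fun r => exists x : U, norm x <= 1 /\ r = norm (S x))).

(* Vectors are numbered from 1 to [m], and the sum is [zero] when [m = 0]. *)
Definition lin_comb (m : nat) (c : nat -> C) (v : nat -> V) : V :=
  sum_n_m (fun i => scal (c i : C_AbsRing) (v i)) 1 m.

Definition lin_indep (m : nat) (v : nat -> V) : Prop :=
  forall c : nat -> C, lin_comb m c v = zero ->
    forall i, (1 <= i <= m)%nat -> c i = RtoC 0.

Definition has_rank (T : U -> V) (m : nat) : Prop :=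
  exists v : nat -> V, lin_indep m v /\
    forall y : V, (exists x : U, T x = y) <-> (exists c : nat -> C, y = lin_comb m c v).

(* Coquelicot's [is_linear] means linear and bounded. *)
Definition approx_number (S : U -> V) (n : nat) : R :=
  real (Glb_Rbar (fun r => exists T : U -> V,
    is_linear T /\ (exists m, (m < n)%nat /\ has_rank T m) /\
    r = op_norm (fun x => minus (S x) (T x)))).

(* [Rpower 0 p] is [1] in the standard library. *)
Definition nonneg_power (x p : R) : R :=
  if Rlt_dec 0 x then Rpower x p else 0.

Definition beta_number (S : U -> V) : Rbar :=
  LimInf_seq (fun n => nonneg_power (approx_number S n) (/ INR n)).

(* The approximation numbers are indexed from 1. *)
Definition in_schatten (p : R) (S : U -> V) : Prop :=
  is_linear S /\ ex_series (fun n => nonneg_power (approx_number S (n + 1)) p).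

End Approximation.

Definition decreases_exponentially (u : nat -> R) : Prop :=
  exists K r : R, 0 < r < 1 /\ forall n, (1 <= n)%nat -> u n <= K * r ^ n.

Definition is_composition_operator (phi : disk -> disk) (S : H2 -> H2) : Prop :=
  is_linear S /\ forall (f : H2) (z : disk), S f z = f (phi z).

Definition cayley (z : C) : C := ((1 - z) / (1 + z))%C.

(* [exp (theta * Log z)] for the principal branch of the logarithm, restricted
   to [0 < Re z], where the principal argument is [atan (Im z / Re z)]. *)
Definition half_plane_power (theta : R) (z : C) : C :=
  let r := Rpower (Cmod z) theta in
  let t := theta * atan (Im z / Re z) in
  (r * cos t, r * sin t).

Definition lens_fun (theta : R) (z : C) : C :=
  cayley (half_plane_power theta (cayley z)).

Lemma cayley_disk (z : C) : Cmod z < 1 -> 0 < Re (cayley z).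
Proof.
  intros Hz. destruct z as [x y].
  assert (N : x ^ 2 + y ^ 2 < 1).
  { change (Re (x, y) ^ 2 + Im (x, y) ^ 2 < 1). rewrite <- Cmod2_alt.
    assert (0 <= Cmod (x, y)) by apply Cmod_ge_0. nra. }
  assert (D : 0 < (1 + x) ^ 2 + y ^ 2) by nra.
  replace (Re (cayley (x, y))) with ((1 - (x ^ 2 + y ^ 2)) / ((1 + x) ^ 2 + y ^ 2)).
  - apply Rdiv_lt_0_compat; lra.
  - unfold cayley, Cdiv, Cinv, Cmult, Cminus, Cplus, Copp, RtoC, Re; simpl. field.
    nra.
Qed.

Lemma cayley_half_plane (w : C) : 0 < Re w -> Cmod (cayley w) < 1.
Proof.
  intros Hw. destruct w as [x y]; simpl in Hw.
  assert (D : 0 < (1 + x) ^ 2 + y ^ 2) by nra.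
  assert (E : Cmod (cayley (x, y)) ^ 2
              = 1 - 4 * x / ((1 + x) ^ 2 + y ^ 2)).
  { rewrite Cmod2_alt.
    unfold cayley, Cdiv, Cinv, Cmult, Cminus, Cplus, Copp, RtoC, Re, Im; simpl. field.
    nra. }
  assert (0 < 4 * x / ((1 + x) ^ 2 + y ^ 2)) by (apply Rdiv_lt_0_compat; lra).
  assert (0 <= Cmod (cayley (x, y))) by apply Cmod_ge_0. nra.
Qed.

Lemma half_plane_power_Re (theta : R) (z : C) :
  0 < theta < 1 -> 0 < Re (half_plane_power theta z).
Proof.
  intros Ht. unfold half_plane_power; simpl.
  apply Rmult_lt_0_compat; [apply exp_pos|].
  destruct (atan_bound (Im z / Re z)).
  apply cos_gt_0; nra.
Qed.

Lemma lens_fun_disk (theta : R) (Htheta : 0 < theta < 1) (z : disk) :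
  Cmod (lens_fun theta (proj1_sig z)) < 1.
Proof. now apply cayley_half_plane, half_plane_power_Re. Qed.

Definition lens_map (theta : R) (Htheta : 0 < theta < 1) (z : disk) : disk :=
  exist _ (lens_fun theta (proj1_sig z)) (lens_fun_disk theta Htheta z).

(* Main.v *)
Require Import Defs.
From Stdlib Require Import Reals Lra Lia Arith FunctionalExtensionality Classical
  IndefiniteDescription.
From Coquelicot Require Import Coquelicot.

Open Scope R_scope.

(** Everything is done on Taylor coefficients, and the Cayley transform [T] turns the
    lens map into [t -> t ^ theta] on the right half-plane. Write [k_a] for the
    reproducing kernel [1 / (1 - a z)] and [b_a] for the Blaschke factor
    [(z - a) / (1 - a z)], [a] real.

    The operator is bounded because of a positivity: with
    [(1 - z) ^ theta = 1 - E z], where [E] has nonnegative coefficients of sum at most one,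
    the lens map is the odd part of [E] divided by one minus its even part, so its
    own coefficients are nonnegative of sum at most one ([lens_coefficients]). Hence it
    multiplies [H^2] contractively, and Littlewood's argument
    [f o phi = f(0) + phi (g o phi)] makes the composition a contraction
    ([composition_operator_exists]). The binomial series is identified with the
    principal power in [half_plane_power_ode] by a differential equation along rays.

    Both estimates rest on the adjoint [D_a] of the multiplication by [b_a]
    ([blaschke_adjoint]): it is a contraction, the kernels are its eigenvectors,
    [D_a k_v = b_a(v) k_v], and [f - b_a D_a f] is a multiple of [k_a].

    For the lower bound, let [u_k = T (exp (k eps))], [k = 1, ..., n], and [v_k] the images
    [T (exp (k theta eps))]. An operator of rank below [n] kills some nonzero
    [f = sum c_k k_(v_k)]. Applying [D_(v_i)] for all [i <> k] isolates [c_k], whence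
    [|c_k|] is controlled by the norm of [f] and the products of the
    [|b_(v_i)(v_k)|], while the square of the norm of [f] is
    [sum conj(c_k) f(v_k) = sum conj(c_k) (S f)(u_k)], where the values [(S f)(u_k)] are
    controlled by the norm of [S f] ([approx_number_ge_kernels]). The loss is
    [exp ((1 - theta) n eps / 2)] from the weights, [exp (8 / (theta eps))] from the
    products, and a factor [n]. With [eps] proportional to [1 / sqrt n] the
    exponent is [4 sqrt ((1 - theta) / theta) sqrt n], and [4 < PI sqrt 2] absorbs the
    factor [n] ([lens_lower_bound]).

    For the upper bound, divide [f] by the Blaschke product [B] with zeros [T (2 ^ j)],
    [- J <= j < J], each of multiplicity [J]. The remainder of the division has
    rank at most [2 J^2], and what is left is [(B o phi) (g o phi)] with [g] not larger than
    [f] in norm ([approx_number_le_blaschke]). With [p = t ^ theta] in the sector [|arg p| < theta PI / 2], the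
    square of its modulus, at most [|B|^2 / (1 - |phi|^2)] times the square of the norm of [g],
    is [O (exp (- c J))] times
    [|1 - z| ^ (- eta) + |1 + z| ^ (- eta)], for some [theta < eta < 1]: on
    [2 ^ (- J) <= |p| <= 2 ^ J] by the zeros of [B], and elsewhere because [eta > theta]
    ([dyadic_product_bound]). Since [(1 - z) ^ (- eta / 2)] and [(1 + z) ^ (- eta / 2)]
    are in [H^2], and pointwise domination implies domination of the norms
    ([domination], by Parseval's identity on roots of unity), the error is
    [O (exp (- c J / 2))] while the rank is of order [J^2] ([lens_upper_bound]). *)

(** * Square-summable sequences and the space H^2 *)

Ltac as_R := cbv beta; match goal with |- ?a = ?b => change (@eq R a b) end.
Ltac as_C := cbv beta; match goal with |- ?a = ?b => change (@eq C a b) end.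

Lemma sum_n_S_R (a : nat -> R) n : sum_n a (S n) = sum_n a n + a (S n).
Proof. rewrite sum_Sn. reflexivity. Qed.

Lemma sum_n_S_C (a : nat -> C) n : sum_n a (S n) = (sum_n a n + a (S n))%C.
Proof. rewrite sum_Sn. reflexivity. Qed.

Lemma sum_n_ext_R (a b : nat -> R) n :
  (forall k, (k <= n)%nat -> a k = b k) -> sum_n a n = sum_n b n.
Proof. apply (sum_n_ext_loc (G := R_AbelianMonoid)). Qed.

Lemma sum_n_ext_C (a b : nat -> C) n :
  (forall k, (k <= n)%nat -> a k = b k) -> sum_n a n = sum_n b n.
Proof. apply (sum_n_ext_loc (G := C_AbelianMonoid)). Qed.

Lemma sum_n_nonneg (a : nat -> R) n : (forall k, 0 <= a k) -> 0 <= sum_n a n.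
Proof.
  intros H. induction n; [rewrite sum_O; apply H|].
  rewrite sum_n_S_R. specialize (H (S n)); lra.
Qed.

Lemma sum_n_le_loc (a b : nat -> R) n :
  (forall k, (k <= n)%nat -> a k <= b k) -> sum_n a n <= sum_n b n.
Proof.
  induction n; intros H; [rewrite !sum_O; apply H; lia|].
  rewrite !sum_n_S_R. apply Rplus_le_compat; [apply IHn; intros; apply H; lia|apply H; lia].
Qed.

Lemma sum_n_fst (a : nat -> C) n : fst (sum_n a n) = sum_n (fun k => fst (a k)) n.
Proof. induction n; [now rewrite !sum_O|]. rewrite sum_n_S_C, sum_n_S_R, <- IHn. reflexivity. Qed.

Lemma sum_n_snd (a : nat -> C) n : snd (sum_n a n) = sum_n (fun k => snd (a k)) n.
Proof. induction n; [now rewrite !sum_O|]. rewrite sum_n_S_C, sum_n_S_R, <- IHn. reflexivity. Qed.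

Lemma is_series_C (a : nat -> C) (l : C) :
  is_series (fun n => fst (a n)) (fst l) -> is_series (fun n => snd (a n)) (snd l) ->
  is_series a l.
Proof.
  intros H1 H2. apply filterlim_locally; intros eps.
  assert (A1 := proj1 (filterlim_locally _ _) H1 eps).
  assert (A2 := proj1 (filterlim_locally _ _) H2 eps).
  generalize (filter_and _ _ A1 A2). apply filter_imp; intros n [B1 B2].
  rewrite <- sum_n_fst in B1. rewrite <- sum_n_snd in B2.
  split; assumption.
Qed.

Lemma is_series_C_unique (a : nat -> C) (l l' : C) :
  is_series a l -> is_series a l' -> l = l'.
Proof. intros H H'. exact (filterlim_locally_unique (F := eventually) _ _ _ H H'). Qed.

Lemma sum_n_le_series (a : nat -> R) (l : R) n :
  (forall k, 0 <= a k) -> is_series a l -> sum_n a n <= l.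
Proof.
  intros P H. apply (is_lim_seq_incr_compare (sum_n a)); [exact H|].
  intros k. rewrite sum_n_S_R. specialize (P (S k)); lra.
Qed.

Lemma sum_n_le_Series (a : nat -> R) n :
  (forall k, 0 <= a k) -> ex_series a -> sum_n a n <= Series a.
Proof. intros P H. apply sum_n_le_series; [exact P | now apply Series_correct]. Qed.

Lemma ex_series_bounded (a : nat -> R) (M : R) :
  (forall k, 0 <= a k) -> (forall n, sum_n a n <= M) -> ex_series a /\ Series a <= M.
Proof.
  intros P H.
  assert (G : ex_finite_lim_seq (sum_n a)).
  { apply ex_finite_lim_seq_incr with M; [|exact H].
    intros n. rewrite sum_n_S_R. specialize (P (S n)); lra. }
  destruct G as [l G]. assert (I : is_series a l) by exact G.
  split; [now exists l|]. rewrite (is_series_unique _ _ I).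
  apply (is_lim_seq_le (sum_n a) (fun _ => M) l M H G). apply is_lim_seq_const.
Qed.

Lemma Rabs_fst_le (z : C) : Rabs (fst z) <= Cmod z.
Proof.
  destruct z as [x y]. unfold Cmod; simpl fst; simpl snd.
  rewrite <- sqrt_Rsqr_abs. apply sqrt_le_1_alt. unfold Rsqr. nra.
Qed.

Lemma Rabs_snd_le (z : C) : Rabs (snd z) <= Cmod z.
Proof.
  destruct z as [x y]. unfold Cmod; simpl fst; simpl snd.
  rewrite <- sqrt_Rsqr_abs. apply sqrt_le_1_alt. unfold Rsqr. nra.
Qed.

Definition csum (a : nat -> C) : C :=
  (Series (fun n => fst (a n)), Series (fun n => snd (a n))).

Lemma ex_series_le_R (a b : nat -> R) :
  (forall n, Rabs (a n) <= b n) -> ex_series b -> ex_series a.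
Proof. intros H. now apply (@ex_series_le R_AbsRing R_CompleteNormedModule a b). Qed.

Lemma csum_correct (a : nat -> C) :
  ex_series (fun n => Cmod (a n)) -> is_series a (csum a).
Proof.
  intros H. apply is_series_C; apply Series_correct; eapply ex_series_le_R; try exact H;
    intros n; [apply Rabs_fst_le | apply Rabs_snd_le].
Qed.

Lemma csum_unique (a : nat -> C) l : is_series a l -> csum a = l.
Proof.
  intros H. apply is_series_C_proj in H. destruct H as [H1 H2].
  apply is_series_unique in H1, H2. unfold csum. rewrite H1, H2. now destruct l.
Qed.

Lemma Cmod_sum_n_le (a : nat -> C) n : Cmod (sum_n a n) <= sum_n (fun k => Cmod (a k)) n.
Proof. apply (norm_sum_n_m (V := C_NormedModule) a 0 n). Qed.

Lemma is_series_Cmod_le (a : nat -> C) (l : C) (M : R) :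
  is_series a l -> (forall n, sum_n (fun k => Cmod (a k)) n <= M) -> Cmod l <= M.
Proof.
  intros H B.
  assert (L : is_lim_seq (fun n => Cmod (sum_n a n)) (Cmod l)).
  { apply (filterlim_comp _ _ _ _ (@norm C_AbsRing C_NormedModule) _ _ _ H).
    exact (filterlim_norm (V := C_NormedModule) l). }
  apply (is_lim_seq_le _ (fun _ => M) _ _
    (fun n => Rle_trans _ _ _ (Cmod_sum_n_le a n) (B n)) L (is_lim_seq_const M)).
Qed.

Lemma pow_n_Cpow (z : C) n : pow_n (z : C_AbsRing) n = (z ^ n)%C.
Proof. induction n; [reflexivity|]. simpl. now rewrite IHn. Qed.

Lemma is_taylor_iff (f : disk -> C) (a : nat -> C) :
  is_taylor f a <->
  forall z : disk, is_series (fun n => a n * proj1_sig z ^ n)%C (f z).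
Proof.
  assert (E : forall (z : C) n,
      scal (pow_n (z : C_AbsRing) n) (a n : C_NormedModule) = (a n * z ^ n)%C).
  { intros z n. rewrite <- (pow_n_Cpow z n). apply Cmult_comm. }
  split; intros H z; specialize (H z); unfold is_pseries in *;
    (eapply is_series_ext; [|exact H]); intros n; [|symmetry]; apply E.
Qed.

(** The square of the norm of [H^2], read on Taylor coefficients. *)
Definition nsq (a : nat -> C) : R := Series (fun n => Cmod (a n) ^ 2).

Lemma nsq_pos a : square_summable a -> 0 <= nsq a.
Proof. apply Series_sq_nonneg. Qed.

Lemma nsq_bounded (a : nat -> C) (M : R) :
  (forall n, sum_n (fun k => Cmod (a k) ^ 2) n <= M) -> square_summable a /\ nsq a <= M.
Proof. intros H. apply ex_series_bounded; [intros; apply pow2_ge_0|exact H]. Qed.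

Lemma sum_n_le_nsq (a : nat -> C) n :
  square_summable a -> sum_n (fun k => Cmod (a k) ^ 2) n <= nsq a.
Proof. intros H. apply sum_n_le_Series; [intros; apply pow2_ge_0|exact H]. Qed.

Lemma cauchy_schwarz_sum (x y : nat -> R) n :
  (sum_n (fun k => x k * y k) n) ^ 2 <=
  sum_n (fun k => x k ^ 2) n * sum_n (fun k => y k ^ 2) n.
Proof.
  assert (P : forall (w : nat -> R) m, 0 <= sum_n (fun k => w k ^ 2) m)
    by (intros; apply sum_n_nonneg; intros; apply pow2_ge_0).
  induction n; [rewrite !sum_O; right; ring|].
  rewrite !sum_n_S_R.
  set (s := sum_n (fun k => x k * y k) n) in *.
  assert (A0 := P x n). assert (B0 := P y n).
  set (A := sum_n (fun k => x k ^ 2) n) in *. set (B := sum_n (fun k => y k ^ 2) n) in *.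
  set (u := x (S n)). set (v := y (S n)).
  (* by squaring: 4 s^2 u^2 v^2 <= 4 A B u^2 v^2 <= (A v^2 + B u^2)^2 *)
  assert (K : 2 * s * (u * v) <= A * v ^ 2 + B * u ^ 2).
  { apply Rsqr_incr_0_var.
    - unfold Rsqr.
      assert (0 <= (A * v ^ 2 - B * u ^ 2) ^ 2) by apply pow2_ge_0.
      assert (0 <= (A * B - s ^ 2) * (u * v) ^ 2)
        by (apply Rmult_le_pos; [lra|apply pow2_ge_0]).
      nra.
    - apply Rplus_le_le_0_compat; apply Rmult_le_pos; auto; apply pow2_ge_0. }
  nra.
Qed.

Lemma cauchy_schwarz_l2 (a b : nat -> C) n :
  square_summable a -> square_summable b ->
  sum_n (fun k => Cmod (a k * b k)) n <= sqrt (nsq a) * sqrt (nsq b).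
Proof.
  intros Ha Hb. rewrite <- sqrt_mult by now apply nsq_pos.
  rewrite <- (sqrt_pow2 (sum_n (fun k => Cmod (a k * b k)) n))
    by (apply sum_n_nonneg; intros; apply Cmod_ge_0).
  apply sqrt_le_1_alt.
  rewrite (sum_n_ext _ (fun k => Cmod (a k) * Cmod (b k)))
    by (intros; apply Cmod_mult).
  eapply Rle_trans; [apply cauchy_schwarz_sum|].
  apply Rmult_le_compat;
    try (apply sum_n_nonneg; intros; apply pow2_ge_0); now apply sum_n_le_nsq.
Qed.

Lemma ex_series_Cmod_mult (a b : nat -> C) :
  square_summable a -> square_summable b -> ex_series (fun k => Cmod (a k * b k)).
Proof.
  intros Ha Hb. eapply ex_series_bounded; [intros; apply Cmod_ge_0|].
  intros n. now apply cauchy_schwarz_l2.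
Qed.

Lemma is_series_cauchy_schwarz (a b : nat -> C) (l : C) :
  square_summable a -> square_summable b ->
  is_series (fun k => a k * b k)%C l -> Cmod l <= sqrt (nsq a) * sqrt (nsq b).
Proof.
  intros Ha Hb H. apply (is_series_Cmod_le _ _ _ H). intros; now apply cauchy_schwarz_l2.
Qed.

Lemma is_series_sq_geom (z : C) : Cmod z < 1 ->
  is_series (fun n => Cmod (z ^ n) ^ 2) (/ (1 - Cmod z ^ 2)).
Proof.
  intros Hz. assert (0 <= Cmod z) by apply Cmod_ge_0.
  apply is_series_ext with (fun n => (Cmod z ^ 2) ^ n).
  - intros n. rewrite Cmod_pow, <- !pow_mult. f_equal. lia.
  - apply is_series_geom. rewrite Rabs_pos_eq by apply pow2_ge_0. nra.
Qed.

Lemma square_summable_geom (z : C) : Cmod z < 1 -> square_summable (fun n => z ^ n)%C.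
Proof. intros Hz. eexists. now apply is_series_sq_geom. Qed.

Lemma nsq_geom (z : C) : Cmod z < 1 -> nsq (fun n => z ^ n)%C = / (1 - Cmod z ^ 2).
Proof. intros Hz. now apply is_series_unique, is_series_sq_geom. Qed.

Lemma l2_series_correct (a : nat -> C) (z : C) :
  square_summable a -> Cmod z < 1 ->
  is_series (fun n => a n * z ^ n)%C (csum (fun n => a n * z ^ n)%C).
Proof.
  intros Ha Hz. apply csum_correct, ex_series_Cmod_mult; [exact Ha|].
  now apply square_summable_geom.
Qed.

Lemma H2_of_prop (a : nat -> C) (Ha : square_summable a) :
  exists b, square_summable b /\
    is_taylor (fun z => csum (fun n => a n * proj1_sig z ^ n)%C) b.
Proof.
  exists a. split; [exact Ha|]. apply is_taylor_iff. intros [z Hz]; simpl.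
  now apply l2_series_correct.
Qed.

Definition H2_of (a : nat -> C) (Ha : square_summable a) : H2 := mkH2 _ (H2_of_prop a Ha).

Lemma taylor_coef_unique (f : H2) (a : nat -> C) : is_taylor f a -> taylor_coef f = a.
Proof.
  intros H. apply functional_extensionality.
  apply (is_taylor_unique f); [apply taylor_coef_is_taylor|exact H].
Qed.

Lemma taylor_coef_H2_of a Ha : taylor_coef (H2_of a Ha) = a.
Proof.
  apply taylor_coef_unique, is_taylor_iff. intros [z Hz]; simpl. now apply l2_series_correct.
Qed.

Lemma taylor_coef_plus (f g : H2) :
  taylor_coef (plus f g) = fun n => (taylor_coef f n + taylor_coef g n)%C.
Proof. apply taylor_coef_unique. apply is_taylor_plus; apply taylor_coef_is_taylor. Qed.

Lemma taylor_coef_scal (c : C_AbsRing) (f : H2) :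
  taylor_coef (scal c f) = fun n => (c * taylor_coef f n)%C.
Proof. apply taylor_coef_unique. apply is_taylor_scal; apply taylor_coef_is_taylor. Qed.

Lemma H2_series (f : H2) (z : disk) :
  is_series (fun n => taylor_coef f n * proj1_sig z ^ n)%C (f z).
Proof. revert z. apply is_taylor_iff, taylor_coef_is_taylor. Qed.

Lemma H2_eq_coef (f g : H2) : taylor_coef f = taylor_coef g -> f = g.
Proof.
  intros E. apply H2_ext; intros z. eapply is_series_C_unique; [apply H2_series|].
  rewrite E. apply H2_series.
Qed.

Lemma H2_norm_nsq (f : H2) : H2_norm f = sqrt (nsq (taylor_coef f)).
Proof. reflexivity. Qed.

Lemma H2_norm_pos (f : H2) : 0 <= H2_norm f.
Proof. apply sqrt_pos. Qed.

Lemma H2_norm_sq (f : H2) : H2_norm f ^ 2 = nsq (taylor_coef f).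
Proof. rewrite H2_norm_nsq. apply pow2_sqrt, nsq_pos, taylor_coef_l2. Qed.

Lemma H2_pointwise (f : H2) (z : disk) :
  Cmod (f z) ^ 2 <= H2_norm f ^ 2 / (1 - Cmod (proj1_sig z) ^ 2).
Proof.
  destruct z as [z Hz]. simpl proj1_sig.
  assert (B := is_series_cauchy_schwarz _ _ _ (taylor_coef_l2 f)
    (square_summable_geom z Hz) (H2_series f (exist _ z Hz))).
  rewrite nsq_geom, <- H2_norm_nsq in B by exact Hz.
  assert (0 <= Cmod z) by apply Cmod_ge_0.
  assert (0 < / (1 - Cmod z ^ 2)) by (apply Rinv_0_lt_compat; nra).
  apply Rle_trans with ((H2_norm f * sqrt (/ (1 - Cmod z ^ 2))) ^ 2).
  - apply pow_incr. split; [apply Cmod_ge_0|exact B].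
  - rewrite Rpow_mult_distr, pow2_sqrt by lra. right; reflexivity.
Qed.

(** * Convolution *)

Lemma sum_n_Rmult_l (c : R) (x : nat -> R) n : sum_n (fun k => c * x k) n = c * sum_n x n.
Proof. apply (sum_n_mult_l (K := R_Ring)). Qed.

Lemma sum_n_Cmult_l (c : C) (x : nat -> C) n :
  sum_n (fun k => c * x k)%C n = (c * sum_n x n)%C.
Proof. apply (sum_n_mult_l (K := C_Ring)). Qed.

Lemma sum_n_Rplus (x y : nat -> R) n : sum_n (fun k => x k + y k) n = sum_n x n + sum_n y n.
Proof. apply (sum_n_plus (G := R_AbelianMonoid)). Qed.

Lemma sum_n_Rminus (x y : nat -> R) n : sum_n (fun k => x k - y k) n = sum_n x n - sum_n y n.
Proof.
  rewrite (sum_n_ext_R _ (fun k => x k + (-1) * y k)) by (intros; ring).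
  rewrite sum_n_Rplus, sum_n_Rmult_l. as_R; ring.
Qed.

Lemma sum_n_Cplus (x y : nat -> C) n :
  sum_n (fun k => x k + y k)%C n = (sum_n x n + sum_n y n)%C.
Proof. apply (sum_n_plus (G := C_AbelianMonoid)). Qed.

Lemma sum_n_conv_R (x y : nat -> R) N :
  sum_n (fun n => sum_n (fun k => x k * y (n - k)%nat) n) N =
  sum_n (fun k => x k * sum_n y (N - k)) N.
Proof.
  induction N; [now rewrite !sum_O|].
  rewrite sum_n_S_R, IHN, !sum_n_S_R, Nat.sub_diag, sum_O, <- Rplus_assoc. f_equal.
  rewrite <- sum_n_Rplus. apply sum_n_ext_R. intros k Hk.
  rewrite (Nat.sub_succ_l k N Hk), sum_n_S_R. ring.
Qed.

Lemma sum_n_conv_le (x y : nat -> R) N :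
  (forall k, 0 <= x k) -> (forall k, 0 <= y k) ->
  sum_n (fun n => sum_n (fun k => x k * y (n - k)%nat) n) N <= sum_n x N * sum_n y N.
Proof.
  intros Hx Hy. rewrite sum_n_conv_R.
  rewrite (Rmult_comm (sum_n x N)), <- sum_n_Rmult_l.
  apply sum_n_le_loc. intros k Hk. rewrite Rmult_comm.
  apply Rmult_le_compat_r; [apply Hx|].
  generalize (Nat.le_sub_l N k). generalize (N - k)%nat. clear Hk. intros m Hm.
  induction Hm; [lra|]. rewrite sum_n_S_R. specialize (Hy (S m0)). lra.
Qed.

Definition conv (a b : nat -> C) (n : nat) : C :=
  sum_n (fun k => a k * b (n - k)%nat)%C n.

Definition l1_le (a : nat -> C) (A : R) : Prop :=
  forall n, sum_n (fun k => Cmod (a k)) n <= A.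

Lemma weighted_cauchy_schwarz (x w : nat -> R) n : (forall k, 0 <= x k) ->
  (sum_n (fun k => x k * w k) n) ^ 2 <= sum_n x n * sum_n (fun k => x k * w k ^ 2) n.
Proof.
  intros Hx.
  assert (C := cauchy_schwarz_sum (fun k => sqrt (x k)) (fun k => sqrt (x k) * w k) n).
  cbv beta in C.
  rewrite (sum_n_ext_R (fun k => sqrt (x k) * (sqrt (x k) * w k)) (fun k => x k * w k)) in C.
  2:{ intros k _. rewrite <- Rmult_assoc, sqrt_sqrt; auto. }
  rewrite (sum_n_ext_R (fun k => sqrt (x k) ^ 2) x) in C by (intros; now apply pow2_sqrt).
  rewrite (sum_n_ext_R (fun k => (sqrt (x k) * w k) ^ 2) (fun k => x k * w k ^ 2)) in C.
  2:{ intros k _. now rewrite Rpow_mult_distr, pow2_sqrt. }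
  exact C.
Qed.

(** Young's inequality: [a * b] is an average of shifts of [b] with weights [a], so
    weighting Cauchy-Schwarz by [a] costs one factor [A], and summing the
    shifts costs the other. *)
Lemma conv_l2 (a b : nat -> C) (A : R) :
  l1_le a A -> square_summable b ->
  square_summable (conv a b) /\ nsq (conv a b) <= A ^ 2 * nsq b.
Proof.
  intros Ha Hb.
  assert (A0 : 0 <= A).
  { apply Rle_trans with (2 := Ha 0%nat). rewrite sum_O. apply Cmod_ge_0. }
  apply nsq_bounded. intros N.
  apply Rle_trans with (sum_n (fun n => A *
    sum_n (fun k => Cmod (a k) * (fun m => Cmod (b m) ^ 2) (n - k)%nat) n) N).
  - apply sum_n_le_loc. intros n _. unfold conv.
    apply Rle_trans with ((sum_n (fun k => Cmod (a k) * Cmod (b (n - k)%nat)) n) ^ 2).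
    + apply pow_incr. split; [apply Cmod_ge_0|].
      eapply Rle_trans; [apply Cmod_sum_n_le|]. right. apply sum_n_ext.
      intros; apply Cmod_mult.
    + eapply Rle_trans; [apply (weighted_cauchy_schwarz (fun k => Cmod (a k))
        (fun k => Cmod (b (n - k)%nat))); intros; apply Cmod_ge_0|].
      apply Rmult_le_compat_r; [|apply Ha].
      apply sum_n_nonneg. intros k. apply Rmult_le_pos; [apply Cmod_ge_0|apply pow2_ge_0].
  - rewrite sum_n_Rmult_l.
    replace (A ^ 2 * nsq b) with (A * (A * nsq b)) by ring.
    apply Rmult_le_compat_l; [exact A0|].
    eapply Rle_trans; [apply (sum_n_conv_le (fun k => Cmod (a k))
      (fun m => Cmod (b m) ^ 2)); intros; [apply Cmod_ge_0|apply pow2_ge_0]|].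
    apply Rmult_le_compat; [apply sum_n_nonneg; intros; apply Cmod_ge_0
      |apply sum_n_nonneg; intros; apply pow2_ge_0|apply Ha|now apply sum_n_le_nsq].
Qed.

Lemma is_series_conv (a b : nat -> C) (la lb : C) :
  is_series a la -> is_series b lb ->
  ex_series (fun n => Cmod (a n)) -> ex_series (fun n => Cmod (b n)) ->
  is_series (conv a b) (la * lb)%C.
Proof.
  intros Ha Hb Aa Ab.
  apply is_series_C_proj in Ha, Hb. destruct Ha as [a1 a2], Hb as [b1 b2].
  assert (R1 : forall c : nat -> C, ex_series (fun n => Cmod (c n)) ->
    ex_series (fun n => Rabs (fst (c n))) /\ ex_series (fun n => Rabs (snd (c n)))).
  { intros c Hc. split; eapply ex_series_le_R; try exact Hc; intros n;
      rewrite Rabs_Rabsolu; [apply Rabs_fst_le|apply Rabs_snd_le]. }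
  destruct (R1 a Aa) as [A1 A2], (R1 b Ab) as [B1 B2].
  assert (S11 := is_series_mult _ _ _ _ a1 b1 A1 B1).
  assert (S22 := is_series_mult _ _ _ _ a2 b2 A2 B2).
  assert (S12 := is_series_mult _ _ _ _ a1 b2 A1 B2).
  assert (S21 := is_series_mult _ _ _ _ a2 b1 A2 B1).
  apply is_series_C.
  - apply (is_series_ext (V := R_NormedModule)) with (2 := is_series_minus _ _ _ _ S11 S22).
    intros n. unfold conv. rewrite sum_n_fst, <- !sum_n_Reals. symmetry.
    apply (sum_n_Rminus (fun k => fst (a k) * fst (b (n - k)%nat))
      (fun k => snd (a k) * snd (b (n - k)%nat)) n).
  - apply (is_series_ext (V := R_NormedModule)) with (2 := is_series_plus _ _ _ _ S12 S21).
    intros n. unfold conv. rewrite sum_n_snd, <- !sum_n_Reals. symmetry.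
    apply (sum_n_Rplus (fun k => fst (a k) * snd (b (n - k)%nat))
      (fun k => snd (a k) * fst (b (n - k)%nat)) n).
Qed.

Lemma conv_pow (a b : nat -> C) (z : C) n :
  conv (fun k => a k * z ^ k)%C (fun k => b k * z ^ k)%C n = (conv a b n * z ^ n)%C.
Proof.
  unfold conv.
  rewrite (sum_n_ext_C _ (fun k => (z ^ n * (a k * b (n - k)%nat))%C)).
  - rewrite sum_n_Cmult_l. apply Cmult_comm.
  - intros k Hk. replace (z ^ n)%C with (z ^ k * z ^ (n - k))%C.
    + ring.
    + rewrite <- Cpow_add_r. f_equal. lia.
Qed.

Lemma ex_series_l1 (a : nat -> C) A : l1_le a A -> ex_series (fun n => Cmod (a n)).
Proof. intros H. eapply ex_series_bounded; [intros; apply Cmod_ge_0|exact H]. Qed.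

Lemma ex_series_l1_pow (a : nat -> C) A z :
  l1_le a A -> Cmod z <= 1 -> ex_series (fun n => Cmod (a n * z ^ n)%C).
Proof.
  intros H Hz. eapply ex_series_le_R; [|exact (ex_series_l1 _ _ H)].
  intros n. rewrite Rabs_pos_eq by apply Cmod_ge_0.
  rewrite Cmod_mult, Cmod_pow.
  assert (0 <= Cmod (a n)) by apply Cmod_ge_0.
  assert (Cmod z ^ n <= 1).
  { rewrite <- (pow1 n). apply pow_incr. split; [apply Cmod_ge_0|exact Hz]. }
  nra.
Qed.

Lemma l1_series_correct (a : nat -> C) A z : l1_le a A -> Cmod z <= 1 ->
  is_series (fun n => a n * z ^ n)%C (csum (fun n => a n * z ^ n)%C).
Proof. intros H Hz. apply csum_correct. eapply ex_series_l1_pow; eassumption. Qed.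

Lemma is_series_mult_pow (a b : nat -> C) (A B z : C) :
  ex_series (fun n => Cmod (a n * z ^ n)%C) -> ex_series (fun n => Cmod (b n * z ^ n)%C) ->
  is_series (fun n => a n * z ^ n)%C A -> is_series (fun n => b n * z ^ n)%C B ->
  is_series (fun n => conv a b n * z ^ n)%C (A * B)%C.
Proof.
  intros Ea Eb Ha Hb. eapply is_series_ext; [|exact (is_series_conv _ _ _ _ Ha Hb Ea Eb)].
  intros n. apply conv_pow.
Qed.

Lemma ex_series_l2_pow (a : nat -> C) z :
  square_summable a -> Cmod z < 1 -> ex_series (fun n => Cmod (a n * z ^ n)%C).
Proof. intros Ha Hz. apply ex_series_Cmod_mult; [exact Ha|now apply square_summable_geom]. Qed.

Lemma is_taylor_mult (u g : disk -> C) (a b : nat -> C) (A : R) :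
  l1_le a A -> square_summable b -> is_taylor u a -> is_taylor g b ->
  is_taylor (fun z => u z * g z)%C (conv a b).
Proof.
  intros Ha Hb Hu Hg. apply is_taylor_iff. intros z.
  apply is_series_mult_pow.
  - eapply ex_series_l1_pow; [exact Ha|]. left; exact (proj2_sig z).
  - apply ex_series_l2_pow; [exact Hb|exact (proj2_sig z)].
  - now apply is_taylor_iff.
  - now apply is_taylor_iff.
Qed.

(** * Powers on the right half-plane *)

Lemma polar_atan (u : C) : 0 < Re u ->
  u = (Cmod u * cos (atan (Im u / Re u)), Cmod u * sin (atan (Im u / Re u))).
Proof.
  destruct u as [x y]; simpl; intros Hx. rewrite cos_atan, sin_atan.
  assert (E : Cmod (x, y) = x * sqrt (1 + (y / x)²)).
  { unfold Cmod; simpl fst; simpl snd.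
    rewrite <- (sqrt_pow2 x) at 2 by lra. rewrite <- sqrt_mult_alt by apply pow2_ge_0.
    f_equal. unfold Rsqr. field. lra. }
  assert (0 < sqrt (1 + (y / x)²)).
  { apply sqrt_lt_R0. assert (0 <= (y / x)²) by apply Rle_0_sqr. lra. }
  rewrite E. apply injective_projections; simpl; field; lra.
Qed.

(** The principal branch is not multiplicative in general. Here the two
    arguments differ by less than [PI], and the quotient lies in the half-plane, so
    their difference is again in [(- PI / 2, PI / 2)]: it is the principal argument of
    the quotient. *)
Lemma half_plane_power_div (s : R) (u v : C) : 0 < Re u -> 0 < Re v -> 0 < Re (u / v)%C ->
  half_plane_power s (u / v)%C = (half_plane_power s u / half_plane_power s v)%C.
Proof.
  intros Hu Hv Huv.
  assert (Pu := polar_atan u Hu). assert (Pv := polar_atan v Hv).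
  assert (u0 : u <> 0) by (intros ->; simpl in Hu; lra).
  assert (v0 : v <> 0) by (intros ->; simpl in Hv; lra).
  apply Cmod_gt_0 in u0. assert (v1 := v0). apply Cmod_gt_0 in v1.
  assert (Ec : Cmod (u / v) = Cmod u / Cmod v) by now apply Cmod_div.
  set (a := atan (Im u / Re u)) in *. set (b := atan (Im v / Re v)) in *.
  assert (Bound : - PI < a - b < PI).
  { unfold a, b. destruct (atan_bound (Im u / Re u)), (atan_bound (Im v / Re v)). lra. }
  assert (P : (u / v)%C = (Cmod u / Cmod v * cos (a - b), Cmod u / Cmod v * sin (a - b))).
  { rewrite Pu at 1. rewrite Pv at 1. rewrite cos_minus, sin_minus.
    assert (S : sin b * sin b = 1 - cos b * cos b)
      by (assert (T := sin2_cos2 b); unfold Rsqr in T; lra).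
    unfold Cdiv, Cinv, Cmult; simpl.
    replace (Cmod v * cos b * (Cmod v * cos b * 1) + Cmod v * sin b * (Cmod v * sin b * 1))
      with (Cmod v * Cmod v).
    2:{ replace (Cmod v * Cmod v) with (Cmod v * Cmod v * (cos b * cos b + (1 - cos b * cos b)))
          by ring. rewrite <- S. ring. }
    apply injective_projections; simpl; field; lra. }
  assert (Cp : 0 < cos (a - b)).
  { rewrite P in Huv. simpl in Huv.
    assert (0 < Cmod u / Cmod v) by (apply Rdiv_lt_0_compat; lra). nra. }
  assert (D : - (PI / 2) < a - b < PI / 2).
  { split; apply Rnot_le_lt; intros h.
    - assert (cos (- (a - b)) <= 0) by (apply cos_le_0; lra). rewrite cos_neg in H. lra.
    - assert (cos (a - b) <= 0) by (apply cos_le_0; lra). lra. }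
  assert (A : atan (Im (u / v)%C / Re (u / v)%C) = a - b).
  { rewrite P. simpl. transitivity (atan (tan (a - b))); [|apply atan_tan; lra]. f_equal.
    unfold tan. field. repeat split; lra. }
  unfold half_plane_power. rewrite A, Ec. fold a b.
  rewrite Rmult_minus_distr_l.
  assert (E : Rpower (Cmod u / Cmod v) s = Rpower (Cmod u) s / Rpower (Cmod v) s).
  { unfold Rpower. rewrite ln_div by lra.
    rewrite Rmult_minus_distr_l. unfold Rminus. rewrite exp_plus, exp_Ropp. reflexivity. }
  rewrite E, cos_minus, sin_minus.
  assert (0 < Rpower (Cmod v) s) by apply exp_pos.
  set (ru := Rpower (Cmod u) s) in *. set (rv := Rpower (Cmod v) s) in *.
  set (sa := s * a). set (sb := s * b).
  assert (S : sin sb * sin sb = 1 - cos sb * cos sb)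
    by (assert (T := sin2_cos2 sb); unfold Rsqr in T; lra).
  unfold Cdiv, Cinv, Cmult; simpl.
  replace (rv * cos sb * (rv * cos sb * 1) + rv * sin sb * (rv * sin sb * 1)) with (rv * rv).
  2:{ replace (rv * rv) with (rv * rv * (cos sb * cos sb + (1 - cos sb * cos sb))) by ring.
      rewrite <- S. ring. }
  apply injective_projections; simpl; field; lra.
Qed.

Lemma Cmod_half_plane_power (s : R) (u : C) : Cmod (half_plane_power s u) = Rpower (Cmod u) s.
Proof.
  unfold half_plane_power. set (t := s * _).
  assert (0 < Rpower (Cmod u) s) by apply exp_pos. set (r := Rpower (Cmod u) s) in *.
  unfold Cmod; simpl fst; simpl snd.
  replace ((r * cos t) ^ 2 + (r * sin t) ^ 2) with (r ^ 2).
  - apply sqrt_pow2; lra.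
  - assert (T := sin2_cos2 t). unfold Rsqr in T.
    transitivity (r ^ 2 * (sin t * sin t + cos t * cos t)); [rewrite T|]; ring.
Qed.

Lemma half_plane_power_neq_0 (s : R) (u : C) : half_plane_power s u <> 0.
Proof. apply Cmod_gt_0. rewrite Cmod_half_plane_power. apply exp_pos. Qed.

Ltac rewrite_derive d := match type of d with
  | is_derive ?f ?x ?l => rewrite (is_derive_unique (fun y : R => f y) x l d) end.

(** Along a path [u = (X, Y)] in the half-plane, [u ^ s] is the only solution of
    [p' = s (u' / u) p] with its initial value, since [p u ^ (- s)] has
    derivative zero. The real form below has [(X X' + Y Y') / |u|^2] and
    [(Y' X - X' Y) / |u|^2] for the two components of [u' / u]. *)
Lemma half_plane_power_ode (s : R) (X Y A B dX dY dA dB : R -> R) :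
  (forall x, 0 <= x <= 1 -> 0 < X x) ->
  (forall x, 0 <= x <= 1 -> is_derive X x (dX x) /\ is_derive Y x (dY x)) ->
  (forall x, 0 <= x <= 1 -> is_derive A x (dA x) /\ is_derive B x (dB x)) ->
  (forall x, 0 <= x <= 1 -> ((dA x, dB x) * (X x, Y x) = s * ((dX x, dY x) * (A x, B x)))%C) ->
  (A 0, B 0) = half_plane_power s (X 0, Y 0) ->
  (A 1, B 1) = half_plane_power s (X 1, Y 1).
Proof.
  intros HX DX DA E E0.
  set (L := fun x => / 2 * ln (X x ^ 2 + Y x ^ 2)).
  set (T := fun x => atan (Y x / X x)).
  set (G1 := fun x => exp (- s * L x) * (A x * cos (s * T x) + B x * sin (s * T x))).
  set (G2 := fun x => exp (- s * L x) * (B x * cos (s * T x) - A x * sin (s * T x))).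
  assert (H : forall x, 0 <= x <= 1 -> half_plane_power s (X x, Y x) =
    (exp (s * L x) * cos (s * T x), exp (s * L x) * sin (s * T x))).
  { intros x Hx. unfold half_plane_power. simpl.
    assert (P := HX x Hx).
    assert (LE : Rpower (Cmod (X x, Y x)) s = exp (s * L x)).
    { unfold Rpower, L, Cmod. simpl fst; simpl snd.
      assert (0 < X x ^ 2 + Y x ^ 2) by nra.
      rewrite <- (sqrt_sqrt (X x ^ 2 + Y x ^ 2)) at 2 by lra.
      rewrite ln_mult by (apply sqrt_lt_R0; lra). f_equal. field. }
    rewrite LE. reflexivity. }
  assert (Dz : forall x, 0 <= x <= 1 -> is_derive G1 x 0 /\ is_derive G2 x 0).
  { intros x Hx. assert (P := HX x Hx).
    destruct (DX x Hx) as [d1 d2]. destruct (DA x Hx) as [d3 d4]. specialize (E x Hx).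
    assert (Q : 0 < X x ^ 2 + Y x ^ 2) by nra.
    apply (f_equal (fun z : C => (fst z, snd z))) in E. simpl in E.
    injection E as E1 E2.
    set (l := (X x * dX x + Y x * dY x) / (X x ^ 2 + Y x ^ 2)).
    set (t := (dY x * X x - dX x * Y x) / (X x ^ 2 + Y x ^ 2)).
    assert (dL : is_derive L x l).
    { unfold L. auto_derive.
      - repeat split; [now exists (dX x)|now exists (dY x)|]. simpl in Q. lra.
      - rewrite_derive d1; rewrite_derive d2. unfold l. field. lra. }
    assert (dT : is_derive T x t).
    { unfold T. auto_derive.
      - repeat split; [now exists (dY x)|now exists (dX x)|]. lra.
      - rewrite_derive d1; rewrite_derive d2. unfold t, Rsqr.
        field. split; [|lra]. nra. }
    assert (F1 : dA x = s * (l * A x - t * B x)).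
    { unfold l, t. apply (Rmult_eq_reg_r (X x ^ 2 + Y x ^ 2)); [|lra].
      transitivity ((dA x * X x - dB x * Y x) * X x + (dA x * Y x + dB x * X x) * Y x);
        [ring|rewrite E1, E2; field; lra]. }
    assert (F2 : dB x = s * (l * B x + t * A x)).
    { unfold l, t. apply (Rmult_eq_reg_r (X x ^ 2 + Y x ^ 2)); [|lra].
      transitivity ((dA x * Y x + dB x * X x) * X x - (dA x * X x - dB x * Y x) * Y x);
        [ring|rewrite E1, E2; field; lra]. }
    split; [unfold G1|unfold G2]; auto_derive;
      try (repeat split; eexists; eassumption);
      rewrite_derive dL; rewrite_derive dT; rewrite_derive d3; rewrite_derive d4;
      rewrite F1, F2; ring. }
  assert (C1 : G1 0 = G1 1).
  { apply (eq_is_derive (V := R_NormedModule)); [intros t Ht; apply (Dz t Ht)|lra]. }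
  assert (C2 : G2 0 = G2 1).
  { apply (eq_is_derive (V := R_NormedModule)); [intros t Ht; apply (Dz t Ht)|lra]. }
  rewrite H in E0 |- * by lra.
  injection E0 as A0 B0.
  assert (S : forall t, sin t * sin t + cos t * cos t = 1)
    by (intros t; exact (sin2_cos2 t)).
  assert (EE : forall x, exp (- s * L x) * exp (s * L x) = 1).
  { intros x. rewrite <- exp_plus, <- exp_0. f_equal. ring. }
  assert (G10 : G1 0 = 1).
  { unfold G1. rewrite A0, B0.
    transitivity (exp (- s * L 0) * exp (s * L 0) *
      (sin (s * T 0) * sin (s * T 0) + cos (s * T 0) * cos (s * T 0))); [ring|].
    rewrite S, EE. ring. }
  assert (G20 : G2 0 = 0) by (unfold G2; rewrite A0, B0; ring).
  rewrite G10 in C1. rewrite G20 in C2. unfold G1, G2 in C1, C2.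
  set (c := cos (s * T 1)) in *. set (o := sin (s * T 1)) in *.
  assert (S1 := S (s * T 1)). fold c o in S1. specialize (EE 1).
  set (e := exp (- s * L 1)) in *. set (e' := exp (s * L 1)) in *.
  f_equal.
  - transitivity (e' * (e * (A 1 * c + B 1 * o)) * c - e' * (e * (B 1 * c - A 1 * o)) * o).
    + transitivity (e * e' * (o * o + c * c) * A 1); [rewrite S1, EE|]; ring.
    + rewrite <- C1, <- C2. ring.
  - transitivity (e' * (e * (A 1 * c + B 1 * o)) * o + e' * (e * (B 1 * c - A 1 * o)) * c).
    + transitivity (e * e' * (o * o + c * c) * B 1); [rewrite S1, EE|]; ring.
    + rewrite <- C1, <- C2. ring.
Qed.

(** * Binomial series *)

(** The Taylor coefficients of [(1 - z) ^ s]. *)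
Fixpoint binomial_coef (s : R) (n : nat) : R :=
  match n with O => 1 | S m => binomial_coef s m * ((INR m - s) / (INR m + 1)) end.

Lemma binomial_coef_S s n : (INR n + 1) * binomial_coef s (S n) = (INR n - s) * binomial_coef s n.
Proof. assert (P := pos_INR n). simpl. field. lra. Qed.

Lemma binomial_coef_le_1 s n : -1 <= s <= 1 -> Rabs (binomial_coef s n) <= 1.
Proof.
  intros Hs. induction n; [simpl; rewrite Rabs_R1; lra|].
  assert (P := pos_INR n). simpl. rewrite Rabs_mult.
  assert (Rabs ((INR n - s) / (INR n + 1)) <= 1).
  { unfold Rdiv. rewrite Rabs_mult, Rabs_inv, (Rabs_pos_eq (INR n + 1)) by lra.
    apply (Rmult_le_reg_r (INR n + 1)); [lra|]. rewrite Rmult_assoc, Rinv_l by lra.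
    rewrite !Rmult_1_r, Rmult_1_l. destruct n.
    - simpl. apply Rabs_le. lra.
    - rewrite S_INR in *. assert (Q := pos_INR n). apply Rabs_le. lra. }
  assert (0 <= Rabs ((INR n - s) / (INR n + 1))) by apply Rabs_pos.
  assert (0 <= Rabs (binomial_coef s n)) by apply Rabs_pos. nra.
Qed.

Lemma CV_radius_geom (a : nat -> R) (q x : R) :
  0 <= q < 1 -> (forall n, Rabs (a n) <= q ^ n) -> Rabs x <= 1 ->
  Rbar_lt (Rabs x) (CV_radius a).
Proof.
  intros Hq Ha Hx. set (r := 2 / (1 + q)).
  assert (Hr : 1 < r) by (apply (Rmult_lt_reg_r (1 + q)); [lra|]; unfold r; field_simplify; lra).
  apply Rbar_lt_le_trans with (Finite r); [simpl; lra|].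
  apply (proj1 (CV_radius_bounded a)). exists 1. intros n.
  rewrite Rabs_mult, <- RPow_abs, (Rabs_pos_eq r) by lra.
  apply Rle_trans with (q ^ n * r ^ n).
  - apply Rmult_le_compat_r; [apply pow_le; lra|apply Ha].
  - rewrite <- Rpow_mult_distr, <- (pow1 n). apply pow_incr. split; [nra|].
    unfold r. apply (Rmult_le_reg_r (1 + q)); [lra|]. field_simplify; lra.
Qed.

Lemma is_series_C_lin (u v u' v' w : nat -> R) (x y s a b a' b' : R) :
  is_series u a -> is_series v b -> is_series u' a' -> is_series v' b' ->
  (forall n, w n = x * (u' n - s * u n) + y * (v' n - s * v n)) ->
  is_series w (x * (a' - s * a) + y * (b' - s * b)).
Proof.
  intros Hu Hv Hu' Hv' E.
  apply (is_series_ext (fun n => x * (u' n - s * u n) + y * (v' n - s * v n)));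
    [intros; now symmetry|].
  apply (is_series_plus (V := R_NormedModule) (fun n => x * (u' n - s * u n)));
    [apply (is_series_scal (V := R_NormedModule) x (fun n => u' n - s * u n))
    |apply (is_series_scal (V := R_NormedModule) y (fun n => v' n - s * v n))];
    apply (is_series_minus (V := R_NormedModule)); try assumption;
    now apply (is_series_scal (V := R_NormedModule) s).
Qed.

(** The binomial series solves [(1 - z) p' = - s p], and along the ray through [z]
    this is the equation that characterizes [(1 - z) ^ s]. *)
Lemma binomial_series (s : R) (z : C) : -1 <= s <= 1 -> Cmod z < 1 ->
  is_series (fun n => RtoC (binomial_coef s n) * z ^ n)%C (half_plane_power s (1 - z)).
Proof.
  intros Hs Hz. assert (Z0 : 0 <= Cmod z) by apply Cmod_ge_0.
  set (A := fun n => binomial_coef s n * fst (z ^ n)%C). set (B := fun n => binomial_coef s n * snd (z ^ n)%C).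
  assert (bA : forall n, Rabs (A n) <= Cmod z ^ n /\ Rabs (B n) <= Cmod z ^ n).
  { intros n. unfold A, B. rewrite !Rabs_mult, <- Cmod_pow.
    assert (h := binomial_coef_le_1 s n Hs). assert (h1 := Rabs_fst_le (z ^ n)%C).
    assert (h2 := Rabs_snd_le (z ^ n)%C).
    assert (0 <= Rabs (binomial_coef s n)) by apply Rabs_pos.
    assert (0 <= Rabs (fst (z ^ n)%C)) by apply Rabs_pos.
    assert (0 <= Rabs (snd (z ^ n)%C)) by apply Rabs_pos. split; nra. }
  assert (cA : forall x, Rabs x <= 1 -> Rbar_lt (Rabs x) (CV_radius A))
    by (intros x; apply (CV_radius_geom A (Cmod z)); [lra|apply bA]).
  assert (cB : forall x, Rabs x <= 1 -> Rbar_lt (Rabs x) (CV_radius B))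
    by (intros x; apply (CV_radius_geom B (Cmod z)); [lra|apply bA]).
  assert (SV : forall a x, Rbar_lt (Rabs x) (CV_radius a) ->
     is_series (fun n => a n * x ^ n) (PSeries a x)).
  { intros a x Hx. apply is_pseries_R, PSeries_correct, CV_radius_inside, Hx. }
  assert (SD : forall a x, Rbar_lt (Rabs x) (CV_radius a) ->
     is_series (fun n => INR n * a n * x ^ n) (x * PSeries (PS_derive a) x)).
  { intros a x Hx. apply (is_series_decr_1 (V := R_NormedModule)).
    replace (plus _ _) with (scal x (PSeries (PS_derive a) x)).
    2:{ unfold plus, opp, scal; simpl. unfold mult; simpl. ring. }
    apply is_series_ext with (fun n => scal x (PS_derive a n * x ^ n)).
    { intros n. unfold PS_derive, scal; simpl. unfold mult; simpl. ring. }
    apply (is_series_scal (V := R_NormedModule)). apply SV. now rewrite CV_radius_derive. }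
  assert (ODE : forall x, Rabs x <= 1 ->
    PSeries (PS_derive A) x =
      fst z * (x * PSeries (PS_derive A) x - s * PSeries A x)
      + (- snd z) * (x * PSeries (PS_derive B) x - s * PSeries B x) /\
    PSeries (PS_derive B) x =
      fst z * (x * PSeries (PS_derive B) x - s * PSeries B x)
      + snd z * (x * PSeries (PS_derive A) x - s * PSeries A x)).
  { intros x Hx. specialize (cA x Hx). specialize (cB x Hx).
    assert (a1 := SV A x cA). assert (b1 := SV B x cB).
    assert (a2 := SD A x cA). assert (b2 := SD B x cB).
    split.
    - assert (cA' : Rbar_lt (Rabs x) (CV_radius (PS_derive A))) by now rewrite CV_radius_derive.
      rewrite <- (is_series_unique _ _ (SV (PS_derive A) x cA')) at 1.
      apply is_series_unique.
      apply (is_series_C_lin _ _ _ _ _ _ _ _ _ _ _ _ a1 b1 a2 b2).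
      intros n. unfold PS_derive, A, B. rewrite <- Rmult_assoc, S_INR, binomial_coef_S.
      simpl Cpow. simpl fst. simpl snd. ring.
    - assert (cB' : Rbar_lt (Rabs x) (CV_radius (PS_derive B))) by now rewrite CV_radius_derive.
      rewrite <- (is_series_unique _ _ (SV (PS_derive B) x cB')) at 1.
      apply is_series_unique.
      apply (is_series_C_lin _ _ _ _ _ _ _ _ _ _ _ _ b1 a1 b2 a2).
      intros n. unfold PS_derive, A, B. rewrite <- Rmult_assoc, S_INR, binomial_coef_S.
      simpl Cpow. simpl fst. simpl snd. ring. }
  assert (zb : -1 < fst z < 1) by (assert (h := Rabs_fst_le z); destruct (Rabs_def2 (fst z) 1); lra).
  assert (At1 : (PSeries A 1, PSeries B 1) = half_plane_power s (1 - z)).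
  { replace (1 - z)%C with ((1 - 1 * fst z, - (1 * snd z)) : C)
      by (apply injective_projections; simpl; ring).
    apply (half_plane_power_ode s (fun x => 1 - x * fst z) (fun x => - (x * snd z)) (PSeries A) (PSeries B)
      (fun _ => - fst z) (fun _ => - snd z) (PSeries (PS_derive A)) (PSeries (PS_derive B))).
    - intros x Hx. nra.
    - intros x Hx. split; auto_derive; trivial; ring.
    - intros x Hx. assert (Rabs x <= 1) by (rewrite Rabs_pos_eq; lra).
      split; apply is_derive_PSeries; auto.
    - intros x Hx. destruct (ODE x) as [O1 O2]; [rewrite Rabs_pos_eq; lra|].
      apply injective_projections; simpl; nra.
    - rewrite !PSeries_0. unfold A, B, half_plane_power. simpl.
      rewrite !Rmult_0_l, Ropp_0, Rminus_0_r, Rdiv_1_r, atan_0, !Rmult_0_r, cos_0, sin_0.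
      unfold Cmod, Rpower. simpl. rewrite !Rmult_0_l, !Rmult_1_r, Rplus_0_r, sqrt_1, ln_1.
      rewrite !Rmult_0_r, exp_0. f_equal; ring. }
  rewrite <- At1. apply is_series_C; simpl fst; simpl snd.
  - eapply is_series_ext; [|apply (SV A 1), cA; rewrite Rabs_R1; lra].
    intros n. unfold A. simpl. rewrite pow1. ring.
  - eapply is_series_ext; [|apply (SV B 1), cB; rewrite Rabs_R1; lra].
    intros n. unfold B. simpl. rewrite pow1. ring.
Qed.

(** * The lens map has nonnegative Taylor coefficients of sum at most one *)

Lemma binomial_coef_S_pred s n : (INR n + 1) * binomial_coef s (S n) = - s * binomial_coef (s - 1) n.
Proof.
  induction n; [simpl; field|].
  rewrite binomial_coef_S, S_INR. assert (P := pos_INR n).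
  apply (Rmult_eq_reg_l (INR n + 1)); [|lra].
  transitivity ((INR n + 1 - s) * ((INR n + 1) * binomial_coef s (S n))); [ring|].
  rewrite IHn. simpl. field. lra.
Qed.

Lemma sum_n_binomial_coef s n : sum_n (binomial_coef s) n = binomial_coef (s - 1) n.
Proof.
  induction n; [now rewrite sum_O|]. rewrite sum_n_S_R, IHn.
  assert (P := pos_INR n). apply (Rmult_eq_reg_l (INR n + 1)); [|lra].
  rewrite Rmult_plus_distr_l, binomial_coef_S_pred, binomial_coef_S. ring.
Qed.

Lemma binomial_coef_nonneg s n : s <= 0 -> 0 <= binomial_coef s n.
Proof.
  intros Hs. induction n; simpl; [lra|]. assert (P := pos_INR n).
  apply Rmult_le_pos; [exact IHn|]. apply Rdiv_le_0_compat; lra.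
Qed.

Lemma binomial_coef_S_nonpos s n : 0 < s < 1 -> binomial_coef s (S n) <= 0.
Proof.
  intros Hs. assert (P := pos_INR n).
  apply (Rmult_le_reg_l (INR n + 1)); [lra|]. rewrite binomial_coef_S_pred.
  assert (0 <= binomial_coef (s - 1) n) by (apply binomial_coef_nonneg; lra). nra.
Qed.

(** After [i] iterations from any starting point, the values of index below [i]
    do not change. *)
Lemma causal_fixpoint (Phi : (nat -> R) -> nat -> R) :
  (forall x y n, (forall j, (j < n)%nat -> x j = y j) -> Phi x n = Phi y n) ->
  exists x, forall n, x n = Phi x n.
Proof.
  intros H. set (it := fun i => Nat.iter i Phi (fun _ => 0)).
  assert (St : forall n i j, (n < i)%nat -> (n < j)%nat -> it i n = it j n).
  { intros n. induction n as [n IH] using lt_wf_ind. intros i j Hi Hj.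
    destruct i as [|i]; [lia|]. destruct j as [|j]; [lia|].
    apply (H (it i) (it j)). intros k Hk. apply IH; lia. }
  exists (fun n => it (S n) n). intros n. apply (H (it n)).
  intros j Hj. apply St; lia.
Qed.

Definition rconv (x y : nat -> R) (n : nat) : R := sum_n (fun k => x k * y (n - k)%nat) n.

Lemma conv_RtoC (x y : nat -> R) n :
  conv (fun k => RtoC (x k)) (fun k => RtoC (y k)) n = RtoC (rconv x y n).
Proof.
  unfold conv, rconv. apply injective_projections.
  - rewrite sum_n_fst. apply sum_n_ext_R. intros; simpl; ring.
  - rewrite sum_n_snd. simpl snd. transitivity (sum_n (fun _ => 0 * 0) n).
    + apply sum_n_ext_R. intros; simpl; ring.
    + rewrite sum_n_Rmult_l. apply Rmult_0_l.
Qed.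

Lemma sum_n_head (c : R) n : sum_n (fun k => match k with O => c | _ => 0 end) n = c.
Proof. induction n; [now rewrite sum_O|]. rewrite sum_n_S_R, IHn. apply Rplus_0_r. Qed.

Lemma l1_le_RtoC (x : nat -> R) M : (forall n, 0 <= x n) ->
  (forall n, sum_n x n <= M) -> l1_le (fun n => RtoC (x n)) M.
Proof.
  intros P H n. rewrite (sum_n_ext_R _ x); [apply H|].
  intros k _. rewrite Cmod_R. now apply Rabs_pos_eq.
Qed.

Lemma Cpow_opp (z : C) n : ((- z) ^ n)%C = if Nat.odd n then (- z ^ n)%C else (z ^ n)%C.
Proof.
  induction n; [reflexivity|]. rewrite Nat.odd_succ, <- Nat.negb_odd. simpl Cpow.
  rewrite IHn. destruct (Nat.odd n); simpl; ring.
Qed.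

Lemma is_series_Clin (u v : nat -> C) (x y a b : C) :
  is_series u a -> is_series v b ->
  is_series (fun n => x * u n + y * v n)%C (x * a + y * b)%C.
Proof.
  intros Hu Hv. apply (is_series_plus (V := C_NormedModule) (fun n => x * u n)%C (fun n => y * v n)%C);
    [now apply (is_series_scal (V := C_NormedModule) x)|now apply (is_series_scal (V := C_NormedModule) y)].
Qed.

Lemma Re_pos_neq_0 (z : C) : 0 < Re z -> z <> 0.
Proof. intros H ->. simpl in H. lra. Qed.

Lemma Re_one_minus (z : C) : Cmod z < 1 -> 0 < Re (1 - z)%C.
Proof. intros H. simpl. assert (h := Rabs_fst_le z). destruct (Rabs_def2 (fst z) 1); lra. Qed.

Lemma Re_one_plus (z : C) : Cmod z < 1 -> 0 < Re (1 + z)%C.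
Proof. intros H. simpl. assert (h := Rabs_fst_le z). destruct (Rabs_def2 (fst z) 1); lra. Qed.

Lemma lens_fun_quotient (theta : R) (z : C) : 0 < theta < 1 -> Cmod z < 1 ->
  let p := half_plane_power theta (1 - z)%C in
  let q := half_plane_power theta (1 + z)%C in
  (q + p)%C <> 0 /\ lens_fun theta z = ((q - p) / (q + p))%C.
Proof.
  intros Ht Hz p q.
  assert (q0 : q <> 0) by apply half_plane_power_neq_0.
  assert (W : half_plane_power theta (cayley z) = (p / q)%C).
  { apply half_plane_power_div; [now apply Re_one_minus|now apply Re_one_plus|].
    exact (cayley_disk z Hz). }
  assert (n0 : (q + p)%C <> 0).
  { replace (q + p)%C with (q * (1 + p / q))%C by (field; exact q0).
    apply Cmult_neq_0; [exact q0|]. apply Re_pos_neq_0. rewrite <- W.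
    assert (h := half_plane_power_Re theta (cayley z) Ht). simpl in *. lra. }
  split; [exact n0|]. unfold lens_fun. rewrite W. unfold cayley. field.
  split; assumption.
Qed.

(** With [(1 - z) ^ theta = 1 - E z], the lens map is the odd part of [E]
    divided by one minus its even part. The coefficients of [E] are
    nonnegative of total mass at most one, so expanding the quotient in a geometric
    series gives nonnegative coefficients, and if [N] and [D] are the masses of the odd and
    even parts then the total mass is at most [N / (1 - D) <= 1]. *)
Lemma lens_coefficients (theta : R) : 0 < theta < 1 ->
  exists alpha : nat -> R,
    alpha O = 0 /\ l1_le (fun n => RtoC (alpha n)) 1 /\
    forall z : C, Cmod z < 1 ->
      is_series (fun n => RtoC (alpha n) * z ^ n)%C (lens_fun theta z).
Proof.
  intros Ht.
  set (N := fun n => if Nat.odd n then - binomial_coef theta n else 0).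
  set (D := fun n => match n with O => 0 | _ => if Nat.odd n then 0 else - binomial_coef theta n end).
  set (E := fun n => if Nat.odd n then 0 else binomial_coef theta n).
  assert (N0 : forall n, 0 <= N n).
  { intros [|n]; unfold N; [simpl; lra|]. assert (h := binomial_coef_S_nonpos theta n Ht).
    destruct (Nat.odd (S n)); lra. }
  assert (D0 : forall n, 0 <= D n).
  { intros [|n]; unfold D; [lra|]. assert (h := binomial_coef_S_nonpos theta n Ht).
    destruct (Nat.odd (S n)); lra. }
  assert (ND : forall n, sum_n N n + sum_n D n <= 1).
  { intros n. rewrite <- sum_n_Rplus.
    assert (h : 0 <= sum_n (binomial_coef theta) n)
      by (rewrite sum_n_binomial_coef; apply binomial_coef_nonneg; lra).
    assert (e : sum_n (fun k => N k + D k) n + sum_n (binomial_coef theta) n = 1); [|lra].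
    rewrite <- sum_n_Rplus. rewrite <- (sum_n_head 1 n). apply sum_n_ext_R.
    intros [|k] _; unfold N, D; [simpl; ring|].
    destruct (Nat.odd (S k)); ring. }
  destruct (causal_fixpoint (fun x n => N n + rconv D x n)) as [alpha Ha].
  { intros x y n H. f_equal. apply sum_n_ext_R. intros [|k] Hk; [simpl; ring|].
    rewrite H; [reflexivity|lia]. }
  assert (A0 : forall n, 0 <= alpha n).
  { intros n. induction n as [n IH] using lt_wf_ind. rewrite Ha.
    apply Rplus_le_le_0_compat; [apply N0|]. unfold rconv.
    rewrite (sum_n_ext_R _ (fun k => Rmax 0 (D k * alpha (n - k)%nat))).
    - apply sum_n_nonneg. intros; apply Rmax_l.
    - intros [|k] Hk; rewrite Rmax_right; [reflexivity|simpl; lra|reflexivity|].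
      apply Rmult_le_pos; [apply D0|apply IH; lia]. }
  assert (LA : l1_le (fun n => RtoC (alpha n)) 1).
  { apply l1_le_RtoC; [exact A0|]. intros n.
    assert (h : sum_n alpha n <= sum_n N n + sum_n D n * sum_n alpha n).
    { rewrite (sum_n_ext_R alpha (fun k => N k + rconv D alpha k)) at 1 by (intros; apply Ha).
      rewrite sum_n_Rplus. apply Rplus_le_compat_l. now apply sum_n_conv_le. }
    destruct n as [|n].
    + rewrite sum_O, Ha. unfold rconv, N. rewrite sum_O. simpl. lra.
    + assert (t : theta <= sum_n N (S n)).
      { clear h. induction n; rewrite sum_n_S_R.
        - rewrite sum_O. unfold N. simpl. right. field.
        - specialize (N0 (S (S n))). lra. }
      specialize (ND (S n)). nra. }
  exists alpha. split; [|split; [exact LA|]].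
  - rewrite Ha. unfold rconv, N. rewrite sum_O. simpl. ring.
  - intros z Hz. destruct (lens_fun_quotient theta z Ht Hz) as [n0 Eq].
    set (p := half_plane_power theta (1 - z)%C) in *.
    set (q := half_plane_power theta (1 + z)%C) in *.
    assert (Sp : is_series (fun n => RtoC (binomial_coef theta n) * z ^ n)%C p)
      by (apply binomial_series; lra).
    assert (Sq : is_series (fun n => RtoC (binomial_coef theta n) * (- z) ^ n)%C q).
    { unfold q. replace (1 + z)%C with (1 - (- z))%C by ring.
      apply binomial_series; [lra|]. now rewrite Cmod_opp. }
    assert (SN : is_series (fun n => RtoC (N n) * z ^ n)%C ((q - p) / 2)%C).
    { replace ((q - p) / 2)%C with (RtoC (/ 2) * q + RtoC (- / 2) * p)%C
        by (rewrite RtoC_opp, RtoC_inv by lra; field).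
      eapply is_series_ext; [|exact (is_series_Clin _ _ _ _ _ _ Sq Sp)].
      intros n. unfold N. simpl. rewrite Cpow_opp.
      destruct (Nat.odd n); rewrite ?RtoC_opp, ?RtoC_inv by lra; as_C; field. }
    assert (SE : is_series (fun n => RtoC (E n) * z ^ n)%C ((q + p) / 2)%C).
    { replace ((q + p) / 2)%C with (RtoC (/ 2) * q + RtoC (/ 2) * p)%C
        by (rewrite RtoC_inv by lra; field).
      eapply is_series_ext; [|exact (is_series_Clin _ _ _ _ _ _ Sq Sp)].
      intros n. unfold E. simpl. rewrite Cpow_opp.
      destruct (Nat.odd n); rewrite ?RtoC_inv by lra; as_C; field. }
    assert (SA := l1_series_correct _ _ z LA (Rlt_le _ _ Hz)).
    set (A := csum (fun n => RtoC (alpha n) * z ^ n)%C) in *.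
    assert (LE : ex_series (fun n => Cmod (RtoC (E n) * z ^ n)%C)).
    { apply ex_series_le_R with (fun n => Cmod z ^ n).
      - intros n. rewrite Rabs_pos_eq by apply Cmod_ge_0.
        rewrite Cmod_mult, Cmod_R, Cmod_pow.
        assert (Rabs (E n) <= 1).
        { unfold E. destruct (Nat.odd n); [rewrite Rabs_R0; lra|apply binomial_coef_le_1; lra]. }
        assert (0 <= Cmod z ^ n) by (apply pow_le, Cmod_ge_0). nra.
      - apply ex_series_geom. rewrite Rabs_pos_eq by apply Cmod_ge_0. exact Hz. }
    assert (SP := is_series_mult_pow _ _ _ _ z LE
      (ex_series_l1_pow _ _ z LA (Rlt_le _ _ Hz)) SE SA).
    assert (K : ((q + p) / 2 * A = (q - p) / 2)%C).
    { eapply is_series_C_unique; [exact SP|]. eapply is_series_ext; [|exact SN].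
      intros n. simpl. f_equal. rewrite conv_RtoC. f_equal.
      assert (h : rconv E alpha n + rconv D alpha n = alpha n).
      { unfold rconv. rewrite <- sum_n_Rplus. rewrite <- (sum_n_head (alpha n) n).
        apply sum_n_ext_R. intros [|k] _; unfold E, D.
        - rewrite Nat.sub_0_r. simpl. ring.
        - destruct (Nat.odd (S k)); ring. }
      specialize (Ha n). lra. }
    rewrite Eq. replace ((q - p) / (q + p))%C with A; [exact SA|].
    transitivity ((q + p) / 2 * A / ((q + p) / 2))%C.
    + field. exact n0.
    + rewrite K. field. exact n0.
Qed.

(** * Composition with a symbol fixing the origin *)

Lemma is_series_squeeze_R (a : nat -> R) (l : R) (u : nat -> R) :
  (forall n, Rabs (sum_n a n - l) <= u n) -> is_lim_seq u 0 -> is_series a l.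
Proof.
  intros H U. change (is_lim_seq (sum_n a) l).
  apply (is_lim_seq_le_le (fun n => l + (-1) * u n) _ (fun n => l + u n)).
  - intros n. destruct (Rabs_le_between (sum_n a n - l) (u n)) as [B _].
    specialize (B (H n)). lra.
  - replace (Finite l) with (Finite (l + (-1) * 0)) by (f_equal; ring).
    apply (is_lim_seq_plus' _ _ l); [apply is_lim_seq_const|].
    apply (is_lim_seq_scal_l u (-1) 0 U).
  - replace (Finite l) with (Finite (l + 0)) by (f_equal; ring).
    apply (is_lim_seq_plus' _ _ l); [apply is_lim_seq_const|exact U].
Qed.

Lemma is_series_squeeze_C (a : nat -> C) (l : C) (u : nat -> R) :
  (forall n, Cmod (sum_n a n - l) <= u n) -> is_lim_seq u 0 -> is_series a l.
Proof.
  intros H U. apply is_series_C; apply (is_series_squeeze_R _ _ u); trivial; intros n;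
    (eapply Rle_trans; [|apply H]).
  - rewrite <- sum_n_fst. apply (Rabs_fst_le (sum_n a n - l)%C).
  - rewrite <- sum_n_snd. apply (Rabs_snd_le (sum_n a n - l)%C).
Qed.

Lemma sum_n_shift_R (a : nat -> R) n : sum_n a (S n) = a O + sum_n (fun k => a (S k)) n.
Proof.
  induction n; [rewrite sum_n_S_R, !sum_O; reflexivity|].
  rewrite sum_n_S_R, IHn, (sum_n_S_R (fun k => a (S k))). apply Rplus_assoc.
Qed.

Lemma sum_n_shift_C (a : nat -> C) n : sum_n a (S n) = (a O + sum_n (fun k => a (S k)) n)%C.
Proof.
  induction n; [rewrite sum_n_S_C, !sum_O; reflexivity|].
  rewrite sum_n_S_C, IHn, (sum_n_S_C (fun k => a (S k))). symmetry; apply Cplus_assoc.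
Qed.

Definition cdelta (c : C) (n : nat) : C := match n with O => c | _ => RtoC 0 end.

Lemma is_series_cdelta (c z : C) : is_series (fun n => cdelta c n * z ^ n)%C c.
Proof.
  apply (is_series_squeeze_C _ _ (fun _ => 0)); [|apply is_lim_seq_const].
  intros n. right. replace (sum_n (fun n => cdelta c n * z ^ n)%C n) with c.
  - replace (c - c)%C with (RtoC 0) by ring. apply Cmod_0.
  - induction n; [rewrite sum_O; simpl; as_C; ring|].
    rewrite sum_n_S_C, <- IHn. simpl cdelta. as_C; ring.
Qed.

(** Taylor coefficients of [sum_(k <= K) b_k phi ^ k], in Horner form. *)
Fixpoint horner_comp (a : nat -> C) (K : nat) (b : nat -> C) (n : nat) : C :=
  match K with
  | O => cdelta (b O) n
  | S K => (cdelta (b O) n + conv a (horner_comp a K (fun k => b (S k))) n)%C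
  end.

(** The coefficient of index [n] does not change after [n] Horner steps. *)
Definition comp_coef (a b : nat -> C) (n : nat) : C := horner_comp a n b n.

Section Composition.

Context (a : nat -> C) (a_0 : a O = RtoC 0) (a_l1 : l1_le a 1).

Lemma conv_a_0 (x : nat -> C) : conv a x O = RtoC 0.
Proof. unfold conv. rewrite sum_O, a_0. apply Cmult_0_l. Qed.

(** Littlewood's induction: [f o phi = b_0 + phi (g o phi)], the two terms are
    orthogonal because [phi] vanishes at the origin, and multiplication by
    [phi] is a contraction. *)
Lemma horner_comp_l2 K b :
  square_summable (horner_comp a K b) /\
  nsq (horner_comp a K b) <= sum_n (fun k => Cmod (b k) ^ 2) K.
Proof.
  assert (Dl : forall c n, sum_n (fun k => Cmod (cdelta c k) ^ 2) n = Cmod c ^ 2).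
  { intros c n. rewrite <- (sum_n_head (Cmod c ^ 2) n). apply sum_n_ext_R.
    intros [|k] _; simpl; [reflexivity|]. rewrite Cmod_0. ring. }
  revert b; induction K; intros b.
  - apply nsq_bounded. intros n. rewrite sum_O. right. apply Dl.
  - destruct (IHK (fun k => b (S k))) as [I1 I2].
    destruct (conv_l2 a _ 1 a_l1 I1) as [C1 C2].
    apply nsq_bounded. intros n. rewrite sum_n_shift_R.
    apply Rle_trans with (Cmod (b O) ^ 2 + nsq (conv a (horner_comp a K (fun k => b (S k))))); [|lra].
    rewrite <- (Dl (b O) n). eapply Rle_trans; [|apply Rplus_le_compat_l, (sum_n_le_nsq _ n C1)].
    rewrite <- sum_n_Rplus. apply sum_n_le_loc. intros [|k] _; simpl horner_comp; simpl cdelta.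
    + rewrite conv_a_0, Cplus_0_r. assert (h := pow2_ge_0 (Cmod 0)). lra.
    + rewrite Cplus_0_l. assert (h := pow2_ge_0 (Cmod 0)). lra.
Qed.

Lemma horner_comp_eval K b (z w : C) : Cmod z < 1 ->
  is_series (fun n => a n * z ^ n)%C w ->
  is_series (fun n => horner_comp a K b n * z ^ n)%C (sum_n (fun k => b k * w ^ k)%C K).
Proof.
  intros Hz Hw. revert b; induction K; intros b.
  - rewrite sum_O. simpl Cpow. rewrite Cmult_1_r. apply is_series_cdelta.
  - rewrite sum_n_shift_C. simpl Cpow at 2. rewrite Cmult_1_r.
    rewrite (sum_n_ext_C (fun k => b (S k) * w ^ S k)%C
      (fun k => w * (b (S k) * w ^ k))%C) by (intros; simpl; ring).
    rewrite sum_n_Cmult_l.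
    apply (is_series_ext (fun n => cdelta (b O) n * z ^ n +
      conv a (horner_comp a K (fun k => b (S k))) n * z ^ n)%C).
    { intros n. simpl. symmetry. apply Cmult_plus_distr_r. }
    apply (is_series_plus (V := C_NormedModule)); [apply is_series_cdelta|].
    apply is_series_mult_pow; [|apply ex_series_l2_pow; [apply horner_comp_l2|exact Hz]|exact Hw|apply IHK].
    eapply ex_series_l1_pow; [exact a_l1|lra].
Qed.

Lemma horner_comp_stable n K K' b : (n <= K)%nat -> (n <= K')%nat -> horner_comp a K b n = horner_comp a K' b n.
Proof.
  revert K K' b. induction n as [n IH] using lt_wf_ind. intros K K' b HK HK'.
  destruct n as [|n].
  - destruct K, K'; simpl; rewrite ?conv_a_0; ring.
  - destruct K as [|K]; [lia|]. destruct K' as [|K']; [lia|].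
    cbn [horner_comp]. f_equal. apply sum_n_ext_C. intros [|k] Hk.
    + rewrite a_0. ring.
    + rewrite (IH (S n - S k)%nat) with (K' := K'); [reflexivity|lia|lia|lia].
Qed.

Lemma comp_coef_l2 b : square_summable b ->
  square_summable (comp_coef a b) /\ nsq (comp_coef a b) <= nsq b.
Proof.
  intros Hb. apply nsq_bounded. intros n.
  apply Rle_trans with (sum_n (fun k => Cmod (b k) ^ 2) n); [|now apply sum_n_le_nsq].
  destruct (horner_comp_l2 n b) as [C1 C2].
  eapply Rle_trans; [|exact C2]. eapply Rle_trans; [|apply (sum_n_le_nsq _ n C1)].
  right. apply sum_n_ext_R. intros k Hk. unfold comp_coef.
  now rewrite (horner_comp_stable k k n).
Qed.

Lemma Cmod_le_nsq (x : nat -> C) n : square_summable x -> Cmod (x n) <= sqrt (nsq x).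
Proof.
  intros Hx. rewrite <- (sqrt_pow2 (Cmod (x n))) by apply Cmod_ge_0.
  apply sqrt_le_1_alt. eapply Rle_trans; [|apply (sum_n_le_nsq x n Hx)].
  destruct n; [rewrite sum_O; lra|]. rewrite sum_n_S_R.
  assert (0 <= sum_n (fun k => Cmod (x k) ^ 2) n)
    by (apply sum_n_nonneg; intros; apply pow2_ge_0). lra.
Qed.

(** The partial sums of [sum b_k w ^ k] are the values at [z] of functions that
    agree with the candidate up to order [K] and stay in a fixed ball of [H^2],
    hence they converge to its value at [z]. *)
Lemma comp_coef_eval b (z w v : C) : Cmod z < 1 -> square_summable b ->
  is_series (fun n => a n * z ^ n)%C w -> is_series (fun k => b k * w ^ k)%C v ->
  is_series (fun n => comp_coef a b n * z ^ n)%C v.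
Proof.
  intros Hz Hb Hw Hv.
  destruct (comp_coef_l2 b Hb) as [L1 L2].
  assert (SL := l2_series_correct _ z L1 Hz).
  set (l := csum (fun n => comp_coef a b n * z ^ n)%C) in *.
  assert (Z0 := Cmod_ge_0 z).
  set (sg := sqrt (Cmod z)). assert (sg0 : 0 <= sg) by apply sqrt_pos.
  assert (sg2 : sg * sg = Cmod z) by now apply sqrt_sqrt.
  assert (sg1 : sg < 1) by nra.
  set (M := sqrt (nsq b)). assert (M0 : 0 <= M) by apply sqrt_pos.
  assert (E : is_series (fun k => b k * w ^ k)%C l).
  { apply (is_series_squeeze_C _ _ (fun K => 2 * M / (1 - sg) * sg ^ K)).
    - intros K. assert (SK := horner_comp_eval K b z w Hz Hw).
      assert (SM : is_series (fun n => (horner_comp a K b n - comp_coef a b n) * z ^ n)%C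
        (sum_n (fun k => b k * w ^ k) K - l)%C).
      { eapply is_series_ext; [|exact (is_series_minus _ _ _ _ SK SL)].
        intros n. unfold plus, opp; simpl. as_C; ring. }
      apply (is_series_Cmod_le _ _ _ SM). intros n.
      apply Rle_trans with (sum_n (fun k => 2 * M * sg ^ K * sg ^ k) n).
      + apply sum_n_le_loc. intros k _. rewrite Cmod_mult, Cmod_pow, <- sg2.
        destruct (le_lt_dec k K) as [h|h].
        * unfold comp_coef. rewrite (horner_comp_stable k K k) by lia.
          replace (horner_comp a k b k - horner_comp a k b k)%C with (RtoC 0) by ring.
          rewrite Cmod_0, Rmult_0_l.
          apply Rmult_le_pos; [apply Rmult_le_pos; [lra|]|]; now apply pow_le.
        * assert (B1 : Cmod (horner_comp a K b k) <= M).
          { destruct (horner_comp_l2 K b) as [C1 C2].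
            eapply Rle_trans; [apply (Cmod_le_nsq _ k C1)|]. apply sqrt_le_1_alt.
            eapply Rle_trans; [exact C2|]. now apply sum_n_le_nsq. }
          assert (B2 : Cmod (comp_coef a b k) <= M).
          { eapply Rle_trans; [apply (Cmod_le_nsq _ k L1)|]. now apply sqrt_le_1_alt. }
          assert (B3 : Cmod (horner_comp a K b k - comp_coef a b k) <= 2 * M).
          { unfold Cminus. eapply Rle_trans; [apply Cmod_triangle|]. rewrite Cmod_opp. lra. }
          rewrite Rpow_mult_distr.
          assert (B4 : sg ^ k <= sg ^ K).
          { replace k with (K + (k - K))%nat by lia. rewrite pow_add.
            assert (0 <= sg ^ K) by now apply pow_le.
            assert (sg ^ (k - K) <= 1) by (rewrite <- (pow1 (k - K)); apply pow_incr; lra).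
            nra. }
          assert (0 <= sg ^ k) by now apply pow_le.
          rewrite Rmult_assoc. apply Rmult_le_compat; [apply Cmod_ge_0|nra|exact B3|nra].
      + rewrite sum_n_Rmult_l.
        assert (G : sum_n (fun k => sg ^ k) n <= / (1 - sg)).
        { apply sum_n_le_series; [intros; now apply pow_le|]. apply is_series_geom.
          rewrite Rabs_pos_eq; lra. }
        assert (0 <= sg ^ K) by now apply pow_le.
        unfold Rdiv. replace (2 * M * / (1 - sg) * sg ^ K) with (2 * M * sg ^ K * / (1 - sg)) by ring.
        apply Rmult_le_compat_l; [nra|exact G].
    - replace (Finite 0) with (Finite (2 * M / (1 - sg) * 0)) by (f_equal; ring).
      apply (is_lim_seq_scal_l _ _ 0). apply is_lim_seq_geom. rewrite Rabs_pos_eq; lra. }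
  now rewrite (is_series_C_unique _ _ _ Hv E).
Qed.

Lemma composition_operator_exists (phi : disk -> disk) :
  (forall z, is_series (fun n => a n * proj1_sig z ^ n)%C (proj1_sig (phi z))) ->
  exists S : H2 -> H2, is_composition_operator phi S.
Proof.
  intros Hphi.
  assert (T : forall f : H2, is_taylor (fun z => f (phi z)) (comp_coef a (taylor_coef f))).
  { intros f. apply is_taylor_iff. intros z.
    apply (comp_coef_eval _ _ (proj1_sig (phi z))); [exact (proj2_sig z)
      |apply taylor_coef_l2|apply Hphi|apply H2_series]. }
  assert (P : forall f : H2, exists b, square_summable b /\ is_taylor (fun z => f (phi z)) b).
  { intros f. exists (comp_coef a (taylor_coef f)). split; [|apply T].
    apply comp_coef_l2, taylor_coef_l2. }
  set (S := fun f : H2 => mkH2 (fun z => f (phi z)) (P f)).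
  assert (N : forall f, H2_norm (S f) <= H2_norm f).
  { intros f. rewrite (H2_norm_eq (S f) _ (T f)). apply sqrt_le_1_alt.
    apply comp_coef_l2, taylor_coef_l2. }
  exists S. split; [split|reflexivity].
  - intros f g. now apply H2_ext.
  - intros c f. now apply H2_ext.
  - exists 1. split; [lra|]. intros f. rewrite Rmult_1_l. apply N.
Qed.

End Composition.

Lemma lens_composition_operator (theta : R) (Ht : 0 < theta < 1) :
  exists S : H2 -> H2, is_composition_operator (lens_map theta Ht) S.
Proof.
  destruct (lens_coefficients theta Ht) as [alpha [A0 [A1 A2]]].
  apply (composition_operator_exists (fun n => RtoC (alpha n))).
  - now rewrite A0.
  - exact A1.
  - intros [z Hz]. simpl. now apply A2.
Qed.

(** * Rank and approximation numbers *)

Lemma sum1_S {G : AbelianMonoid} (f : nat -> G) n :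
  sum_n_m f 1 (S n) = plus (sum_n_m f 1 n) (f (S n)).
Proof. apply sum_n_Sm. lia. Qed.

Lemma sum1_S_C (f : nat -> C) n : sum_n_m f 1 (S n) = (sum_n_m f 1 n + f (S n))%C.
Proof. apply (sum1_S (G := C_AbelianMonoid)). Qed.

Lemma sum1_0_C (f : nat -> C) : sum_n_m f 1 0 = RtoC 0.
Proof. apply (sum_n_m_zero (G := C_AbelianMonoid)). lia. Qed.

Lemma sum1_ext_C (f g : nat -> C) n :
  (forall k, (1 <= k <= n)%nat -> f k = g k) -> sum_n_m f 1 n = sum_n_m g 1 n.
Proof. apply (sum_n_m_ext_loc (G := C_AbelianMonoid)). Qed.

Lemma sum1_Clin (a : C) (f g : nat -> C) n :
  sum_n_m (fun k => f k + a * g k)%C 1 n = (sum_n_m f 1 n + a * sum_n_m g 1 n)%C.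
Proof.
  induction n; [rewrite !sum1_0_C; as_C; ring|]. rewrite !sum1_S_C, IHn. as_C; ring.
Qed.

Lemma sum1_zero_C (f : nat -> C) n :
  (forall k, (1 <= k <= n)%nat -> f k = RtoC 0) -> sum_n_m f 1 n = RtoC 0.
Proof.
  induction n; intros H; [apply sum1_0_C|].
  rewrite sum1_S_C, IHn, H by (intros; try apply H; lia). apply Cplus_0_r.
Qed.

(** Gaussian elimination: solve one equation for the last unknown, and substitute. *)
Lemma homogeneous_system (m n : nat) (A : nat -> nat -> C) : (m < n)%nat ->
  exists c : nat -> C, (exists j, (1 <= j <= n)%nat /\ c j <> RtoC 0) /\
    forall i, (1 <= i <= m)%nat -> sum_n_m (fun j => A i j * c j)%C 1 n = RtoC 0.
Proof.
  revert n A. induction m; intros n A Hmn.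
  { exists (fun _ => RtoC 1). split; [exists 1%nat; split; [lia|apply C1_nz]|lia]. }
  destruct n as [|n]; [lia|].
  destruct (classic (exists r, (1 <= r <= S m)%nat /\ A r (S n) <> RtoC 0)) as [[r [Hr Nr]]|Z].
  - (* equations other than [r], renumbered from 1 to [m] *)
    set (sk := fun i => if le_lt_dec r i then S i else i).
    destruct (IHm n (fun i j => A (sk i) j + (- A (sk i) (S n) / A r (S n)) * A r j)%C)
      as [c [[j [Hj Nj]] Hc]]; [lia|].
    set (t := (- (sum_n_m (fun j => A r j * c j) 1 n) / A r (S n))%C).
    set (c' := fun j => if Nat.eq_dec j (S n) then t else c j).
    assert (Ec : forall i, sum_n_m (fun j => A i j * c' j)%C 1 (S n) =
      (sum_n_m (fun j => A i j * c j)%C 1 n + A i (S n) * t)%C).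
    { intros i. rewrite sum1_S_C. unfold c' at 2.
      destruct (Nat.eq_dec (S n) (S n)) as [_|]; [|lia]. f_equal.
      apply sum1_ext_C. intros k Hk. unfold c'. destruct (Nat.eq_dec k (S n)); [lia|reflexivity]. }
    exists c'. split.
    + exists j. split; [lia|]. unfold c'. destruct (Nat.eq_dec j (S n)); [lia|exact Nj].
    + assert (Hs : forall i, (1 <= i <= m)%nat ->
        sum_n_m (fun j => A (sk i) j * c' j)%C 1 (S n) = RtoC 0).
      { intros i Hi. rewrite Ec, <- (Hc i Hi). symmetry.
        rewrite (sum1_ext_C _ (fun j => A (sk i) j * c j +
          (- A (sk i) (S n) / A r (S n)) * (A r j * c j))%C)
          by (intros; cbv beta; as_C; field; exact Nr).
        rewrite sum1_Clin. unfold t. as_C. field. exact Nr. }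
      intros i Hi. destruct (lt_eq_lt_dec i r) as [[h|h]|h].
      * rewrite <- (Hs i) by lia. unfold sk. destruct (le_lt_dec r i); [lia|reflexivity].
      * subst i. rewrite Ec. unfold t. as_C. field. exact Nr.
      * rewrite <- (Hs (i - 1)%nat) by lia. unfold sk.
        destruct (le_lt_dec r (i - 1)%nat); [|lia]. now replace (S (i - 1)) with i by lia.
  - exists (fun j => if Nat.eq_dec j (S n) then RtoC 1 else RtoC 0). split.
    + exists (S n). split; [lia|]. destruct (Nat.eq_dec (S n) (S n)); [apply C1_nz|lia].
    + intros i Hi. apply sum1_zero_C. intros k Hk.
      destruct (Nat.eq_dec k (S n)) as [->|]; [|ring].
      destruct (classic (A i (S n) = RtoC 0)) as [e|e]; [rewrite e; ring|].
      exfalso. apply Z. now exists i.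
Qed.

Lemma minus_plus_plus {G : AbelianGroup} (a b c d : G) :
  minus (plus a b) (plus c d) = plus (minus a c) (minus b d).
Proof.
  unfold minus. rewrite opp_plus, <- !plus_assoc. f_equal. rewrite !plus_assoc. f_equal.
  apply plus_comm.
Qed.

Lemma minus_minus {G : AbelianGroup} (a b : G) : minus a (minus a b) = b.
Proof.
  change (plus a (opp (minus a b)) = b). rewrite opp_minus, plus_comm. unfold minus.
  rewrite <- plus_assoc. transitivity (plus b zero); [|apply plus_zero_r].
  f_equal. exact (plus_opp_l a).
Qed.

Section Rank.

Context {U V : NormedModule C_AbsRing}.

Definition lin_map (T : U -> V) : Prop :=
  (forall x y, T (plus x y) = plus (T x) (T y)) /\
  (forall (k : C_AbsRing) x, T (scal k x) = scal k (T x)).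

Lemma nscal_zero_r {W : NormedModule C_AbsRing} (a : C_AbsRing) :
  @eq W (scal a (zero : W)) zero.
Proof. exact (scal_zero_r (V := W) a). Qed.

Lemma nscal_zero_l {W : NormedModule C_AbsRing} (x : W) :
  @eq W (scal (RtoC 0 : C_AbsRing) x) zero.
Proof. exact (scal_zero_l (V := W) x). Qed.

Lemma nscal_one {W : NormedModule C_AbsRing} (x : W) : @eq W (scal (RtoC 1 : C_AbsRing) x) x.
Proof. exact (scal_one (V := W) x). Qed.

Lemma nscal_distr_l {W : NormedModule C_AbsRing} (a : C_AbsRing) (x y : W) :
  @eq W (scal a (plus x y)) (plus (scal a x) (scal a y)).
Proof. exact (scal_distr_l (V := W) a x y). Qed.

Lemma nscal_distr_r {W : NormedModule C_AbsRing} (a b : C) (x : W) :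
  @eq W (scal (a + b : C_AbsRing)%C x)
    (plus (scal (a : C_AbsRing) x) (scal (b : C_AbsRing) x)).
Proof. exact (scal_distr_r (V := W) a b x). Qed.

Lemma nscal_opp_r {W : NormedModule C_AbsRing} (a : C_AbsRing) (x : W) :
  @eq W (scal a (opp x)) (opp (scal a x)).
Proof. exact (scal_opp_r (V := W) a x). Qed.

Lemma nscal_opp_l {W : NormedModule C_AbsRing} (a : C) (x : W) :
  @eq W (scal (- a : C_AbsRing)%C x) (opp (scal (a : C_AbsRing) x)).
Proof. exact (scal_opp_l (V := W) a x). Qed.

Lemma nscal_assoc {W : NormedModule C_AbsRing} (a b : C) (x : W) :
  @eq W (scal (a : C_AbsRing) (scal (b : C_AbsRing) x)) (scal (a * b : C_AbsRing)%C x).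
Proof. exact (scal_assoc (V := W) a b x). Qed.

Lemma lin_map_zero T : lin_map T -> T zero = zero.
Proof.
  intros [_ H]. rewrite <- (nscal_zero_r (W := U) zero), H. apply nscal_zero_l.
Qed.

Lemma lin_comb_S {W : NormedModule C_AbsRing} m c (v : nat -> W) :
  lin_comb (S m) c v = plus (lin_comb m c v) (scal (c (S m) : C_AbsRing) (v (S m))).
Proof. apply sum1_S. Qed.

Lemma lin_comb_O {W : NormedModule C_AbsRing} c (v : nat -> W) : lin_comb 0 c v = zero.
Proof. apply sum_n_m_zero. lia. Qed.

Lemma lin_comb_ext {W : NormedModule C_AbsRing} m c c' (v v' : nat -> W) :
  (forall i, (1 <= i <= m)%nat -> c i = c' i /\ v i = v' i) ->
  lin_comb m c v = lin_comb m c' v'.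
Proof.
  intros H. apply sum_n_m_ext_loc. intros k Hk. destruct (H k Hk) as [-> ->]. reflexivity.
Qed.

Lemma lin_comb_lin {W : NormedModule C_AbsRing} m (a : C) c c' (v : nat -> W) :
  lin_comb m (fun i => c i + a * c' i)%C v =
  plus (lin_comb m c v) (scal (a : C_AbsRing) (lin_comb m c' v)).
Proof.
  induction m.
  - now rewrite !lin_comb_O, nscal_zero_r, plus_zero_l.
  - rewrite !lin_comb_S, IHm, nscal_distr_l, nscal_assoc.
    rewrite nscal_distr_r, <- !plus_assoc. f_equal. rewrite !plus_assoc. f_equal.
    apply plus_comm.
Qed.

Lemma lin_comb_zero {W : NormedModule C_AbsRing} m c (v : nat -> W) :
  (forall i, (1 <= i <= m)%nat -> c i = RtoC 0) -> lin_comb m c v = zero.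
Proof.
  induction m; intros H; [apply lin_comb_O|].
  rewrite lin_comb_S, IHm, H by (intros; try apply H; lia).
  rewrite plus_zero_l. apply nscal_zero_l.
Qed.

Lemma lin_comb_plus {W : NormedModule C_AbsRing} m c c' (v : nat -> W) :
  @eq W (lin_comb m (fun i => c i + c' i)%C v) (plus (lin_comb m c v) (lin_comb m c' v)).
Proof.
  rewrite <- (nscal_one (lin_comb m c' v)), <- lin_comb_lin. apply lin_comb_ext.
  intros i _. split; [ring|reflexivity].
Qed.

Lemma lin_comb_scal {W : NormedModule C_AbsRing} m (a : C) c (v : nat -> W) :
  @eq W (lin_comb m (fun i => a * c i)%C v) (scal (a : C_AbsRing) (lin_comb m c v)).
Proof.
  rewrite <- (plus_zero_l (scal (a : C_AbsRing) (lin_comb m c v) : W)).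
  rewrite <- (lin_comb_zero m (fun _ => RtoC 0) v) by reflexivity.
  rewrite <- lin_comb_lin. apply lin_comb_ext. intros i _. split; [ring|reflexivity].
Qed.

Lemma lin_map_lin_comb T m c e : lin_map T ->
  T (lin_comb m c e) = lin_comb m c (fun i => T (e i)).
Proof.
  intros HT. induction m; [rewrite !lin_comb_O; now apply lin_map_zero|].
  rewrite !lin_comb_S. destruct HT as [H1 H2]. now rewrite H1, H2, IHm.
Qed.

Lemma lin_comb_comb {W : NormedModule C_AbsRing} n m (c : nat -> C) (A : nat -> nat -> C)
  (v : nat -> W) :
  lin_comb n c (fun j => lin_comb m (fun i => A i j) v) =
  lin_comb m (fun i => sum_n_m (fun j => A i j * c j)%C 1 n) v.
Proof.
  induction n.
  - rewrite lin_comb_O. symmetry. apply lin_comb_zero. intros; apply sum1_0_C.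
  - rewrite lin_comb_S, IHn, <- lin_comb_lin. apply lin_comb_ext. intros i _.
    split; [|reflexivity]. rewrite sum1_S_C. as_C; ring.
Qed.

Lemma dependent_in_span {W : NormedModule C_AbsRing} n m (w v : nat -> W) : (m < n)%nat ->
  (forall j, (1 <= j <= n)%nat -> exists c, w j = lin_comb m c v) ->
  exists c : nat -> C, (exists j, (1 <= j <= n)%nat /\ c j <> RtoC 0) /\
    lin_comb n c w = zero.
Proof.
  intros Hmn H.
  assert (H' : forall j, exists c : nat -> C, (1 <= j <= n)%nat -> w j = lin_comb m c v).
  { intros j. destruct (classic (1 <= j <= n)%nat) as [h|h].
    - destruct (H j h) as [c Hc]. now exists c.
    - exists (fun _ => RtoC 0). intros; contradiction. }
  destruct (functional_choice _ H') as [B HB].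
  destruct (homogeneous_system m n (fun i j => B j i) Hmn) as [c [Nc Hc]].
  exists c. split; [exact Nc|].
  transitivity (lin_comb n c (fun j => lin_comb m (fun i => B j i) v)).
  { apply lin_comb_ext. intros; split; [reflexivity|now apply HB]. }
  rewrite (lin_comb_comb n m c (fun i j => B j i) v). now apply lin_comb_zero.
Qed.

(** A maximal independent family in the range is a basis of it. *)
Lemma finite_rank (T : U -> V) N v : lin_map T ->
  (forall x, exists c, T x = lin_comb N c v) -> exists m, (m <= N)%nat /\ has_rank T m.
Proof.
  intros HT Hv.
  set (P := fun m => exists x : nat -> U, lin_indep m (fun i => T (x i))).
  assert (Bd : forall m, P m -> (m <= N)%nat).
  { intros m [x Hx]. destruct (le_lt_dec m N) as [h|h]; [exact h|]. exfalso.
    destruct (dependent_in_span m N (fun i => T (x i)) v h (fun j _ => Hv (x j)))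
      as [c [[j [Hj Nj]] Hc]].
    exact (Nj (Hx c Hc j Hj)). }
  assert (Mx : exists m, P m /\ ~ P (S m)).
  { apply NNPP. intros h.
    assert (A : forall m, P m).
    { induction m; [exists (fun _ => zero); intros c _ i Hi; lia|].
      apply NNPP. intros h'. apply h. now exists m. }
    specialize (Bd (S N) (A (S N))). lia. }
  destruct Mx as [m [[x Hx] Nm]]. exists m. split; [apply Bd; now exists x|].
  exists (fun i => T (x i)). split; [exact Hx|]. intros y. split.
  - intros [z <-]. apply NNPP. intros Nz. apply Nm.
    exists (fun i => if Nat.eq_dec i (S m) then z else x i).
    intros c Hc.
    rewrite lin_comb_S in Hc. destruct (Nat.eq_dec (S m) (S m)) as [_|]; [|lia].
    rewrite (lin_comb_ext m c c _ (fun i => T (x i))) in Hc.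
    2:{ intros i Hi. split; [reflexivity|]. destruct (Nat.eq_dec i (S m)); [lia|reflexivity]. }
    destruct (classic (c (S m) = RtoC 0)) as [e|e].
    + rewrite e, nscal_zero_l, plus_zero_r in Hc.
      intros i Hi. destruct (Nat.eq_dec i (S m)) as [->|]; [exact e|].
      apply (Hx c Hc). lia.
    + exfalso. apply Nz. exists (fun i => 0 + (- / c (S m)) * c i)%C.
      rewrite lin_comb_lin.
      rewrite (lin_comb_zero m (fun _ => RtoC 0)), plus_zero_l by reflexivity.
      assert (E : @eq V (lin_comb m c (fun i => T (x i)))
        (opp (scal (c (S m) : C_AbsRing) (T z)))).
      { apply (plus_reg_r (G := V) (scal (c (S m) : C_AbsRing) (T z))).
        exact (eq_trans Hc (eq_sym (plus_opp_l (G := V) _))). }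
      rewrite E, <- nscal_opp_l, nscal_assoc, <- (nscal_one (T z)) at 1.
      f_equal. change (RtoC 1 = (- / c (S m) * - c (S m))%C). field. exact e.
  - intros [c ->]. exists (lin_comb m c x). now apply lin_map_lin_comb.
Qed.

Definition bounded_by (L : U -> V) (M : R) : Prop := forall x, norm (L x) <= M * norm x.

Lemma op_norm_is_lub (L : U -> V) M : bounded_by L M -> 0 <= M ->
  (forall x, norm x <= 1 -> norm (L x) <= op_norm L) /\ 0 <= op_norm L <= M.
Proof.
  intros HL HM. unfold op_norm.
  destruct (Lub_Rbar_correct (fun r => exists x : U, norm x <= 1 /\ r = norm (L x))) as [H1 H2].
  set (l := Lub_Rbar _) in *.
  assert (LM : Rbar_le l (Finite M)).
  { apply H2. intros r [x [Hx ->]]. simpl. specialize (HL x).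
    assert (0 <= norm x) by apply norm_ge_0. nra. }
  assert (L0 : Rbar_le (Finite 0) l).
  { apply Rbar_le_trans with (Finite (norm (L zero))).
    - simpl. apply norm_ge_0.
    - apply H1. exists zero. rewrite norm_zero. split; [lra|reflexivity]. }
  destruct l as [l| |]; simpl in *; try contradiction.
  split; [|lra]. intros x Hx. apply (H1 (norm (L x))). now exists x.
Qed.

Lemma norm_le_op_norm (L : U -> V) M x : lin_map L -> bounded_by L M -> 0 <= M ->
  norm (L x) <= op_norm L * norm x.
Proof.
  intros [_ Hs] HL HM. destruct (op_norm_is_lub L M HL HM) as [H _].
  destruct (Req_dec (norm x) 0) as [e|e].
  { specialize (HL x). rewrite e in *. rewrite Rmult_0_r in *. exact HL. }
  assert (P : 0 < norm x) by (assert (h := norm_ge_0 x); lra).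
  set (y := scal (RtoC (/ norm x) : C_AbsRing) x).
  assert (Hy : norm y <= 1).
  { unfold y. eapply Rle_trans; [apply norm_scal|]. unfold abs; simpl.
    rewrite Cmod_R, Rabs_pos_eq by (left; now apply Rinv_0_lt_compat).
    right. now apply Rinv_l. }
  assert (Ex : x = scal (RtoC (norm x) : C_AbsRing) y).
  { unfold y. rewrite nscal_assoc. rewrite <- (nscal_one x) at 1. f_equal. unfold mult; simpl.
    rewrite <- RtoC_mult, Rinv_r; [reflexivity|exact e]. }
  rewrite Ex at 1. rewrite Hs. eapply Rle_trans; [apply norm_scal|].
  unfold abs; simpl. rewrite Cmod_R, Rabs_pos_eq by lra. rewrite Rmult_comm.
  apply Rmult_le_compat_r; [lra|]. now apply H.
Qed.

Lemma is_linear_lin_map (T : U -> V) : is_linear T -> lin_map T.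
Proof. intros [H1 H2 _]. now split. Qed.

Lemma is_linear_bounded (T : U -> V) : is_linear T -> exists M, 0 <= M /\ bounded_by T M.
Proof. intros [_ _ [M [H1 H2]]]. exists M. split; [lra|exact H2]. Qed.

Lemma minus_linear_bounded (S T : U -> V) : is_linear S -> is_linear T ->
  lin_map (fun x => minus (S x) (T x)) /\
  exists M, 0 <= M /\ bounded_by (fun x => minus (S x) (T x)) M.
Proof.
  intros HS HT.
  destruct (is_linear_bounded S HS) as [M1 [P1 B1]].
  destruct (is_linear_bounded T HT) as [M2 [P2 B2]].
  destruct HS as [S1 S2 _], HT as [T1 T2 _]. split; [split|].
  - intros x y. rewrite S1, T1. exact (minus_plus_plus (G := V) _ _ _ _).
  - intros k x. rewrite S2, T2. unfold minus. now rewrite (nscal_distr_l (W := V)), nscal_opp_r.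
  - exists (M1 + M2). split; [lra|]. intros x. unfold minus.
    eapply Rle_trans; [apply norm_triangle|]. rewrite norm_opp.
    specialize (B1 x). specialize (B2 x). lra.
Qed.

(** The lower bound [d] and the competitor [T = 0] make the infimum in the definition of
    the approximation number a finite number. *)
Lemma approx_number_glb (S : U -> V) n d : is_linear S -> (1 <= n)%nat ->
  (forall T m, is_linear T -> (m < n)%nat -> has_rank T m ->
    d <= op_norm (fun x => minus (S x) (T x))) ->
  d <= approx_number S n /\
  forall T m, is_linear T -> (m < n)%nat -> has_rank T m ->
    approx_number S n <= op_norm (fun x => minus (S x) (T x)).
Proof.
  intros HS Hn H. unfold approx_number.
  set (E := fun r => exists T : U -> V, is_linear T /\
    (exists m, (m < n)%nat /\ has_rank T m) /\ r = op_norm (fun x => minus (S x) (T x))).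
  destruct (Glb_Rbar_correct E) as [H1 H2]. set (l := Glb_Rbar E) in *.
  assert (Ld : Rbar_le (Finite d) l).
  { apply H2. intros r [T [HT [[m [Hm Rm]] ->]]]. now apply (H T m). }
  assert (L0 : Rbar_le l (Finite (op_norm (fun x => minus (S x) (zero : V))))).
  { apply H1. exists (fun _ => zero). split; [apply is_linear_zero|split; [|reflexivity]].
    exists 0%nat. split; [lia|]. exists (fun _ => zero). split.
    - intros c _ i Hi. lia.
    - intros y. split.
      + intros [x <-]. exists (fun _ => RtoC 0). now rewrite lin_comb_O.
      + intros [c ->]. exists zero. now rewrite lin_comb_O. }
  destruct l as [l'| |]; simpl in Ld, L0; try contradiction.
  split; [exact Ld|]. intros T m HT Hm Rm. apply (H1 (op_norm (fun x => minus (S x) (T x)))).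
  exists T. split; [exact HT|]. split; [now exists m|reflexivity].
Qed.

(** Bernstein's bound: an operator of rank below [n] kills a nonzero vector of
    any [n]-dimensional space, on which [S] is bounded below by [d]. *)
Lemma approx_number_ge (S : U -> V) n d (e : nat -> U) : is_linear S -> (1 <= n)%nat ->
  (forall c : nat -> C, (exists j, (1 <= j <= n)%nat /\ c j <> RtoC 0) ->
     0 < norm (lin_comb n c e) /\ d * norm (lin_comb n c e) <= norm (S (lin_comb n c e))) ->
  d <= approx_number S n.
Proof.
  intros HS Hn H. apply approx_number_glb; [exact HS|exact Hn|].
  intros T m HT Hm [v [_ Hv]].
  destruct (dependent_in_span n m (fun j => T (e j)) v Hm) as [c [Nc Hc]].
  { intros j _. apply Hv. now exists (e j). }
  destruct (H c Nc) as [P Q].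
  rewrite <- lin_map_lin_comb in Hc by now apply is_linear_lin_map.
  destruct (minus_linear_bounded S T HS HT) as [L [M [M0 HM]]].
  assert (B := norm_le_op_norm _ M (lin_comb n c e) L HM M0). cbv beta in B.
  rewrite Hc in B.
  assert (Z := f_equal norm (minus_zero_r (G := V) (S (lin_comb n c e)))).
  apply (Rmult_le_reg_r (norm (lin_comb n c e))); [exact P|].
  exact (Rle_trans _ _ _ Q (eq_ind _ (fun r => r <= _) B _ Z)).
Qed.

Lemma approx_number_le (S T : U -> V) n N v d : is_linear S -> lin_map T -> (N < n)%nat ->
  (forall x, exists c, T x = lin_comb N c v) -> 0 <= d ->
  bounded_by (fun x => minus (S x) (T x)) d -> approx_number S n <= d.
Proof.
  intros HS HT Hn Hv Hd HB.
  destruct (is_linear_bounded S HS) as [M [M0 HM]].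
  assert (LT : is_linear T).
  { destruct HT as [T1 T2]. split; [exact T1|exact T2|]. exists (M + d + 1). split; [lra|].
    intros x. replace (T x) with (minus (S x) (minus (S x) (T x))).
    - unfold minus at 1. eapply Rle_trans; [apply norm_triangle|]. rewrite norm_opp.
      specialize (HM x). specialize (HB x). cbv beta in HB.
      assert (0 <= norm x) by apply norm_ge_0. lra.
    - exact (minus_minus (G := V) _ _). }
  destruct (finite_rank T N v HT Hv) as [m [Hm Rm]].
  destruct (minus_linear_bounded S T HS LT) as [_ [M' [M0' HM']]].
  apply Rle_trans with (op_norm (fun x => minus (S x) (T x))).
  - assert (Hn1 : (1 <= n)%nat) by lia.
    destruct (approx_number_glb S n 0 HS Hn1) as [_ A].
    + intros T' m' HT' _ _. destruct (minus_linear_bounded S T' HS HT') as [_ [K [K0 HK]]].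
      apply (op_norm_is_lub _ K HK K0).
    + apply (A T m LT); [lia|exact Rm].
  - apply (op_norm_is_lub _ d HB Hd).
Qed.

End Rank.

(** * Adjoint of the multiplication by a Blaschke factor *)

Lemma square_summable_shift (f : nat -> C) n :
  square_summable f -> square_summable (fun k => f (n + k)%nat).
Proof. intros H. now apply (ex_series_incr_n (V := R_NormedModule) (fun k => Cmod (f k) ^ 2) n). Qed.

Lemma nsq_shift (f : nat -> C) n : square_summable f ->
  nsq f = sum_n (fun k => Cmod (f k) ^ 2) n + nsq (fun k => f (S n + k)%nat).
Proof.
  intros H. unfold nsq. rewrite (Series_incr_n (fun k => Cmod (f k) ^ 2) (S n)); [|lia|exact H].
  rewrite <- sum_n_Reals. reflexivity.
Qed.

(** The tail sums [r_n = sum_k f_(n + k) a ^ k], so that [r_0 = f a] and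
    [f_n = r_n - a r_(n+1)]. *)
Definition tailsum (a : R) (f : nat -> C) (n : nat) : C :=
  csum (fun k => f (n + k)%nat * RtoC a ^ k)%C.

(** The coefficients of [(f - (1 - a^2) f(a) / (1 - a z)) / b_a], where
    [b_a z = (z - a) / (1 - a z)]. *)
Definition quot_coef (a : R) (f : nat -> C) (n : nat) : C :=
  (tailsum a f (S n) - a * tailsum a f n)%C.

Section Adjoint.

Context (a : R) (a_lt : -1 < a < 1).

Lemma Cmod_a : Cmod (RtoC a) < 1.
Proof. rewrite Cmod_R. now apply Rabs_def1. Qed.

Lemma tailsum_correct f n : square_summable f ->
  is_series (fun k => f (n + k)%nat * RtoC a ^ k)%C (tailsum a f n).
Proof.
  intros H. apply l2_series_correct; [now apply square_summable_shift|exact Cmod_a].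
Qed.

Lemma tailsum_rec f n : square_summable f ->
  f n = (tailsum a f n - a * tailsum a f (S n))%C.
Proof.
  intros H.
  assert (E : tailsum a f n = (f n + a * tailsum a f (S n))%C).
  { apply (is_series_C_unique _ _ _ (tailsum_correct f n H)).
    apply (is_series_decr_1 (V := C_NormedModule)).
    replace (plus _ _) with (scal (RtoC a : C_AbsRing) (tailsum a f (S n))).
    2:{ rewrite Nat.add_0_r. unfold plus, opp, scal; simpl. unfold mult; simpl. as_C; ring. }
    apply is_series_ext with
      (fun k => scal (RtoC a : C_AbsRing) (f (S n + k)%nat * RtoC a ^ k : C_NormedModule)%C).
    { intros k. rewrite <- plus_n_Sm. unfold scal; simpl. unfold mult; simpl. as_C; ring. }
    apply (is_series_scal (V := C_NormedModule)). now apply tailsum_correct. }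
  rewrite E. ring.
Qed.

Lemma tailsum_bound f n : square_summable f ->
  (1 - a ^ 2) * Cmod (tailsum a f n) ^ 2 <= nsq (fun k => f (n + k)%nat).
Proof.
  intros H.
  assert (B := is_series_cauchy_schwarz _ _ _ (square_summable_shift f n H)
    (square_summable_geom _ Cmod_a) (tailsum_correct f n H)).
  rewrite nsq_geom in B by exact Cmod_a.
  rewrite Cmod_R in B. rewrite <- (pow2_abs a).
  assert (A := Cmod_a). rewrite Cmod_R in A.
  assert (A1 := Rabs_pos a).
  assert (P : 0 < 1 - Rabs a ^ 2) by nra.
  assert (N := nsq_pos _ (square_summable_shift f n H)).
  assert (C1 : Cmod (tailsum a f n) ^ 2 <= nsq (fun k => f (n + k)%nat) * / (1 - Rabs a ^ 2)).
  { rewrite <- (pow2_sqrt (nsq (fun k => f (n + k)%nat))) by exact N.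
    rewrite <- (pow2_sqrt (/ (1 - Rabs a ^ 2))) by (left; now apply Rinv_0_lt_compat).
    rewrite <- Rpow_mult_distr. apply pow_incr. split; [apply Cmod_ge_0|exact B]. }
  apply (Rmult_le_compat_l (1 - Rabs a ^ 2)) in C1; [|lra].
  eapply Rle_trans; [exact C1|]. right. field. lra.
Qed.

(** Termwise, [|r_n - a r_(n+1)|^2 - |r_(n+1) - a r_n|^2] is
    [(1 - a^2) (|r_n|^2 - |r_(n+1)|^2)], which telescopes. *)
Lemma quot_coef_l2 f : square_summable f ->
  square_summable (quot_coef a f) /\ nsq (quot_coef a f) <= nsq f.
Proof.
  intros H. apply nsq_bounded. intros n.
  assert (T : sum_n (fun k => Cmod (quot_coef a f k) ^ 2) n =
    sum_n (fun k => Cmod (f k) ^ 2) n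
    - (1 - a ^ 2) * (Cmod (tailsum a f 0) ^ 2 - Cmod (tailsum a f (S n)) ^ 2)).
  { assert (St : forall k, Cmod (quot_coef a f k) ^ 2 = Cmod (f k) ^ 2
      - (1 - a ^ 2) * (Cmod (tailsum a f k) ^ 2 - Cmod (tailsum a f (S k)) ^ 2)).
    { intros k. rewrite (tailsum_rec f k H) at 1. unfold quot_coef.
      rewrite !Cmod2_alt. simpl. ring. }
    induction n; [rewrite !sum_O; apply St|].
    rewrite !sum_n_S_R, IHn, St. as_R; ring. }
  rewrite T, (nsq_shift f n H).
  assert (B := tailsum_bound f (S n) H).
  assert (0 <= Cmod (tailsum a f 0) ^ 2) by apply pow2_ge_0.
  assert (0 <= 1 - a ^ 2) by nra. nra.
Qed.

Lemma tailsum_eval f (z F : C) : square_summable f -> Cmod z < 1 ->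
  is_series (fun n => f n * z ^ n)%C F ->
  exists G, is_series (fun n => quot_coef a f n * z ^ n)%C G /\
    ((1 - a * z) * F = (1 - a ^ 2) * tailsum a f 0 + (z - a) * G)%C.
Proof.
  intros H Hz HF.
  assert (Ex : ex_series (fun n => Cmod (tailsum a f (S n) * z ^ n)%C)).
  { set (M := sqrt (nsq f / (1 - a ^ 2))).
    assert (P : 0 < 1 - a ^ 2) by nra.
    apply ex_series_le_R with (fun n => M * Cmod z ^ n).
    - intros n. rewrite Rabs_pos_eq, Cmod_mult, Cmod_pow by apply Cmod_ge_0.
      apply Rmult_le_compat_r; [apply pow_le, Cmod_ge_0|].
      unfold M. rewrite <- (sqrt_pow2 (Cmod (tailsum a f (S n)))) by apply Cmod_ge_0.
      apply sqrt_le_1_alt. apply (Rmult_le_reg_l (1 - a ^ 2)); [exact P|].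
      eapply Rle_trans; [now apply tailsum_bound|].
      replace ((1 - a ^ 2) * (nsq f / (1 - a ^ 2))) with (nsq f) by (field; lra).
      rewrite (nsq_shift f n H).
      assert (0 <= sum_n (fun k => Cmod (f k) ^ 2) n)
        by (apply sum_n_nonneg; intros; apply pow2_ge_0). lra.
    - apply (ex_series_scal_l (V := R_NormedModule) M).
      apply ex_series_geom. rewrite Rabs_pos_eq; [exact Hz|apply Cmod_ge_0]. }
  assert (SQ := csum_correct _ Ex). set (Q := csum (fun n => tailsum a f (S n) * z ^ n)%C) in *.
  set (Rz := (tailsum a f 0 + z * Q)%C).
  assert (SR : is_series (fun n => tailsum a f n * z ^ n)%C Rz).
  { apply (is_series_decr_1 (V := C_NormedModule)).
    replace (plus _ _) with (scal (z : C_AbsRing) (Q : C_NormedModule)).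
    2:{ unfold Rz, plus, opp, scal; simpl. unfold mult; simpl. as_C; ring. }
    apply is_series_ext with
      (fun n => scal (z : C_AbsRing) (tailsum a f (S n) * z ^ n : C_NormedModule)%C).
    { intros n. unfold scal; simpl. unfold mult; simpl. as_C; ring. }
    now apply (is_series_scal (V := C_NormedModule)). }
  exists (1 * Q + (- a) * Rz)%C. split.
  - eapply is_series_ext; [|exact (is_series_Clin _ _ 1 (- a)%C _ _ SQ SR)].
    intros n. unfold quot_coef. as_C; ring.
  - assert (EF : F = (1 * Rz + (- a) * Q)%C).
    { apply (is_series_C_unique _ _ _ HF).
      eapply is_series_ext; [|exact (is_series_Clin _ _ 1 (- a)%C _ _ SR SQ)].
      intros n. simpl. rewrite (tailsum_rec f n H). as_C; ring. }
    rewrite EF. unfold Rz. simpl. ring.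
Qed.

Lemma tailsum_plus f g n : square_summable f -> square_summable g ->
  tailsum a (fun k => f k + g k)%C n = (tailsum a f n + tailsum a g n)%C.
Proof.
  intros Hf Hg. apply csum_unique.
  replace (tailsum a f n + tailsum a g n)%C
    with (1 * tailsum a f n + 1 * tailsum a g n)%C by ring.
  eapply is_series_ext;
    [|exact (is_series_Clin _ _ 1 1 _ _ (tailsum_correct f n Hf) (tailsum_correct g n Hg))].
  intros k. as_C; ring.
Qed.

Lemma tailsum_scal c f n : square_summable f ->
  tailsum a (fun k => c * f k)%C n = (c * tailsum a f n)%C.
Proof.
  intros Hf. apply csum_unique.
  eapply is_series_ext;
    [|exact (is_series_scal (V := C_NormedModule) (c : C_AbsRing) _ _ (tailsum_correct f n Hf))].
  intros k. apply (Cmult_assoc c).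
Qed.

Lemma tailsum_geom (v : R) n : Rabs v < 1 ->
  tailsum a (fun k => RtoC v ^ k)%C n = (RtoC v ^ n / (1 - a * v))%C.
Proof.
  intros Hv.
  assert (A := Cmod_a). rewrite Cmod_R in A.
  assert (Hav : Rabs (v * a) < 1).
  { rewrite Rabs_mult. assert (h := Rabs_pos v). assert (h' := Rabs_pos a). nra. }
  assert (nz : 1 - a * v <> 0) by (destruct (Rabs_def2 (v * a) 1 Hav); nra).
  apply csum_unique.
  replace (RtoC v ^ n / (1 - a * v))%C with (RtoC (v ^ n * / (1 - v * a))).
  2:{ rewrite RtoC_mult, RtoC_inv, RtoC_minus, RtoC_mult, RtoC_pow by (rewrite Rmult_comm; exact nz).
      unfold Cdiv. now rewrite (Cmult_comm a v). }
  assert (SR : is_series (fun k => v ^ n * (v * a) ^ k) (v ^ n * / (1 - v * a)))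
    by (apply (is_series_scal (V := R_NormedModule) (v ^ n)); now apply is_series_geom).
  assert (E : forall k, (RtoC v ^ (n + k) * RtoC a ^ k)%C = RtoC (v ^ n * (v * a) ^ k)).
  { intros k. rewrite RtoC_mult, !RtoC_pow, RtoC_mult, Cpow_mult_l, Cpow_add_r. ring. }
  apply is_series_C; (eapply is_series_ext; [intros k; symmetry; now rewrite E|]); simpl.
  - exact SR.
  - apply (is_series_zero (V := R_NormedModule)).
Qed.

(** As for every adjoint of a multiplication operator, the reproducing kernels are
    eigenvectors. The adjoint of an isometry is also a left inverse up to a multiple of
    the kernel at the zero of the factor, which is the last property. *)
Lemma blaschke_adjoint :
  exists (D : H2 -> H2) (l : H2 -> C),
    lin_map D /\
    ((forall f g, l (plus f g) = (l f + l g)%C) /\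
     (forall (c : C_AbsRing) f, l (scal c f) = (c * l f)%C)) /\
    (forall f, H2_norm (D f) <= H2_norm f) /\
    (forall (v : R) f, Rabs v < 1 -> taylor_coef f = (fun n => RtoC v ^ n)%C ->
       D f = scal (RtoC ((v - a) / (1 - a * v)) : C_AbsRing) f) /\
    (forall (f : H2) (z : disk), ((1 - a * proj1_sig z) * f z =
       (1 - a ^ 2) * l f + (proj1_sig z - a) * D f z)%C).
Proof.
  set (D := fun f : H2 => H2_of _ (proj1 (quot_coef_l2 _ (taylor_coef_l2 f)))).
  assert (TD : forall f, taylor_coef (D f) = quot_coef a (taylor_coef f))
    by (intros; apply taylor_coef_H2_of).
  exists D, (fun f => tailsum a (taylor_coef f) 0). repeat split.
  - intros f g. apply H2_eq_coef. rewrite taylor_coef_plus, !TD, taylor_coef_plus.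
    apply functional_extensionality. intros n. unfold quot_coef.
    rewrite !tailsum_plus by apply taylor_coef_l2. ring.
  - intros c f. apply H2_eq_coef. rewrite taylor_coef_scal, !TD, taylor_coef_scal.
    apply functional_extensionality. intros n. unfold quot_coef.
    rewrite !tailsum_scal by apply taylor_coef_l2. ring.
  - intros f g. rewrite taylor_coef_plus. apply tailsum_plus; apply taylor_coef_l2.
  - intros c f. rewrite taylor_coef_scal. apply tailsum_scal, taylor_coef_l2.
  - intros f. rewrite !H2_norm_nsq, TD. apply sqrt_le_1_alt, quot_coef_l2, taylor_coef_l2.
  - intros v f Hv E. apply H2_eq_coef. rewrite taylor_coef_scal, TD, E.
    apply functional_extensionality. intros n. unfold quot_coef.
    rewrite !tailsum_geom by exact Hv.
    assert (A := Cmod_a). rewrite Cmod_R in A.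
    assert (nz : 1 - a * v <> 0).
    { destruct (Rabs_def2 v 1 Hv). nra. }
    rewrite RtoC_div, !RtoC_minus, RtoC_mult by exact nz. simpl Cpow. field.
    rewrite <- RtoC_mult, <- RtoC_minus. intros h. apply nz. now injection h.
  - intros f z.
    destruct (tailsum_eval (taylor_coef f) _ _ (taylor_coef_l2 f) (proj2_sig z) (H2_series f z))
      as [G [HG E]].
    rewrite E. do 2 f_equal. apply (is_series_C_unique _ _ _ HG).
    rewrite <- TD. apply H2_series.
Qed.

End Adjoint.

(** * Lower bound: spans of reproducing kernels *)

Lemma lin_comb_single {W : NormedModule C_AbsRing} n k c (w : nat -> W) :
  (1 <= k <= n)%nat -> (forall i, (1 <= i <= n)%nat -> i <> k -> w i = zero) ->
  lin_comb n c w = scal (c k : C_AbsRing) (w k).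
Proof.
  assert (Z : forall m, (forall i, (1 <= i <= m)%nat -> w i = zero) -> lin_comb m c w = zero).
  { induction m; intros H; [apply lin_comb_O|].
    rewrite lin_comb_S, IHm by (intros; apply H; lia).
    rewrite plus_zero_l, (H (S m)) by lia. apply nscal_zero_r. }
  induction n; intros Hk H; [lia|].
  rewrite lin_comb_S. destruct (Nat.eq_dec k (S n)) as [->|e].
  - rewrite Z by (intros; apply H; lia). apply plus_zero_l.
  - rewrite IHn by (try lia; intros; apply H; lia).
    rewrite (H (S n)) by lia. rewrite nscal_zero_r. apply plus_zero_r.
Qed.

Fixpoint prod_except (b : nat -> R) (k m : nat) : R :=
  match m with
  | O => 1
  | S m' => prod_except b k m' * (if Nat.eq_dec m k then 1 else b m)
  end.

Lemma prod_except_zero b k m i : (1 <= i <= m)%nat -> i <> k -> b i = 0 -> prod_except b k m = 0.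
Proof.
  intros Hi Hk Hb. induction m; [lia|]. cbn [prod_except].
  destruct (Nat.eq_dec i (S m)) as [->|e].
  - destruct (Nat.eq_dec (S m) k); [congruence|]. rewrite Hb. ring.
  - rewrite IHm by lia. ring.
Qed.

(** The reproducing kernels are common eigenvectors of all the adjoints, and the
    one at [v i] kills the kernel at [v i]; leaving out [i = k] spares the kernel at
    [v k]. *)
Lemma iterated_adjoint (v : nat -> R) (k m : nat) : (forall i, Rabs (v i) < 1) ->
  exists D : H2 -> H2, lin_map D /\ (forall f, H2_norm (D f) <= H2_norm f) /\
    forall x f, Rabs x < 1 -> taylor_coef f = (fun n => RtoC x ^ n)%C ->
      D f = scal (RtoC (prod_except (fun i => (x - v i) / (1 - v i * x)) k m) : C_AbsRing) f.
Proof.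
  intros Hv. induction m.
  - exists (fun f => f). split; [split; reflexivity|]. split; [intros; lra|].
    intros x f _ _. exact (eq_sym (nscal_one (W := H2_NormedModule) f)).
  - destruct IHm as [D [[L1 L2] [N E]]].
    destruct (Nat.eq_dec (S m) k) as [e|e].
    + exists D. split; [now split|]. split; [exact N|]. intros x f Hx Hf.
      cbn [prod_except]. destruct (Nat.eq_dec (S m) k); [|contradiction].
      rewrite Rmult_1_r. now apply E.
    + destruct (blaschke_adjoint (v (S m))) as [D' [_ [[M1 M2] [_ [N' [E' _]]]]]].
      { destruct (Rabs_def2 (v (S m)) 1 (Hv (S m))); lra. }
      exists (fun f => D' (D f)). split; [split|split].
      * intros f g. now rewrite L1, M1.
      * intros c f. now rewrite L2, M2.
      * intros f. eapply Rle_trans; [apply N'|apply N].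
      * intros x f Hx Hf. rewrite (E x f Hx Hf), M2, (E' x f Hx Hf).
        eapply eq_trans; [exact (nscal_assoc (W := H2_NormedModule) _ _ f)|].
        cbn [prod_except]. destruct (Nat.eq_dec (S m) k); [contradiction|].
        now rewrite RtoC_mult.
Qed.

Lemma taylor_coef_lin_comb n c (e : nat -> H2) m :
  taylor_coef (lin_comb n c e) m = sum_n_m (fun j => c j * taylor_coef (e j) m)%C 1 n.
Proof.
  induction n.
  - rewrite sum1_0_C, lin_comb_O.
    rewrite <- (nscal_zero_r (W := H2_NormedModule) (RtoC 0)), taylor_coef_scal. apply Cmult_0_l.
  - rewrite lin_comb_S, taylor_coef_plus, taylor_coef_scal, IHn, sum1_S_C. reflexivity.
Qed.

Lemma is_series_sum1 n (b : nat -> C) (u : nat -> nat -> C) (l : nat -> C) :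
  (forall k, (1 <= k <= n)%nat -> is_series (u k) (l k)) ->
  is_series (fun m => sum_n_m (fun k => b k * u k m)%C 1 n) (sum_n_m (fun k => b k * l k)%C 1 n).
Proof.
  induction n; intros H.
  - rewrite sum1_0_C. eapply is_series_ext; [intros m; symmetry; apply sum1_0_C|].
    apply (is_series_zero (V := C_NormedModule)).
  - rewrite sum1_S_C. eapply is_series_ext; [intros m; symmetry; apply sum1_S_C|].
    apply (is_series_plus (V := C_NormedModule)); [apply IHn; intros; apply H; lia|].
    apply (is_series_scal (V := C_NormedModule) (b (S n) : C_AbsRing)). apply H; lia.
Qed.

Lemma Cmod_sum1_le (a : nat -> C) (M : R) n :
  (forall k, (1 <= k <= n)%nat -> Cmod (a k) <= M) -> Cmod (sum_n_m a 1 n) <= INR n * M.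
Proof.
  induction n; intros H; [rewrite sum1_0_C, Cmod_0; simpl; lra|].
  rewrite sum1_S_C, S_INR. eapply Rle_trans; [apply Cmod_triangle|].
  assert (h := H (S n)). specialize (IHn (fun k hk => H k ltac:(lia))).
  specialize (h ltac:(lia)). lra.
Qed.

Lemma Cconj_sum1 (a : nat -> C) n :
  Cconj (sum_n_m a 1 n) = sum_n_m (fun k => Cconj (a k)) 1 n.
Proof.
  induction n; [rewrite !sum1_0_C; apply injective_projections; simpl; ring|].
  rewrite !sum1_S_C, Cplus_conj, IHn. reflexivity.
Qed.

Lemma Cconj_RtoC (x : R) : Cconj (RtoC x) = RtoC x.
Proof. apply injective_projections; simpl; ring. Qed.

(** For [f] in the span of the kernels at [v_1, ..., v_n], with coefficients [c],
    the square of the norm is [sum conj(c_k) f(v_k)]. The values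
    [f(v_k) = (S f)(u_k)] are bounded by the norm of [S f], and the
    adjoints at the points [v_i], [i <> k], isolate [c_k] and bound it by the norm of [f]. *)
Lemma approx_number_ge_kernels (phi : disk -> disk) (S : H2 -> H2) (n : nat)
  (v : nat -> R) (p : nat -> disk) (K : R) :
  is_composition_operator phi S -> (1 <= n)%nat -> 0 < K ->
  (forall k, Rabs (v k) < 1) ->
  (forall k, proj1_sig (phi (p k)) = RtoC (v k)) ->
  (forall k, (1 <= k <= n)%nat -> let d := prod_except (fun i => (v k - v i) / (1 - v i * v k)) k n in
     d <> 0 /\ 1 - v k ^ 2 <= (K * d) ^ 2 * (1 - Cmod (proj1_sig (p k)) ^ 2)) ->
  / (INR n * K) <= approx_number S n.
Proof.
  intros [LS HS] Hn HK Hv Hp Hd.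
  assert (n0 : 1 <= INR n) by (apply (le_INR 1); exact Hn).
  assert (Ex : forall k, Cmod (RtoC (v k)) < 1) by (intros; now rewrite Cmod_R).
  set (e := fun k => H2_of _ (square_summable_geom _ (Ex k))).
  assert (Te : forall k, taylor_coef (e k) = (fun m => RtoC (v k) ^ m)%C)
    by (intros; apply taylor_coef_H2_of).
  assert (Ne : forall k, H2_norm (e k) ^ 2 * (1 - v k ^ 2) = 1).
  { intros k. rewrite H2_norm_sq, Te, nsq_geom, Cmod_R, pow2_abs by apply Ex.
    apply Rinv_l. destruct (Rabs_def2 (v k) 1 (Hv k)). nra. }
  apply (approx_number_ge S n _ e LS Hn).
  intros c [j [Hj Nj]]. set (f := lin_comb n c e).
  change (0 < H2_norm f /\ / (INR n * K) * H2_norm f <= H2_norm (S f)).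
  assert (Ck : forall k, (1 <= k <= n)%nat ->
    Cmod (c k) * Rabs (prod_except (fun i => (v k - v i) / (1 - v i * v k)) k n) * H2_norm (e k)
      <= H2_norm f).
  { intros k Hk. destruct (iterated_adjoint v k n Hv) as [D [LD [ND ED]]].
    eapply Rle_trans; [|apply (ND f)]. right. unfold f.
    rewrite lin_map_lin_comb by exact LD.
    rewrite (lin_comb_single n k) by
      (try exact Hk; intros i Hi Hik; rewrite (ED (v i) (e i) (Hv i) (Te i));
       rewrite (prod_except_zero _ k n i) by (try assumption; unfold Rdiv; ring);
       exact (nscal_zero_l (W := H2_NormedModule) (e i))).
    rewrite (ED (v k) (e k) (Hv k) (Te k)).
    change (Cmod (c k) * Rabs (prod_except (fun i => (v k - v i) / (1 - v i * v k)) k n) * H2_norm (e k)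
      = H2_norm (H2_scal (c k) (H2_scal (RtoC (prod_except (fun i => (v k - v i) / (1 - v i * v k)) k n))
         (e k)))).
    rewrite !H2_norm_scal, Cmod_R. ring. }
  assert (Pe : forall k, 0 < H2_norm (e k)).
  { intros k. assert (h := H2_norm_pos (e k)). specialize (Ne k).
    destruct h as [h|h]; [exact h|]. rewrite <- h in Ne. lra. }
  assert (F0 : 0 < H2_norm f).
  { eapply Rlt_le_trans; [|apply (Ck j Hj)]. apply Rmult_lt_0_compat; [|apply Pe].
    apply Rmult_lt_0_compat; [now apply Cmod_gt_0|]. apply Rabs_pos_lt. now apply (Hd j). }
  split; [exact F0|].
  assert (Sq : RtoC (H2_norm f ^ 2) = sum_n_m (fun k => Cconj (c k) * f (phi (p k)))%C 1 n).
  { assert (S1 : is_series (fun m => RtoC (Cmod (taylor_coef f m) ^ 2)) (RtoC (H2_norm f ^ 2))).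
    { rewrite H2_norm_sq. apply is_series_C; simpl.
      - apply Series_correct, taylor_coef_l2.
      - apply (is_series_zero (V := R_NormedModule)). }
    apply (is_series_C_unique _ _ _ S1).
    eapply is_series_ext; [|apply (is_series_sum1 n (fun k => Cconj (c k))
      (fun k m => taylor_coef f m * RtoC (v k) ^ m)%C (fun k => f (phi (p k))))].
    - intros m. cbv beta. symmetry. rewrite Cmod2_conj. unfold f at 2.
      rewrite taylor_coef_lin_comb, Cconj_sum1.
      rewrite <- (Cplus_0_l (taylor_coef f m * _)).
      rewrite <- (sum1_zero_C (fun _ => RtoC 0) n) by reflexivity.
      rewrite <- sum1_Clin. apply sum1_ext_C. intros k _.
      rewrite Te, Cmult_conj, Cpow_conj, Cconj_RtoC. as_C; ring.
    - intros k _. rewrite <- Hp. apply H2_series. }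
  assert (Bd : H2_norm f ^ 2 <= INR n * (K * H2_norm f * H2_norm (S f))).
  { rewrite <- (Rabs_pos_eq (H2_norm f ^ 2)) by apply pow2_ge_0.
    rewrite <- Cmod_R, Sq. apply Cmod_sum1_le. intros k Hk.
    rewrite Cmod_mult, Cmod_conj, <- HS.
    destruct (Hd k Hk) as [d0 d1]. cbv zeta in d0, d1. specialize (Ck k Hk).
    set (d := prod_except (fun i => (v k - v i) / (1 - v i * v k)) k n) in *.
    assert (P := H2_pointwise (S f) (p k)).
    assert (Up : 0 < 1 - Cmod (proj1_sig (p k)) ^ 2).
    { assert (h := proj2_sig (p k)). simpl in h.
      assert (h' := Cmod_ge_0 (proj1_sig (p k))). nra. }
    set (up := 1 - Cmod (proj1_sig (p k)) ^ 2) in *.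
    assert (P2 : Cmod (S f (p k)) ^ 2 * up <= H2_norm (S f) ^ 2).
    { apply (Rmult_le_compat_r up) in P; [|lra]. unfold Rdiv in P.
      rewrite Rmult_assoc, Rinv_l, Rmult_1_r in P by lra. exact P. }
    specialize (Ne k). specialize (Pe k).
    assert (D0 : 0 < Rabs d) by now apply Rabs_pos_lt.
    assert (D2 : Rabs d ^ 2 = d ^ 2) by apply pow2_abs.
    set (X := Cmod (c k)) in *. set (Y := Cmod (S f (p k))) in *.
    assert (X0 : 0 <= X) by apply Cmod_ge_0. assert (Y0 : 0 <= Y) by apply Cmod_ge_0.
    assert (N0 := H2_norm_pos (S f)).
    set (N := H2_norm (S f)) in *. set (F := H2_norm f) in *. set (E := H2_norm (e k)) in *.
    set (A := Rabs d) in *.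
    assert (YB : Y <= K * A * E * N).
    { apply Rsqr_incr_0_var; [|repeat apply Rmult_le_pos; lra]. unfold Rsqr.
      assert (Y ^ 2 * (1 - v k ^ 2) <= (K * d) ^ 2 * N ^ 2).
      { eapply Rle_trans; [apply Rmult_le_compat_l; [apply pow2_ge_0|exact d1]|].
        replace (Y ^ 2 * ((K * d) ^ 2 * up)) with ((K * d) ^ 2 * (Y ^ 2 * up)) by ring.
        apply Rmult_le_compat_l; [apply pow2_ge_0|exact P2]. }
      apply (Rmult_le_compat_l (E ^ 2)) in H; [|apply pow2_ge_0].
      replace (E ^ 2 * (Y ^ 2 * (1 - v k ^ 2))) with (Y ^ 2 * (E ^ 2 * (1 - v k ^ 2))) in H by ring.
      rewrite Ne in H. rewrite Rpow_mult_distr, <- D2 in H.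
      replace (K * A * E * N * (K * A * E * N)) with (E ^ 2 * (K ^ 2 * A ^ 2 * N ^ 2)) by ring.
      lra. }
    apply Rle_trans with (X * (K * A * E * N)); [now apply Rmult_le_compat_l|].
    replace (X * (K * A * E * N)) with (K * (X * A * E) * N) by ring.
    apply Rmult_le_compat_r; [exact N0|]. apply Rmult_le_compat_l; [lra|exact Ck]. }
  assert (nK : 0 < INR n * K) by nra.
  apply (Rmult_le_reg_l (INR n * K)); [exact nK|].
  rewrite <- Rmult_assoc, Rinv_r, Rmult_1_l by lra.
  apply (Rmult_le_reg_l (H2_norm f)); [exact F0|]. lra.
Qed.

(** * Lower bound: the lens map on a geometric progression of the diameter *)

Lemma exp_le (x y : R) : x <= y -> exp x <= exp y.
Proof.
  intros H. destruct (Req_dec x y) as [->|e]; [lra|]. left. apply exp_increasing. lra.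
Qed.

Lemma ln_ge_half_diff (s : R) : 0 < s <= 1 -> s - / s <= 2 * ln s.
Proof.
  intros Hs. destruct (Req_dec s 1) as [->|e]; [rewrite ln_1, Rinv_1; lra|].
  set (g := fun x => 2 * ln x - x + / x).
  destruct (MVT_gen g s 1 (fun x => 2 / x - 1 - / x ^ 2)) as [x [Hx E]].
  - rewrite Rmin_left, Rmax_right by lra. intros x Hx. unfold g. auto_derive; [lra|field; lra].
  - rewrite Rmin_left, Rmax_right by lra. intros x Hx.
    apply continuity_pt_filterlim, (ex_derive_continuous g). unfold g. auto_derive. lra.
  - rewrite Rmin_left, Rmax_right in Hx by lra.
    assert (N : 2 / x - 1 - / x ^ 2 <= 0).
    { replace (2 / x - 1 - / x ^ 2) with (- (1 - / x) ^ 2) by (field; lra).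
      assert (h := pow2_ge_0 (1 - / x)). lra. }
    unfold g in E at 1. rewrite ln_1, Rinv_1 in E.
    assert (g s >= 0) by nra. unfold g in H. lra.
Qed.

Lemma exp_neg_pow (h : R) (n : nat) : exp (- h) ^ n = exp (- h * INR n).
Proof.
  induction n; [simpl; rewrite Rmult_0_r, exp_0; reflexivity|].
  rewrite S_INR. simpl pow. rewrite IHn, <- exp_plus. f_equal. ring.
Qed.

Fixpoint sq_euler_product (q : R) (m : nat) : R :=
  match m with O => 1 | S k => sq_euler_product q k * (1 - q ^ S k) ^ 2 end.

(** With [s_n = sqrt (1 - q ^ n)], [q = exp (- h)], one has
    [- ln (1 - q ^ n) <= 1 / s_n - s_n = q ^ n / s_n <= (2 / h) (s_n - s_(n-1))],
    and the last bound telescopes. *)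
Lemma sq_euler_product_ge (h : R) (m : nat) : 0 < h ->
  exp (- (4 / h)) <= sq_euler_product (exp (- h)) m.
Proof.
  intros Hh. set (q := exp (- h)).
  assert (q0 : 0 < q) by apply exp_pos.
  assert (q1 : q < 1) by (unfold q; rewrite <- exp_0; apply exp_increasing; lra).
  assert (qn : forall m, 0 < q ^ m <= 1).
  { intros i. split; [now apply pow_lt|]. rewrite <- (pow1 i). apply pow_incr. lra. }
  set (s := fun m => sqrt (1 - q ^ m)).
  assert (W : exp (- (4 / h) * s m) <= sq_euler_product q m).
  { induction m.
    - unfold s. simpl. rewrite Rminus_diag, sqrt_0, Rmult_0_r, exp_0. lra.
    - assert (Q := qn m).
      assert (Q1 : q ^ S m < 1).
      { simpl. destruct Q as [Q0 Q1]. nra. }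
      assert (Q2 : 0 < q ^ S m) by apply qn.
      assert (s0 : 0 < s (S m)) by (apply sqrt_lt_R0; lra).
      assert (s2 : s (S m) * s (S m) = 1 - q ^ S m) by (apply sqrt_sqrt; lra).
      assert (s2' : s m * s m = 1 - q ^ m) by (apply sqrt_sqrt; lra).
      assert (s1 : s (S m) <= 1) by nra.
      assert (s0' : 0 <= s m) by apply sqrt_pos.
      assert (L := ln_ge_half_diff (s (S m)) (conj s0 s1)).
      assert (qh : q ^ S m * h <= q ^ m - q ^ S m).
      { assert (B : 1 + h <= exp h) by apply exp_ineq1_le.
        assert (Eq : exp h * q = 1)
          by (unfold q; rewrite <- exp_plus, <- exp_0; f_equal; ring).
        simpl. assert (q * (1 + h) <= 1) by nra.
        destruct Q. nra. }
      assert (T : / s (S m) - s (S m) <= 2 / h * (s (S m) - s m)).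
      { apply (Rmult_le_reg_r (s (S m) * h)); [nra|].
        replace ((/ s (S m) - s (S m)) * (s (S m) * h)) with ((1 - s (S m) * s (S m)) * h)
          by (field; lra).
        replace (2 / h * (s (S m) - s m) * (s (S m) * h)) with (2 * s (S m) * (s (S m) - s m))
          by (field; lra).
        assert (s m <= s (S m)) by nra. nra. }
      assert (E : 1 - q ^ S m = exp (2 * ln (s (S m)))).
      { rewrite <- s2. replace (2 * ln (s (S m))) with (ln (s (S m)) + ln (s (S m))) by ring.
        rewrite exp_plus, exp_ln by exact s0. reflexivity. }
      assert (E' : exp (- (2 / h * (s (S m) - s m))) <= 1 - q ^ S m).
      { rewrite E. apply exp_le. lra. }
      assert (P := exp_pos (- (2 / h * (s (S m) - s m)))).
      cbn [sq_euler_product].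
      replace (- (4 / h) * s (S m)) with (- (4 / h) * s m +
        (- (2 / h * (s (S m) - s m)) + - (2 / h * (s (S m) - s m)))) by (field; lra).
      rewrite !exp_plus. apply Rmult_le_compat; [left; apply exp_pos|nra|exact IHm|].
      rewrite <- Rsqr_pow2. apply Rmult_le_compat; lra. }
  eapply Rle_trans; [|exact W]. apply exp_le.
  assert (h4 : 0 < 4 / h) by (apply Rdiv_lt_0_compat; lra).
  assert (sm : s m <= 1).
  { destruct (qn m) as [q2 q3]. assert (s m * s m = 1 - q ^ m) by (apply sqrt_sqrt; lra).
    assert (0 <= s m) by apply sqrt_pos. nra. }
  assert (0 <= 4 / h * (1 - s m)) by (apply Rmult_le_pos; lra). lra.
Qed.

(** The indices below [k] and those above [k] each contribute at least an Euler
    product. *)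
Lemma prod_except_geometric_ge (h : R) (b : nat -> R) (k n : nat) : 0 < h -> (1 <= k <= n)%nat ->
  (forall i, (i < k)%nat -> (1 - exp (- h) ^ (k - i)) ^ 2 <= Rabs (b i)) ->
  (forall i, (k < i)%nat -> (1 - exp (- h) ^ (i - k)) ^ 2 <= Rabs (b i)) ->
  exp (- (8 / h)) <= Rabs (prod_except b k n).
Proof.
  intros Hh Hk B1 B2.
  set (w := sq_euler_product (exp (- h))).
  assert (W : forall m, exp (- (4 / h)) <= w m) by (intros; now apply sq_euler_product_ge).
  assert (WS : forall m, w (S m) = w m * (1 - exp (- h) ^ S m) ^ 2) by reflexivity.
  assert (W0 : w O = 1) by reflexivity.
  assert (w0 : forall m, 0 < w m) by (intros; eapply Rlt_le_trans; [apply exp_pos|apply W]).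
  assert (I1 : forall m, (m < k)%nat -> w (k - 1)%nat <= Rabs (prod_except b k m) * w (k - 1 - m)%nat).
  { induction m; intros Hm.
    - simpl. rewrite Nat.sub_0_r, Rabs_R1. lra.
    - cbn [prod_except]. destruct (Nat.eq_dec (S m) k); [lia|].
      specialize (IHm ltac:(lia)). rewrite Rabs_mult.
      replace (k - 1 - m)%nat with (S (k - 1 - S m)) in IHm by lia. rewrite WS in IHm.
      specialize (B1 (S m) ltac:(lia)).
      replace (S (k - 1 - S m)) with (k - S m)%nat in IHm by lia.
      assert (P := w0 (k - 1 - S m)%nat).
      assert (P' := Rabs_pos (prod_except b k m)).
      eapply Rle_trans; [exact IHm|].
      replace (Rabs (prod_except b k m) * Rabs (b (S m)) * w (k - 1 - S m)%nat)
        with (Rabs (prod_except b k m) * (w (k - 1 - S m)%nat * Rabs (b (S m)))) by ring.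
      apply Rmult_le_compat_l; [exact P'|]. apply Rmult_le_compat_l; [lra|exact B1]. }
  assert (I2 : forall d, (k + d <= n)%nat -> w (k - 1)%nat * w d <= Rabs (prod_except b k (k + d))).
  { induction d; intros Hd.
    - rewrite Nat.add_0_r, W0. specialize (I1 (k - 1)%nat ltac:(lia)).
      rewrite Nat.sub_diag, W0 in I1.
      assert (E : prod_except b k k = prod_except b k (k - 1)).
      { clear. destruct k as [|k]; [reflexivity|]. replace (S k - 1)%nat with k by lia.
        cbn [prod_except]. destruct (Nat.eq_dec (S k) (S k)); [ring|lia]. }
      rewrite E. lra.
    - rewrite <- plus_n_Sm. cbn [prod_except]. destruct (Nat.eq_dec (S (k + d)) k); [lia|].
      specialize (IHd ltac:(lia)). rewrite Rabs_mult, WS.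
      specialize (B2 (S (k + d)) ltac:(lia)).
      replace (S (k + d) - k)%nat with (S d) in B2 by lia.
      rewrite <- Rmult_assoc. apply Rmult_le_compat; [|apply pow2_ge_0|exact IHd|exact B2].
      assert (p1 := w0 (k - 1)%nat). assert (p2 := w0 d). nra. }
  specialize (I2 (n - k)%nat ltac:(lia)). replace (k + (n - k))%nat with n in I2 by lia.
  eapply Rle_trans; [|exact I2].
  replace (- (8 / h)) with (- (4 / h) + - (4 / h)) by (field; lra). rewrite exp_plus.
  assert (X := exp_pos (- (4 / h))).
  apply Rmult_le_compat; try lra; apply W.
Qed.

(** The point [T (exp x)] of the real diameter. *)
Definition pt (x : R) : R := (1 - exp x) / (1 + exp x).

Lemma pt_lt (x : R) : Rabs (pt x) < 1.
Proof.
  assert (h := exp_pos x). unfold pt. apply Rabs_def1;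
    apply (Rmult_lt_reg_r (1 + exp x)); try lra; unfold Rdiv;
    rewrite Rmult_assoc, Rinv_l by lra; lra.
Qed.

Lemma one_minus_pt_sq (x : R) : 1 - pt x ^ 2 = 4 * exp x / (1 + exp x) ^ 2.
Proof. assert (h := exp_pos x). unfold pt. field. lra. Qed.

Lemma blaschke_pt (x y : R) :
  (pt x - pt y) / (1 - pt y * pt x) = (exp y - exp x) / (exp y + exp x).
Proof.
  assert (h := exp_pos x). assert (h' := exp_pos y). unfold pt. field.
  repeat split; try lra.
Qed.

Lemma blaschke_exp_ge (x y : R) : x < y ->
  (1 - exp (- (y - x))) ^ 2 <= Rabs ((exp y - exp x) / (exp y + exp x)).
Proof.
  intros H. assert (h := exp_pos x). assert (h' := exp_pos y).
  assert (hxy : exp x < exp y) by now apply exp_increasing.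
  set (r := exp (- (y - x))).
  assert (Er : exp x = exp y * r) by (unfold r; rewrite <- exp_plus; f_equal; ring).
  assert (r0 : 0 < r) by apply exp_pos.
  assert (r1 : r < 1) by nra.
  rewrite Rabs_pos_eq by (apply Rdiv_le_0_compat; lra).
  rewrite Er. replace ((exp y - exp y * r) / (exp y + exp y * r)) with ((1 - r) / (1 + r))
    by (field; split; nra).
  apply (Rmult_le_reg_r (1 + r)); [lra|].
  replace ((1 - r) / (1 + r) * (1 + r)) with (1 - r) by (field; lra).
  assert (0 <= (1 - r) * (r * r)) by (apply Rmult_le_pos; nra).
  replace ((1 - r) ^ 2 * (1 + r)) with ((1 - r) - (1 - r) * (r * r)) by ring. lra.
Qed.

Lemma lens_pt (theta x : R) : lens_fun theta (RtoC (pt x)) = RtoC (pt (theta * x)).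
Proof.
  assert (h := exp_pos x).
  assert (Cy : forall y, cayley (RtoC (exp y)) = RtoC (pt y)).
  { intros y. assert (h' := exp_pos y). unfold cayley, pt.
    rewrite RtoC_div, RtoC_minus, RtoC_plus by lra. reflexivity. }
  assert (E : cayley (RtoC (pt x)) = RtoC (exp x)).
  { unfold cayley. rewrite <- RtoC_minus, <- RtoC_plus, <- RtoC_div.
    - f_equal. unfold pt. field. lra.
    - assert (P := pt_lt x). destruct (Rabs_def2 _ _ P). lra. }
  unfold lens_fun. rewrite E.
  assert (Hp : half_plane_power theta (RtoC (exp x)) = RtoC (exp (theta * x))).
  { unfold half_plane_power. simpl. unfold Rdiv. rewrite Rmult_0_l, atan_0, Rmult_0_r, cos_0, sin_0.
    rewrite Cmod_R, Rabs_pos_eq by lra. unfold Rpower. rewrite ln_exp.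
    apply injective_projections; simpl; ring. }
  rewrite Hp. apply Cy.
Qed.

(** The points are [u_k = T (exp (k eps))], with images [v_k = T (exp (k theta eps))]. The
    first term of the exponent bounds the loss [sqrt ((1 - v_k^2) / (1 - u_k^2))], the
    second comes from the separation of the images. *)
Lemma approx_lens_ge (theta : R) (Ht : 0 < theta < 1) (S : H2 -> H2) (n : nat) (eps : R) :
  is_composition_operator (lens_map theta Ht) S -> (1 <= n)%nat -> 0 < eps ->
  / INR n * exp (- ((1 - theta) / 2 * INR n * eps + 8 / (theta * eps))) <= approx_number S n.
Proof.
  intros HS Hn He.
  assert (n0 : 1 <= INR n) by (apply (le_INR 1); exact Hn).
  set (K := exp ((1 - theta) / 2 * INR n * eps + 8 / (theta * eps))).
  assert (K0 : 0 < K) by apply exp_pos.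
  rewrite exp_Ropp. fold K. rewrite <- Rinv_mult.
  assert (Hu : forall k : nat, Cmod (RtoC (pt (INR k * eps))) < 1)
    by (intros k; rewrite Cmod_R; apply pt_lt).
  apply (approx_number_ge_kernels (lens_map theta Ht) S n
    (fun k => pt (theta * (INR k * eps))) (fun k => exist _ _ (Hu k)) K HS Hn K0).
  { intros k. apply pt_lt. }
  { intros k. simpl. apply lens_pt. }
  intros k Hk. cbv zeta.
  set (b := fun i => (pt (theta * (INR k * eps)) - pt (theta * (INR i * eps))) /
    (1 - pt (theta * (INR i * eps)) * pt (theta * (INR k * eps)))).
  assert (hh : 0 < theta * eps) by (apply Rmult_lt_0_compat; lra).
  assert (EI : forall i j, (i < j)%nat -> exp (- (theta * eps)) ^ (j - i) =
     exp (- (theta * (INR j * eps) - theta * (INR i * eps)))).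
  { intros i j Hij. rewrite exp_neg_pow, minus_INR by lia. f_equal. ring. }
  assert (LI : forall i j, (i < j)%nat -> theta * (INR i * eps) < theta * (INR j * eps)).
  { intros i j Hij. apply lt_INR in Hij. nra. }
  assert (G : exp (- (8 / (theta * eps))) <= Rabs (prod_except b k n)).
  { apply prod_except_geometric_ge; [exact hh|exact Hk| |].
    - intros i Hi. rewrite EI by exact Hi. unfold b. rewrite blaschke_pt.
      replace (Rabs ((exp (theta * (INR i * eps)) - exp (theta * (INR k * eps))) /
        (exp (theta * (INR i * eps)) + exp (theta * (INR k * eps)))))
        with (Rabs ((exp (theta * (INR k * eps)) - exp (theta * (INR i * eps))) /
        (exp (theta * (INR k * eps)) + exp (theta * (INR i * eps))))).
      + apply blaschke_exp_ge. now apply LI.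
      + rewrite <- Rabs_Ropp. f_equal. assert (p1 := exp_pos (theta * (INR i * eps))).
        assert (p2 := exp_pos (theta * (INR k * eps))). field. lra.
    - intros i Hi. rewrite EI by exact Hi. unfold b. rewrite blaschke_pt.
      apply blaschke_exp_ge. now apply LI. }
  assert (E8 := exp_pos (- (8 / (theta * eps)))).
  split.
  { intros Z. rewrite Z, Rabs_R0 in G. lra. }
  simpl proj1_sig. rewrite Cmod_R, pow2_abs, !one_minus_pt_sq.
  set (x := INR k * eps).
  assert (x0 : 0 <= x) by (unfold x; assert (h := pos_INR k); nra).
  assert (xn : x <= INR n * eps).
  { unfold x. apply Rmult_le_compat_r; [lra|]. apply le_INR. lia. }
  rewrite Rpow_mult_distr, <- (pow2_abs (prod_except b k n)).
  assert (KG : exp ((1 - theta) / 2 * x) <= K * Rabs (prod_except b k n)).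
  { apply Rle_trans with (K * exp (- (8 / (theta * eps)))); [|now apply Rmult_le_compat_l; [lra|]].
    unfold K. rewrite <- exp_plus.
    apply exp_le.
    replace ((1 - theta) / 2 * INR n * eps + 8 / (theta * eps) + - (8 / (theta * eps)))
      with ((1 - theta) / 2 * (INR n * eps)) by ring.
    apply Rmult_le_compat_l; lra. }
  apply Rle_trans with (exp ((1 - theta) / 2 * x) ^ 2 * (4 * exp x / (1 + exp x) ^ 2)).
  - assert (px := exp_pos x). assert (pt' := exp_pos (theta * x)).
    replace (exp ((1 - theta) / 2 * x) ^ 2) with (exp ((1 - theta) * x)).
    2:{ simpl. rewrite Rmult_1_r, <- exp_plus. f_equal. field. }
    assert (py := exp_pos ((1 - theta) * x)).
    assert (Ex : exp x = exp (theta * x) * exp ((1 - theta) * x))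
      by (rewrite <- exp_plus; f_equal; ring).
    assert (y1 : 1 <= exp ((1 - theta) * x)).
    { apply Rle_trans with (exp 0); [rewrite exp_0; lra|]. apply exp_le, Rmult_le_pos; lra. }
    set (y := exp ((1 - theta) * x)) in *. set (w := exp (theta * x)) in *.
    rewrite Ex.
    apply (Rmult_le_reg_r ((1 + w) ^ 2 * (1 + w * y) ^ 2)).
    { apply Rmult_lt_0_compat; apply pow_lt; nra. }
    replace (4 * w / (1 + w) ^ 2 * ((1 + w) ^ 2 * (1 + w * y) ^ 2)) with (4 * w * (1 + w * y) ^ 2)
      by (field; lra).
    replace (y * (4 * (w * y) / (1 + w * y) ^ 2) * ((1 + w) ^ 2 * (1 + w * y) ^ 2))
      with (4 * w * (y * (1 + w)) ^ 2) by (field; nra).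
    apply Rmult_le_compat_l; [lra|]. apply pow_incr. split; nra.
  - apply Rmult_le_compat_r.
    + assert (px := exp_pos x). apply Rdiv_le_0_compat; [lra|apply pow_lt; lra].
    + rewrite <- Rpow_mult_distr. apply pow_incr. split; [left; apply exp_pos|exact KG].
Qed.

Lemma exp_ge_sq (y : R) : 0 <= y -> y ^ 2 / 4 <= exp y.
Proof.
  intros H. assert (E : exp y = exp (y / 2) ^ 2)
    by (simpl; rewrite Rmult_1_r, <- exp_plus; f_equal; field).
  rewrite E. replace (y ^ 2 / 4) with ((y / 2) ^ 2) by field.
  apply pow_incr. split; [lra|]. assert (h := exp_ineq1_le (y / 2)). lra.
Qed.

(** Balancing the two exponents gives [4 sqrt ((1 - theta) / theta)], and
    [4 < PI sqrt 2] leaves room to absorb the factor [1 / n]. *)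
Lemma lens_lower_bound (theta : R) (Ht : 0 < theta < 1) (S : H2 -> H2) :
  is_composition_operator (lens_map theta Ht) S ->
  exists c, 0 < c /\ forall n, (1 <= n)%nat ->
    c * exp (- (PI * sqrt (2 * (1 - theta) / theta)) * sqrt (INR n)) <= approx_number S n.
Proof.
  intros HS.
  assert (d0 : 0 < (1 - theta) / theta) by (apply Rdiv_lt_0_compat; lra).
  set (s := sqrt ((1 - theta) / theta)).
  assert (s0 : 0 < s) by now apply sqrt_lt_R0.
  assert (s2 : s * s = (1 - theta) / theta) by (apply sqrt_sqrt; lra).
  set (B := PI * sqrt (2 * (1 - theta) / theta)).
  assert (HB : 4 * s < B).
  { unfold B. replace (2 * (1 - theta) / theta) with (2 * ((1 - theta) / theta)) by (field; lra).
    rewrite sqrt_mult by lra. fold s. rewrite <- Rmult_assoc.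
    apply Rmult_lt_compat_r; [exact s0|].
    assert (P := PI2_3_2).
    assert (R2 : 14 / 10 < sqrt 2).
    { apply Rsqr_incrst_0; [|lra|apply sqrt_pos]. rewrite Rsqr_sqrt by lra. unfold Rsqr. lra. }
    nra. }
  set (k := B - 4 * s). assert (k0 : 0 < k) by (unfold k; lra).
  exists (k ^ 2 / 4). split; [assert (0 < k ^ 2) by (apply pow_lt; lra); lra|].
  intros n Hn.
  assert (n0 : 1 <= INR n) by (apply (le_INR 1); exact Hn).
  set (r := sqrt (INR n)).
  assert (r0 : 0 < r) by (apply sqrt_lt_R0; lra).
  assert (r2 : r * r = INR n) by (apply sqrt_sqrt; lra).
  assert (es : 0 < 4 / ((1 - theta) * r) * s).
  { apply Rmult_lt_0_compat; [|exact s0]. apply Rdiv_lt_0_compat; [lra|nra]. }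
  eapply Rle_trans; [|apply (approx_lens_ge theta Ht S n _ HS Hn es)].
  assert (E1 : (1 - theta) / 2 * INR n * (4 / ((1 - theta) * r) * s) +
    8 / (theta * (4 / ((1 - theta) * r) * s)) = 4 * s * r).
  { rewrite <- r2.
    replace ((1 - theta) / 2 * (r * r) * (4 / ((1 - theta) * r) * s)) with (2 * s * r)
      by (field; lra).
    replace (8 / (theta * (4 / ((1 - theta) * r) * s))) with (2 * ((1 - theta) / theta) / s * r)
      by (field; lra).
    rewrite <- s2. field. lra. }
  rewrite E1.
  replace (- B * r) with (- (k * r) + - (4 * s * r)) by (unfold k; ring).
  rewrite exp_plus, <- Rmult_assoc. apply Rmult_le_compat_r; [left; apply exp_pos|].
  rewrite exp_Ropp.
  assert (kr : 0 <= k * r) by nra.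
  assert (Q := exp_ge_sq (k * r) kr). assert (X := exp_pos (k * r)).
  apply (Rmult_le_reg_r (INR n * exp (k * r))); [nra|].
  replace (/ INR n * (INR n * exp (k * r))) with (exp (k * r)) by (field; lra).
  replace (k ^ 2 / 4 * / exp (k * r) * (INR n * exp (k * r))) with (k ^ 2 / 4 * INR n)
    by (field; lra).
  rewrite <- r2. lra.
Qed.

(** * Division by a finite Blaschke product *)

Lemma is_series_Cgeom (w : C) : Cmod w < 1 -> is_series (fun n => w ^ n)%C (/ (1 - w))%C.
Proof.
  intros Hw.
  assert (Ex : ex_series (fun n => Cmod (w ^ n)%C)).
  { apply (ex_series_ext (fun n => Cmod w ^ n)); [intros; symmetry; apply Cmod_pow|].
    apply ex_series_geom. rewrite Rabs_pos_eq; [exact Hw|apply Cmod_ge_0]. }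
  assert (S := csum_correct _ Ex). set (s := csum (fun n => w ^ n)%C) in *.
  assert (S' : is_series (fun n => w ^ n)%C (1 + w * s)%C).
  { apply (is_series_decr_1 (V := C_NormedModule)).
    replace (plus _ _) with (scal (w : C_AbsRing) (s : C_NormedModule)).
    2:{ unfold plus, opp, scal; simpl. unfold mult; simpl. as_C; ring. }
    apply (is_series_scal (V := C_NormedModule) (w : C_AbsRing) _ _ S). }
  assert (E := is_series_C_unique _ _ _ S S').
  assert (N : (1 - w)%C <> 0) by (apply Re_pos_neq_0, Re_one_minus, Hw).
  replace (/ (1 - w))%C with s; [exact S|].
  apply (f_equal (fun x => x - w * s)%C) in E.
  transitivity ((s - w * s) / (1 - w))%C; [field; exact N|]. rewrite E. field. exact N.
Qed.

Lemma Cmod_aw_lt (a : R) (w : C) : Rabs a < 1 -> Cmod w < 1 -> Cmod (a * w) < 1.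
Proof.
  intros Ha Hw. rewrite Cmod_mult, Cmod_R.
  assert (h := Rabs_pos a). assert (h' := Cmod_ge_0 w). nra.
Qed.

Lemma one_minus_aw_neq_0 (a : R) (w : C) : Rabs a < 1 -> Cmod w < 1 -> (1 - a * w)%C <> 0.
Proof. intros Ha Hw. now apply Re_pos_neq_0, Re_one_minus, Cmod_aw_lt. Qed.

Definition blaschke (a : R) (w : C) : C := ((w - a) / (1 - a * w))%C.

Fixpoint blaschke_prod (a : nat -> R) (m : nat) (w : C) : C :=
  match m with O => RtoC 1 | S k => (blaschke_prod a k w * blaschke (a (S k)) w)%C end.

Lemma kernel_in_H2 (a : R) : Rabs a < 1 ->
  exists k : H2, forall z : disk, k z = (/ (1 - a * proj1_sig z))%C.
Proof.
  intros Ha. assert (Hc : Cmod (RtoC a) < 1) by now rewrite Cmod_R.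
  exists (H2_of _ (square_summable_geom _ Hc)). intros [z Hz].
  apply (is_series_C_unique _ _ _ (H2_series _ _)).
  rewrite taylor_coef_H2_of. simpl.
  eapply is_series_ext; [|apply is_series_Cgeom, Cmod_aw_lt; [exact Ha|exact Hz]].
  intros n. apply Cpow_mult_l.
Qed.

(** [b_a z = - a + (1 - a^2) z / (1 - a z)] has absolutely summable coefficients. *)
Lemma blaschke_mult_H2 (a : R) (g : H2) : Rabs a < 1 ->
  exists h : H2, forall z : disk, h z = (blaschke a (proj1_sig z) * g z)%C.
Proof.
  intros Ha.
  set (c := fun n => match n with O => (- a)%C | S n => ((1 - a * a) * RtoC a ^ n)%C end).
  assert (L : l1_le c (1 + Cmod (1 - a * a) * / (1 - Rabs a))).
  { assert (P : 0 <= Cmod (1 - a * a) * / (1 - Rabs a)).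
    { apply Rmult_le_pos; [apply Cmod_ge_0|]. left. apply Rinv_0_lt_compat. lra. }
    intros [|n].
    - rewrite sum_O. unfold c. rewrite Cmod_opp, Cmod_R. lra.
    - rewrite sum_n_shift_R. apply Rplus_le_compat.
      + unfold c. rewrite Cmod_opp, Cmod_R. lra.
      + unfold c. rewrite (sum_n_ext_R _ (fun k => Cmod (1 - a * a) * Rabs a ^ k))
          by (intros; rewrite Cmod_mult, Cmod_pow, Cmod_R; reflexivity).
        rewrite sum_n_Rmult_l. apply Rmult_le_compat_l; [apply Cmod_ge_0|].
        apply sum_n_le_series; [intros; apply pow_le, Rabs_pos|].
        apply is_series_geom. now rewrite Rabs_Rabsolu. }
  assert (T : is_taylor (fun z => blaschke a (proj1_sig z)) c).
  { apply is_taylor_iff. intros [z Hz]. simpl.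
    assert (N := one_minus_aw_neq_0 a z Ha Hz).
    apply (is_series_decr_1 (V := C_NormedModule)).
    apply is_series_ext with
      (fun n => scal (((1 - a * a) * z)%C : C_AbsRing) ((a * z) ^ n : C_NormedModule)%C).
    { intros n. rewrite Cpow_mult_l. unfold scal; simpl. unfold mult; simpl. as_C; ring. }
    replace (plus _ _) with (scal (((1 - a * a) * z)%C : C_AbsRing) ((/ (1 - a * z))%C : C_NormedModule)).
    2:{ unfold blaschke, plus, opp, scal; simpl. unfold mult; simpl. as_C; field. exact N. }
    apply (is_series_scal (V := C_NormedModule)), is_series_Cgeom, Cmod_aw_lt; assumption. }
  assert (M := is_taylor_mult _ g c _ _ L (taylor_coef_l2 g) T (taylor_coef_is_taylor g)).
  exists (mkH2 _ (ex_intro _ (conv c (taylor_coef g))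
    (conj (proj1 (conv_l2 _ _ _ L (taylor_coef_l2 g))) M))).
  reflexivity.
Qed.

Lemma lin_comb_eval n c (e : nat -> H2) (z : disk) :
  (lin_comb n c e : H2) z = sum_n_m (fun j => c j * e j z)%C 1 n.
Proof.
  induction n; [rewrite sum1_0_C, lin_comb_O; reflexivity|].
  rewrite lin_comb_S, sum1_S_C, <- IHn. reflexivity.
Qed.

(** Iterating [f = l(f) k_a + b_a D f] writes [f] as a combination of [m]
    fixed functions plus a finite Blaschke product times a function of no larger norm. *)
Lemma finite_division (a : nat -> R) (m : nat) : (forall i, Rabs (a i) < 1) ->
  exists (D : H2 -> H2) (e : nat -> H2) (l : nat -> H2 -> C),
    lin_map D /\ (forall f, H2_norm (D f) <= H2_norm f) /\
    (forall j, (forall f g, l j (plus f g) = (l j f + l j g)%C) /\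
       (forall (c : C_AbsRing) f, l j (scal c f) = (c * l j f)%C)) /\
    forall (f : H2) (z : disk), f z =
      (sum_n_m (fun j => l j f * e j z)%C 1 m + blaschke_prod a m (proj1_sig z) * D f z)%C.
Proof.
  intros Ha.
  assert (Mul : forall k (g : H2), exists h : H2, forall z : disk,
    h z = (blaschke_prod a k (proj1_sig z) * g z)%C).
  { induction k; intros g.
    - exists g. intros z. simpl. ring.
    - destruct (blaschke_mult_H2 (a (S k)) g (Ha _)) as [g' Hg].
      destruct (IHk g') as [h Hh]. exists h. intros z. rewrite Hh, Hg. simpl. ring. }
  induction m.
  - exists (fun f => f), (fun _ => zero), (fun _ _ => RtoC 0).
    split; [split; reflexivity|]. split; [intros; lra|]. split; [intros; split; intros; ring|].
    intros f z. rewrite sum1_0_C. simpl. ring.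
  - destruct IHm as [D [e [l [[L1 L2] [N [Ll E]]]]]].
    set (b := a (S m)). assert (Hb : -1 < b < 1) by (destruct (Rabs_def2 _ _ (Ha (S m))); split; assumption).
    destruct (blaschke_adjoint b Hb) as [D' [l' [[M1 M2] [[K1 K2] [N' [_ E']]]]]].
    destruct (kernel_in_H2 b (Ha (S m))) as [k Hk].
    destruct (Mul m (H2_scal (1 - b ^ 2)%C k)) as [h Hh].
    exists (fun f => D' (D f)), (fun j => if Nat.eq_dec j (S m) then h else e j),
      (fun j f => if Nat.eq_dec j (S m) then l' (D f) else l j f).
    split; [|split; [|split]].
    + split; [intros f g; now rewrite L1, M1|intros c f; now rewrite L2, M2].
    + intros f. eapply Rle_trans; [apply N'|apply N].
    + intros j. destruct (Nat.eq_dec j (S m)); [|apply Ll].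
      split; [intros f g; now rewrite L1, K1|intros c f; now rewrite L2, K2].
    + intros f z. rewrite sum1_S_C. destruct (Nat.eq_dec (S m) (S m)) as [_|]; [|lia].
      rewrite (sum1_ext_C _ (fun j => l j f * e j z)%C).
      2:{ intros j Hj. destruct (Nat.eq_dec j (S m)); [lia|reflexivity]. }
      rewrite (E f z) at 1. rewrite Hh. simpl. rewrite Hk. fold b.
      assert (Nz := one_minus_aw_neq_0 b _ (Ha (S m)) (proj2_sig z)).
      specialize (E' (D f) z).
      assert (Ed : D f z = ((1 - b ^ 2) * l' (D f) / (1 - b * proj1_sig z) +
        blaschke b (proj1_sig z) * D' (D f) z)%C).
      { unfold blaschke. transitivity ((1 - b * proj1_sig z) * D f z / (1 - b * proj1_sig z))%C;
          [field; exact Nz|]. rewrite E'. field. exact Nz. }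
      rewrite Ed. simpl. field. exact Nz.
Qed.

(** Composing the finite division with [phi] leaves the error
    [S f - R f = (B o phi) (D f o phi)], where [R] has rank at most [N] and [D] is a
    contraction. *)
Lemma approx_number_le_blaschke (phi : disk -> disk) (S : H2 -> H2) (n N : nat)
  (a : nat -> R) (d : R) :
  is_composition_operator phi S -> (forall i, Rabs (a i) < 1) -> (N < n)%nat -> 0 <= d ->
  (forall F g : H2, (forall z : disk, F z =
      (blaschke_prod a N (proj1_sig (phi z)) * g (phi z))%C) -> H2_norm F <= d * H2_norm g) ->
  approx_number S n <= d.
Proof.
  intros [LS HS] Ha HN Hd HB.
  destruct (finite_division a N Ha) as [D [e [l [LD [ND [Ll E]]]]]].
  apply (approx_number_le S (fun f => lin_comb N (fun j => l j f) (fun j => S (e j)))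
    n N (fun j => S (e j)) d LS).
  - split.
    + intros f g. rewrite (lin_comb_ext N _ (fun j => l j f + l j g)%C _ (fun j => S (e j)))
        by (intros j _; split; [apply (Ll j)|reflexivity]).
      exact (lin_comb_plus N (fun j => l j f) (fun j => l j g) (fun j => S (e j))).
    + intros c f. rewrite (lin_comb_ext N _ (fun j => c * l j f)%C _ (fun j => S (e j)))
        by (intros j _; split; [apply (Ll j)|reflexivity]).
      exact (lin_comb_scal N c (fun j => l j f) (fun j => S (e j))).
  - exact HN.
  - intros f. now exists (fun j => l j f).
  - exact Hd.
  - intros f. apply Rle_trans with (d * H2_norm (D f)).
    + apply (HB _ (D f)). intros z.
      change ((S f z + (-1) * (lin_comb N (fun j => l j f) (fun j => S (e j)) : H2) z)%C
        = (blaschke_prod a N (proj1_sig (phi z)) * D f (phi z))%C).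
      rewrite lin_comb_eval, HS, (E f (phi z)).
      rewrite (sum1_ext_C (fun j => l j f * S (e j) z)%C (fun j => l j f * e j (phi z))%C)
        by (intros; now rewrite HS).
      ring.
    + apply Rmult_le_compat_l; [exact Hd|apply ND].
Qed.

(** * Pointwise domination implies domination of the norms *)

Definition cis (t : R) : C := (cos t, sin t).

Lemma cis_plus s t : (cis s * cis t)%C = cis (s + t).
Proof.
  unfold cis. rewrite cos_plus, sin_plus. apply injective_projections; simpl; ring.
Qed.

Lemma cis_pow t n : (cis t ^ n)%C = cis (INR n * t).
Proof.
  induction n; [simpl; unfold cis; rewrite Rmult_0_l, cos_0, sin_0; reflexivity|].
  rewrite Cpow_S, IHn, cis_plus, S_INR. f_equal. ring.
Qed.

Lemma Cmod_cis t : Cmod (cis t) = 1.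
Proof.
  unfold cis, Cmod. simpl fst; simpl snd. assert (h := sin2_cos2 t). unfold Rsqr in h.
  replace (cos t ^ 2 + sin t ^ 2) with 1 by (simpl; lra). apply sqrt_1.
Qed.

Lemma cis_neq_1 t : 0 < t < 2 * PI -> cis t <> 1.
Proof.
  intros Ht E. apply (f_equal fst) in E. simpl in E.
  replace t with (2 * (t / 2)) in E by field. rewrite cos_2a_sin in E.
  assert (0 < sin (t / 2)) by (apply sin_gt_0; lra). nra.
Qed.

Lemma cis_2PI n : cis (2 * PI * INR n) = 1.
Proof.
  unfold cis. assert (C1 := cos_period 0 n). assert (S1 := sin_period 0 n).
  rewrite cos_0 in C1. rewrite sin_0 in S1.
  replace (2 * PI * INR n) with (0 + 2 * INR n * PI) by ring. now rewrite C1, S1.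
Qed.

Lemma geometric_sum_C (x : C) n : ((x - 1) * sum_n (fun k => x ^ k) n = x ^ S n - 1)%C.
Proof.
  induction n; [rewrite sum_O; simpl; as_C; ring|].
  rewrite sum_n_S_C. transitivity ((x - 1) * sum_n (fun k => x ^ k) n + (x - 1) * x ^ S n)%C;
    [as_C; ring|]. rewrite IHn. simpl Cpow. as_C; ring.
Qed.

Definition node (r : R) (M k : nat) : C := (r * cis (2 * PI * INR k / (INR M + 1)))%C.

Lemma Cmod_node r M k : 0 <= r -> Cmod (node r M k) = r.
Proof.
  intros Hr. unfold node. rewrite Cmod_mult, Cmod_cis, Cmod_R, Rmult_1_r. now apply Rabs_pos_eq.
Qed.

Lemma roots_sum_zero M d : (1 <= d <= M)%nat ->
  sum_n (fun k => cis (2 * PI * INR k / (INR M + 1)) ^ d)%C M = RtoC 0.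
Proof.
  intros Hd. assert (M0 := pos_INR M).
  set (x := cis (2 * PI * INR d / (INR M + 1))).
  rewrite (sum_n_ext_C _ (fun k => x ^ k)%C).
  2:{ intros k _. unfold x. rewrite !cis_pow. f_equal. field. lra. }
  assert (G := geometric_sum_C x M).
  assert (X : (x ^ S M)%C = 1).
  { unfold x. rewrite cis_pow, S_INR.
    replace ((INR M + 1) * (2 * PI * INR d / (INR M + 1))) with (2 * PI * INR d) by (field; lra).
    apply cis_2PI. }
  rewrite X in G.
  assert (N : x <> 1).
  { apply cis_neq_1. assert (1 <= INR d) by (apply (le_INR 1); lia).
    assert (INR d <= INR M) by (apply le_INR; lia). assert (P := PI_RGT_0). split.
    - apply Rdiv_lt_0_compat; [|lra]. apply Rmult_lt_0_compat; lra.
    - apply (Rmult_lt_reg_r (INR M + 1)); [lra|]. unfold Rdiv.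
      rewrite Rmult_assoc, Rinv_l, Rmult_1_r by lra. apply Rmult_lt_compat_l; lra. }
  assert (N' : (x - 1)%C <> 0).
  { intros h. apply N. transitivity ((x - 1) + 1)%C; [ring|]. rewrite h. ring. }
  assert (Id : forall s : C, s = (/ (x - 1) * ((x - 1) * s))%C) by (intros s; field; exact N').
  rewrite (Id (sum_n (fun k => x ^ k)%C M)), G. as_C; field. exact N'.
Qed.

Lemma Cconj_sum_n (a : nat -> C) n : Cconj (sum_n a n) = sum_n (fun k => Cconj (a k)) n.
Proof. induction n; [now rewrite !sum_O|]. rewrite !sum_n_S_C, Cplus_conj, IHn. reflexivity. Qed.

Lemma node_orthogonal r M j m : (j < m <= M)%nat ->
  sum_n (fun k => node r M k ^ j * Cconj (node r M k ^ m))%C M = RtoC 0.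
Proof.
  intros H.
  rewrite (sum_n_ext_C _ (fun k => (r ^ j * r ^ m) *
    Cconj (cis (2 * PI * INR k / (INR M + 1)) ^ (m - j)))%C).
  - rewrite sum_n_Cmult_l, <- Cconj_sum_n, roots_sum_zero by lia.
    rewrite Cconj_RtoC. as_C; ring.
  - intros k _. unfold node. set (w := cis _).
    assert (U : (w * Cconj w)%C = 1).
    { rewrite <- Cmod2_conj. unfold w. rewrite Cmod_cis, pow1. reflexivity. }
    rewrite !Cpow_mult_l, Cmult_conj, !Cpow_conj, Cconj_RtoC.
    replace m with (j + (m - j))%nat at 2 by lia. rewrite Cpow_add_r.
    transitivity (r ^ j * r ^ m * Cconj w ^ (m - j) * (w * Cconj w) ^ j)%C.
    + rewrite Cpow_mult_l. ring.
    + rewrite U, Cpow_1_l. ring.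
Qed.

Definition partial_eval (p : nat -> C) (n : nat) (z : C) : C :=
  sum_n (fun j => p j * z ^ j)%C n.

Lemma Cmod_plus_sq (x y : C) :
  Cmod (x + y) ^ 2 = Cmod x ^ 2 + Cmod y ^ 2 + 2 * fst (x * Cconj y)%C.
Proof. rewrite !Cmod2_alt. destruct x, y. unfold Re, Im. simpl. ring. Qed.

(** Up to the factor [r], the nodes are the roots of unity of order [M + 1], so two
    monomials of different degrees are orthogonal on them as long as the degrees do
    not exceed [M]. *)
Lemma discrete_parseval (p : nat -> C) r M n : 0 <= r -> (n <= M)%nat ->
  sum_n (fun k => Cmod (partial_eval p n (node r M k)) ^ 2) M =
  (INR M + 1) * sum_n (fun j => Cmod (p j) ^ 2 * r ^ (2 * j)) n.
Proof.
  intros Hr. unfold partial_eval.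
  assert (Cst : forall c, sum_n (fun _ => c) M = (INR M + 1) * c)
    by (intros c; rewrite sum_n_const, S_INR; reflexivity).
  assert (T : forall j k, Cmod (p j * node r M k ^ j) ^ 2 = Cmod (p j) ^ 2 * r ^ (2 * j)).
  { intros j k. rewrite Cmod_mult, Cmod_pow, Cmod_node, Rpow_mult_distr, <- pow_mult by exact Hr.
    do 2 f_equal. lia. }
  induction n; intros Hn.
  - rewrite sum_O, <- Cst. apply sum_n_ext_R. intros k _. rewrite sum_O. apply T.
  - rewrite sum_n_S_R, Rmult_plus_distr_l, <- IHn, <- (Cst (Cmod (p (S n)) ^ 2 * _)) by lia.
    rewrite <- sum_n_Rplus.
    assert (X : sum_n (fun k => sum_n (fun j => p j * node r M k ^ j) n *
        Cconj (p (S n) * node r M k ^ S n))%C M = RtoC 0).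
    { assert (X' : forall i, (i <= n)%nat ->
        sum_n (fun k => sum_n (fun j => p j * node r M k ^ j) i *
          Cconj (p (S n) * node r M k ^ S n))%C M = RtoC 0); [|now apply X'].
      assert (O1 : forall i, (i <= n)%nat -> sum_n (fun k => (p i * node r M k ^ i) *
          Cconj (p (S n) * node r M k ^ S n))%C M = RtoC 0).
      { intros i Hi. rewrite (sum_n_ext_C _ (fun k => (p i * Cconj (p (S n))) *
          (node r M k ^ i * Cconj (node r M k ^ S n)))%C)
          by (intros; rewrite Cmult_conj; as_C; ring).
        rewrite sum_n_Cmult_l, node_orthogonal by lia. as_C; ring. }
      induction i; intros Hi.
      - rewrite <- (O1 0%nat) by lia. apply sum_n_ext_C. intros k _. now rewrite sum_O.
      - rewrite (sum_n_ext_C _ (fun k => sum_n (fun j => p j * node r M k ^ j) i *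
            Cconj (p (S n) * node r M k ^ S n) +
          (p (S i) * node r M k ^ S i) * Cconj (p (S n) * node r M k ^ S n))%C).
        + rewrite sum_n_Cplus, IHi, O1 by lia. as_C; ring.
        + intros k _. rewrite sum_n_S_C. as_C; ring. }
    apply (f_equal fst) in X. rewrite sum_n_fst in X. change (fst (RtoC 0)) with 0 in X.
    rewrite (sum_n_ext_R _ (fun k => (Cmod (sum_n (fun j => p j * node r M k ^ j)%C n) ^ 2 +
       Cmod (p (S n)) ^ 2 * r ^ (2 * S n)) + 2 * fst (sum_n (fun j => p j * node r M k ^ j) n *
        Cconj (p (S n) * node r M k ^ S n))%C)).
    + rewrite sum_n_Rplus, sum_n_Rmult_l. rewrite X. as_R; ring.
    + intros k _. rewrite sum_n_S_C, Cmod_plus_sq, T. reflexivity.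
Qed.

Lemma taylor_tail (f : H2) (z : disk) n :
  Cmod (f z - partial_eval (taylor_coef f) n (proj1_sig z)) <=
  H2_norm f / (1 - Cmod (proj1_sig z)) * Cmod (proj1_sig z) ^ S n.
Proof.
  destruct z as [z Hz]. simpl proj1_sig. assert (Z0 := Cmod_ge_0 z).
  assert (H := H2_series f (exist _ z Hz)). simpl proj1_sig in H.
  assert (T : is_series (fun k => taylor_coef f (S n + k)%nat * z ^ (S n + k))%C
    (f (exist _ z Hz) - partial_eval (taylor_coef f) n z)%C).
  { apply (is_series_incr_n (V := C_NormedModule) (fun k => taylor_coef f k * z ^ k)%C); [lia|].
    eapply eq_ind; [exact H|].
    assert (Id : forall F P : C, F = (F - P + P)%C) by (intros; ring). apply Id. }
  apply (is_series_Cmod_le _ _ _ T). intros m.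
  apply Rle_trans with (sum_n (fun k => H2_norm f * Cmod z ^ S n * Cmod z ^ k) m).
  - apply sum_n_le_loc. intros k _. rewrite Cmod_mult, Cmod_pow, pow_add.
    rewrite Rmult_assoc. apply Rmult_le_compat_r.
    + apply Rmult_le_pos; now apply pow_le.
    + rewrite H2_norm_nsq. apply Cmod_le_nsq, taylor_coef_l2.
  - rewrite sum_n_Rmult_l.
    replace (H2_norm f / (1 - Cmod z) * Cmod z ^ S n)
      with (H2_norm f * Cmod z ^ S n * / (1 - Cmod z)) by (unfold Rdiv; ring).
    apply Rmult_le_compat_l.
    + apply Rmult_le_pos; [apply H2_norm_pos|now apply pow_le].
    + apply sum_n_le_series; [intros; now apply pow_le|].
      apply is_series_geom. now rewrite Rabs_pos_eq.
Qed.

Lemma le_of_exp_factor (X Y a : R) : 0 <= Y ->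
  (forall e, 0 < e -> X <= exp (a * e) * Y) -> X <= Y.
Proof.
  intros HY H.
  assert (L : is_lim_seq (fun n => exp (a * / (INR n + 1)) * Y) Y).
  { replace (Finite Y) with (Rbar_mult (exp (a * 0)) Y)
      by (simpl; f_equal; rewrite Rmult_0_r, exp_0; ring).
    apply (is_lim_seq_scal_r (fun n => exp (a * / (INR n + 1))) Y (exp (a * 0))).
    apply (is_lim_seq_continuous exp).
    - apply derivable_continuous_pt, derivable_pt_exp.
    - apply (is_lim_seq_scal_l _ a 0).
      apply (is_lim_seq_ext (fun n => / INR (S n))); [intros; now rewrite S_INR|].
      apply (is_lim_seq_incr_1 (fun n => / INR n)).
      apply (is_lim_seq_inv _ p_infty); [apply is_lim_seq_INR|discriminate]. }
  apply (is_lim_seq_le (fun _ => X) (fun n => exp (a * / (INR n + 1)) * Y) X Y);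
    [|apply is_lim_seq_const|exact L].
  intros n. apply H. apply Rinv_0_lt_compat. assert (h := pos_INR n). lra.
Qed.

(** Average the pointwise inequality over equidistant points of a circle. The truncation
    errors of the Taylor series disappear as the number of points grows, then the
    radius tends to one. *)
Lemma domination (F G H : H2) (K : R) : 0 <= K ->
  (forall z, Cmod (F z) ^ 2 <= K * (Cmod (G z) ^ 2 + Cmod (H z) ^ 2)) ->
  H2_norm F ^ 2 <= K * (H2_norm G ^ 2 + H2_norm H ^ 2).
Proof.
  intros HK Dom. set (Y := K * (H2_norm G ^ 2 + H2_norm H ^ 2)).
  assert (Y0 : 0 <= Y).
  { apply Rmult_le_pos; [exact HK|]. apply Rplus_le_le_0_compat; apply pow2_ge_0. }
  rewrite H2_norm_sq. apply nsq_bounded. intros n.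
  apply (le_of_exp_factor _ _ (2 + 2 * INR n) Y0). intros e He.
  set (r := exp (- e)). assert (r0 : 0 < r) by apply exp_pos.
  assert (r1 : r < 1) by (unfold r; rewrite <- exp_0; apply exp_increasing; lra).
  set (t := exp e - 1). assert (t0 : 0 < t).
  { unfold t. assert (1 + e <= exp e) by apply exp_ineq1_le. lra. }
  set (tail := fun (f : H2) M => (H2_norm f / (1 - r) * r ^ S M) ^ 2).
  assert (Near : forall (f : H2) M z, Cmod (proj1_sig z) = r ->
    Cmod (partial_eval (taylor_coef f) M (proj1_sig z)) ^ 2
      <= (1 + t) * Cmod (f z) ^ 2 + (1 + / t) * tail f M /\
    Cmod (f z) ^ 2 <= (1 + t) * Cmod (partial_eval (taylor_coef f) M (proj1_sig z)) ^ 2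
      + (1 + / t) * tail f M).
  { intros f M z Hz. assert (B := taylor_tail f z M). rewrite Hz in B.
    set (P := partial_eval (taylor_coef f) M (proj1_sig z)) in *.
    assert (B2 : Cmod (f z - P) ^ 2 <= tail f M)
      by (apply pow_incr; split; [apply Cmod_ge_0|exact B]).
    assert (it : 0 < / t) by now apply Rinv_0_lt_compat.
    assert (B3 : (1 + / t) * Cmod (f z - P) ^ 2 <= (1 + / t) * tail f M)
      by (apply Rmult_le_compat_l; lra).
    split.
    - replace P with (f z + - (f z - P))%C at 1 by ring.
      eapply Rle_trans; [apply (Cmod_add_sq t); exact t0|]. rewrite Cmod_opp. lra.
    - replace (f z) with (P + (f z - P))%C at 1 by ring.
      eapply Rle_trans; [apply (Cmod_add_sq t); exact t0|]. lra. }
  assert (Par : forall (f : H2) M,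
    sum_n (fun j => Cmod (taylor_coef f j) ^ 2 * r ^ (2 * j)) M <= H2_norm f ^ 2).
  { intros f M. rewrite H2_norm_sq.
    eapply Rle_trans; [|apply (sum_n_le_nsq _ M), taylor_coef_l2].
    apply sum_n_le_loc. intros j _. rewrite <- (Rmult_1_r (Cmod (taylor_coef f j) ^ 2)) at 2.
    apply Rmult_le_compat_l; [apply pow2_ge_0|].
    rewrite <- (pow1 (2 * j)). apply pow_incr. lra. }
  set (err := fun M => (1 + / t) * tail F M +
    (1 + t) * K * (1 + / t) * (tail G M + tail H M)).
  assert (Main : forall M,
    sum_n (fun j => Cmod (taylor_coef F j) ^ 2 * r ^ (2 * j)) M <= (1 + t) ^ 2 * Y + err M).
  { intros M. assert (M0 := pos_INR M).
    apply (Rmult_le_reg_l (INR M + 1)); [lra|].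
    rewrite <- discrete_parseval by (lra || lia).
    apply Rle_trans with (sum_n (fun k => (1 + t) ^ 2 * K *
      (Cmod (partial_eval (taylor_coef G) M (node r M k)) ^ 2 +
       Cmod (partial_eval (taylor_coef H) M (node r M k)) ^ 2) + err M) M).
    - apply sum_n_le_loc. intros k _.
      assert (Hn : Cmod (node r M k) < 1) by (rewrite Cmod_node; lra).
      set (z := exist (fun z => Cmod z < 1) (node r M k) Hn : disk).
      assert (Hz : Cmod (proj1_sig z) = r) by (apply Cmod_node; lra).
      destruct (Near F M z Hz) as [NF _]. destruct (Near G M z Hz) as [_ NG].
      destruct (Near H M z Hz) as [_ NH]. specialize (Dom z).
      change (proj1_sig z) with (node r M k) in *.
      eapply Rle_trans; [exact NF|].
      set (g := Cmod (G z) ^ 2) in *. set (h := Cmod (H z) ^ 2) in *.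
      set (pg := Cmod (partial_eval (taylor_coef G) M (node r M k)) ^ 2) in *.
      set (ph := Cmod (partial_eval (taylor_coef H) M (node r M k)) ^ 2) in *.
      unfold err.
      apply Rle_trans with ((1 + t) * (K * (((1 + t) * pg + (1 + / t) * tail G M) +
         ((1 + t) * ph + (1 + / t) * tail H M))) + (1 + / t) * tail F M); [|right; ring].
      apply Rplus_le_compat_r, Rmult_le_compat_l; [lra|].
      eapply Rle_trans; [exact Dom|]. apply Rmult_le_compat_l; lra.
    - rewrite sum_n_Rplus, sum_n_Rmult_l, sum_n_Rplus, !discrete_parseval by (lra || lia).
      rewrite sum_n_const, S_INR. unfold Y.
      assert (PG := Par G M). assert (PH := Par H M).
      set (SG := sum_n (fun j => Cmod (taylor_coef G j) ^ 2 * r ^ (2 * j)) M) in *.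
      set (SH := sum_n (fun j => Cmod (taylor_coef H j) ^ 2 * r ^ (2 * j)) M) in *.
      assert (Q : (1 + t) ^ 2 * K * (SG + SH) <= (1 + t) ^ 2 * K * (H2_norm G ^ 2 + H2_norm H ^ 2)).
      { apply Rmult_le_compat_l; [apply Rmult_le_pos; [apply pow2_ge_0|exact HK]|lra]. }
      assert (Q' := Rmult_le_compat_l (INR M + 1) _ _ ltac:(lra) Q). lra. }
  assert (Err : is_lim_seq (fun M => (1 + t) ^ 2 * Y + err M) ((1 + t) ^ 2 * Y)).
  { assert (Tl : forall f, is_lim_seq (tail f) 0).
    { intros f. unfold tail.
      apply (is_lim_seq_ext (fun M => (H2_norm f / (1 - r) * r) ^ 2 * (r ^ 2) ^ M)).
      { intros M. rewrite <- pow_mult, Nat.mul_comm, pow_mult, <- (tech_pow_Rmult r M). ring. }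
      replace (Finite 0) with (Rbar_mult ((H2_norm f / (1 - r) * r) ^ 2) 0)
        by (simpl; f_equal; ring).
      apply is_lim_seq_scal_l, is_lim_seq_geom. rewrite Rabs_pos_eq by apply pow2_ge_0. nra. }
    replace (Finite ((1 + t) ^ 2 * Y)) with
      (Finite ((1 + t) ^ 2 * Y + ((1 + / t) * 0 + (1 + t) * K * (1 + / t) * (0 + 0))))
      by (f_equal; ring).
    apply is_lim_seq_plus'; [apply is_lim_seq_const|]. unfold err.
    apply is_lim_seq_plus'; apply (is_lim_seq_scal_l _ _ (Finite _)); [apply Tl|].
    apply is_lim_seq_plus'; apply Tl. }
  assert (Fin : sum_n (fun j => Cmod (taylor_coef F j) ^ 2 * r ^ (2 * j)) n <= (1 + t) ^ 2 * Y).
  { apply (is_lim_seq_le_loc (fun _ => sum_n (fun j => Cmod (taylor_coef F j) ^ 2 * r ^ (2 * j)) n)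
      _ (sum_n (fun j => Cmod (taylor_coef F j) ^ 2 * r ^ (2 * j)) n) _) with (3 := Err);
      [|apply is_lim_seq_const].
    exists n. intros M HM. eapply Rle_trans; [|apply Main].
    induction HM; [lra|]. eapply Rle_trans; [exact IHHM|]. rewrite sum_n_S_R.
    assert (0 <= Cmod (taylor_coef F (S m)) ^ 2 * r ^ (2 * S m))
      by (apply Rmult_le_pos; [apply pow2_ge_0|apply pow_le; lra]). lra. }
  assert (Low : r ^ (2 * n) * sum_n (fun j => Cmod (taylor_coef F j) ^ 2) n <=
    sum_n (fun j => Cmod (taylor_coef F j) ^ 2 * r ^ (2 * j)) n).
  { rewrite <- sum_n_Rmult_l. apply sum_n_le_loc. intros j Hj. rewrite Rmult_comm.
    apply Rmult_le_compat_l; [apply pow2_ge_0|].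
    replace (2 * n)%nat with (2 * j + (2 * n - 2 * j))%nat by lia. rewrite pow_add.
    assert (0 < r ^ (2 * j)) by (apply pow_lt; lra).
    assert (r ^ (2 * n - 2 * j) <= 1).
    { rewrite <- (pow1 (2 * n - 2 * j)). apply pow_incr. lra. }
    nra. }
  assert (Er : r ^ (2 * n) * exp (2 * INR n * e) = 1).
  { unfold r. rewrite exp_neg_pow, <- exp_plus, <- exp_0. f_equal. rewrite mult_INR. simpl. ring. }
  assert (Et : (1 + t) ^ 2 = exp (2 * e)).
  { unfold t. replace (1 + (exp e - 1)) with (exp e) by ring. simpl.
    rewrite Rmult_1_r, <- exp_plus. f_equal. ring. }
  set (X := sum_n (fun j => Cmod (taylor_coef F j) ^ 2) n) in *.
  replace ((2 + 2 * INR n) * e) with (2 * INR n * e + 2 * e) by ring.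
  rewrite exp_plus, <- Et. assert (ep := exp_pos (2 * INR n * e)).
  apply Rle_trans with (exp (2 * INR n * e) * (r ^ (2 * n) * X)).
  - right. rewrite <- Rmult_assoc, (Rmult_comm (exp _)), Er. symmetry. apply Rmult_1_l.
  - replace (exp (2 * INR n * e) * (1 + t) ^ 2 * Y) with (exp (2 * INR n * e) * ((1 + t) ^ 2 * Y))
      by ring.
    apply Rmult_le_compat_l; [lra|]. exact (Rle_trans _ _ _ Low Fin).
Qed.

(** * Upper bound: Blaschke products with dyadic zeros *)

(** The coefficients [c_n] of [(1 - z) ^ (- s)] are of order [n ^ (s - 1)], and [s < 1 / 2]
    makes their squares summable. *)
Lemma binomial_coef_neg_square_summable (s : R) : 0 < s < 1 / 2 ->
  square_summable (fun n => RtoC (binomial_coef (- s) n)).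
Proof.
  intros Hs.
  assert (P : forall n, 0 <= binomial_coef (- s) n) by (intros; apply binomial_coef_nonneg; lra).
  (* (1 - 2 s) c_n^2 is at most the decrease of n c_n^2 plus (1 - s) times the decrease of c_n *)
  assert (T : forall n, (1 - 2 * s) * sum_n (fun k => binomial_coef (- s) k ^ 2) n <=
     (1 - s) * (1 - binomial_coef (- s) (S n)) - (INR n + 1) * binomial_coef (- s) (S n) ^ 2).
  { assert (St : forall n, (1 - 2 * s) * binomial_coef (- s) n ^ 2 <=
      INR n * binomial_coef (- s) n ^ 2 - (INR n + 1) * binomial_coef (- s) (S n) ^ 2 +
      (1 - s) * (binomial_coef (- s) n - binomial_coef (- s) (S n))).
    { intros n. assert (n0 := pos_INR n). assert (c0 := P n).
      assert (c1 : binomial_coef (- s) n <= 1).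
      { eapply Rle_trans; [apply Rle_abs|apply binomial_coef_le_1; lra]. }
      simpl binomial_coef. set (c := binomial_coef (- s) n) in *. set (N := INR n) in *.
      assert (E : N * c ^ 2 - (N + 1) * (c * ((N - - s) / (N + 1))) ^ 2 +
        (1 - s) * (c - c * ((N - - s) / (N + 1))) - (1 - 2 * s) * c ^ 2 =
        (1 - s) ^ 2 / (N + 1) * (c * (1 - c))) by (field; lra).
      assert (0 <= (1 - s) ^ 2 / (N + 1) * (c * (1 - c))).
      { apply Rmult_le_pos; [|apply Rmult_le_pos; lra].
        apply Rdiv_le_0_compat; [apply pow2_ge_0|lra]. }
      lra. }
    induction n.
    - rewrite sum_O. specialize (St 0%nat). simpl INR in *. simpl (binomial_coef (- s) 0) in *. lra.
    - rewrite sum_n_S_R, Rmult_plus_distr_l. specialize (St (S n)). rewrite S_INR in *. lra. }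
  apply (nsq_bounded _ ((1 - s) / (1 - 2 * s))). intros n.
  rewrite (sum_n_ext_R _ (fun k => binomial_coef (- s) k ^ 2))
    by (intros; now rewrite Cmod_R, pow2_abs).
  apply (Rmult_le_reg_l (1 - 2 * s)); [lra|].
  replace ((1 - 2 * s) * ((1 - s) / (1 - 2 * s))) with (1 - s) by (field; lra).
  eapply Rle_trans; [apply T|].
  assert (0 <= (INR n + 1) * binomial_coef (- s) (S n) ^ 2).
  { apply Rmult_le_pos; [assert (h := pos_INR n); lra|apply pow2_ge_0]. }
  specialize (P (S n)). nra.
Qed.

Lemma binomial_in_H2 (s : R) : 0 < s < 1 / 2 ->
  exists G H : H2,
    (forall z : disk, Cmod (G z) = Rpower (Cmod (1 - proj1_sig z)) (- s)) /\
    (forall z : disk, Cmod (H z) = Rpower (Cmod (1 + proj1_sig z)) (- s)).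
Proof.
  intros Hs. assert (Sq := binomial_coef_neg_square_summable s Hs).
  assert (Sq' : square_summable (fun n => RtoC (if Nat.odd n then - binomial_coef (- s) n else binomial_coef (- s) n))).
  { unfold square_summable in *. eapply ex_series_ext; [|exact Sq]. intros n. simpl.
    destruct (Nat.odd n); rewrite !Cmod_R, ?Rabs_Ropp; reflexivity. }
  exists (H2_of _ Sq), (H2_of _ Sq'). split; intros z; rewrite <- Cmod_half_plane_power; f_equal;
    apply (is_series_C_unique _ _ _ (H2_series _ _)); rewrite taylor_coef_H2_of.
  - apply binomial_series; [lra|exact (proj2_sig z)].
  - assert (B := binomial_series (- s) (- proj1_sig z) ltac:(lra)
      ltac:(rewrite Cmod_opp; exact (proj2_sig z))).
    replace (1 + proj1_sig z)%C with (1 - - proj1_sig z)%C by ring.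
    eapply is_series_ext; [|exact B]. intros n. simpl. rewrite Cpow_opp.
    destruct (Nat.odd n); rewrite ?RtoC_opp; as_C; ring.
Qed.

Lemma cayley_Cmod_sq (x y : R) : 0 < x ->
  Cmod (cayley (x, y)) ^ 2 = 1 - 4 * x / ((1 + x) ^ 2 + y ^ 2).
Proof.
  intros Hx. assert (D : 0 < (1 + x) ^ 2 + y ^ 2) by nra.
  rewrite Cmod2_alt.
  unfold cayley, Cdiv, Cinv, Cmult, Cminus, Cplus, Copp, RtoC, Re, Im; simpl. field. nra.
Qed.

Lemma blaschke_cayley (s : R) (p : C) : 0 < s -> 0 < Re p ->
  blaschke ((1 - s) / (1 + s)) (cayley p) = ((s - p) / (s + p))%C.
Proof.
  intros Hs Hp. unfold blaschke, cayley.
  assert (N1 : (1 + p)%C <> 0) by (apply Re_pos_neq_0; simpl; unfold Re in Hp; lra).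
  assert (N2 : (s + p)%C <> 0) by (apply Re_pos_neq_0; simpl; unfold Re in Hp; lra).
  assert (N3 : (1 + s)%C <> 0) by (apply Re_pos_neq_0; simpl; lra).
  rewrite RtoC_div, RtoC_minus, RtoC_plus by lra.
  assert (N4 : ((1 + s) * (1 + p) - (1 - s) * (1 - p))%C <> 0).
  { replace ((1 + s) * (1 + p) - (1 - s) * (1 - p))%C with (2 * (s + p))%C by ring.
    apply Cmult_neq_0; [|exact N2]. intros h. injection h. lra. }
  field. repeat split; assumption.
Qed.

(** [|s + p|^2 - |s - p|^2 = 4 s Re p], which in a sector [k |p| <= Re p] is comparable to
    [|s + p|^2] as soon as [|p|] is comparable to [s]. *)
Lemma blaschke_sector (s k : R) (p : C) : 0 < s -> 0 < k <= 1 -> 0 < Cmod p ->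
  k * Cmod p <= Re p ->
  Cmod (blaschke ((1 - s) / (1 + s)) (cayley p)) <= 1 /\
  (s <= Cmod p <= 2 * s ->
   Cmod (blaschke ((1 - s) / (1 + s)) (cayley p)) ^ 2 <= 1 - k / 2).
Proof.
  intros Hs Hk Hp HX.
  assert (X0 : 0 < Re p) by nra.
  rewrite blaschke_cayley by assumption.
  assert (M := Cmod2_alt p).
  destruct p as [X Y]. unfold Re, Im in *. simpl in X0, HX, M.
  set (r := Cmod (X, Y)) in *.
  assert (N2 : (s + (X, Y))%C <> 0) by (apply Re_pos_neq_0; simpl; lra).
  assert (A : Cmod (s - (X, Y)) ^ 2 = s ^ 2 + r ^ 2 - 2 * s * X).
  { rewrite Cmod2_alt. unfold Re, Im. simpl. simpl in M. lra. }
  assert (B : Cmod (s + (X, Y)) ^ 2 = s ^ 2 + r ^ 2 + 2 * s * X).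
  { rewrite Cmod2_alt. unfold Re, Im. simpl. simpl in M. lra. }
  assert (B0 : 0 < Cmod (s + (X, Y))) by now apply Cmod_gt_0.
  assert (A0 := Cmod_ge_0 (s - (X, Y))).
  rewrite Cmod_div by exact N2.
  set (a := Cmod (s - (X, Y))) in *. set (b := Cmod (s + (X, Y))) in *.
  split.
  - apply (Rmult_le_reg_r b); [exact B0|]. unfold Rdiv.
    rewrite Rmult_assoc, Rinv_l, Rmult_1_r, Rmult_1_l by lra.
    apply Rsqr_incr_0_var; [|lra]. unfold Rsqr. nra.
  - intros Hr. unfold Rdiv at 1. rewrite Rpow_mult_distr, pow_inv.
    apply (Rmult_le_reg_r (b ^ 2)); [now apply pow_lt|].
    rewrite Rmult_assoc, Rinv_l, Rmult_1_r by (apply pow_nonzero; lra).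
    rewrite A, B.
    assert (S1 : s ^ 2 + r ^ 2 <= 3 * (s * r)) by nra.
    assert (S2 : s * (k * r) <= s * X) by (apply Rmult_le_compat_l; lra).
    assert (S3 : k * (s ^ 2 + r ^ 2) <= k * (3 * (s * r))) by (apply Rmult_le_compat_l; lra).
    assert (sX : 0 <= s * X) by nra.
    assert (S4 : k * (s * X) <= s * X) by nra.
    nra.
Qed.

Lemma blaschke_prod_le (a : nat -> R) (w : C) (d : R) (J i0 : nat) (m : nat) :
  0 < d <= 1 ->
  (forall i, Cmod (blaschke (a i) w) <= 1) ->
  (forall i, (i0 <= i < i0 + J)%nat -> Cmod (blaschke (a (S i)) w) <= d) ->
  Cmod (blaschke_prod a m w) <= d ^ (Nat.min (m - i0) J).
Proof.
  intros Hd H1 H2. induction m.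
  - simpl. rewrite Cmod_1. lra.
  - cbn [blaschke_prod]. rewrite Cmod_mult.
    assert (A0 := Cmod_ge_0 (blaschke_prod a m w)).
    assert (B0 := Cmod_ge_0 (blaschke (a (S m)) w)).
    destruct (le_lt_dec i0 m) as [h|h]; [destruct (le_lt_dec (i0 + J) m) as [h'|h']|].
    + replace (Nat.min (S m - i0) J) with (Nat.min (m - i0) J) by lia.
      specialize (H1 (S m)). nra.
    + replace (Nat.min (S m - i0) J) with (S (Nat.min (m - i0) J)) by lia.
      specialize (H2 m ltac:(lia)). simpl. rewrite Rmult_comm.
      apply Rmult_le_compat; assumption.
    + replace (Nat.min (S m - i0) J) with (Nat.min (m - i0) J) by lia.
      specialize (H1 (S m)). nra.
Qed.

Lemma real_in_unit_interval (M : nat) (y : R) : (1 <= M)%nat -> 0 <= y <= INR M ->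
  exists d : nat, (d < M)%nat /\ INR d <= y <= INR d + 1.
Proof.
  induction M; intros HM Hy; [lia|].
  destruct (Rle_dec (INR M) y) as [h|h].
  - exists M. rewrite S_INR in Hy. split; [lia|lra].
  - destruct M as [|M]; [simpl in h; lra|].
    destruct IHM as [d [D1 D2]]; [lia|lra|]. exists d. split; [lia|exact D2].
Qed.

Lemma exp_abs_le (a x : R) : exp (a * Rabs x) <= exp (a * x) + exp (- (a * x)).
Proof.
  assert (p1 := exp_pos (a * x)). assert (p2 := exp_pos (- (a * x))).
  unfold Rabs. destruct (Rcase_abs x); [rewrite Ropp_mult_distr_r_reverse|]; lra.
Qed.

Lemma exp_sum_abs_le (a x : R) : 0 <= a ->
  exp (a * x) + exp (- (a * x)) <= 2 * exp (a * Rabs x).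
Proof.
  intros Ha. assert (h := Rle_abs x). assert (h' := Rle_abs (- x)). rewrite Rabs_Ropp in h'.
  assert (exp (a * x) <= exp (a * Rabs x)) by (apply exp_le; nra).
  assert (exp (- (a * x)) <= exp (a * Rabs x)) by (apply exp_le; nra). lra.
Qed.

Lemma mul_ln_2_exp (j : R) : exp (ln 2 * (j + 1)) = 2 * exp (ln 2 * j).
Proof.
  rewrite Rmult_plus_distr_l, Rmult_1_r, exp_plus, exp_ln by lra. ring.
Qed.

(** The zeros [T (2 ^ j)], [- J <= j < J], each of multiplicity [J]. *)
Definition dyadic_zero (J i : nat) : R :=
  pt (ln 2 * (INR ((i - 1) / J) - INR J)).

(** With [rho = |p| = exp (theta x)]: inside [|theta x| <= J ln 2] one of the annuli gives the
    factor [d ^ J]; outside, [exp (theta |x|)] is a small multiple of the larger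
    [exp (eta |x|)]. *)
Lemma dyadic_product_bound (theta eta k : R) (J : nat) (p : C) (x d : R) :
  0 < theta -> theta < eta -> 0 < k <= 1 -> Cmod p = exp (theta * x) ->
  k * Cmod p <= Re p -> 0 < d <= 1 -> 1 - k / 2 <= d ^ 2 ->
  Cmod (blaschke_prod (dyadic_zero J) (J * (2 * J)) (cayley p)) ^ 2 *
    (Cmod p + / Cmod p) <=
  2 * (d ^ (2 * J) + exp (- ((eta - theta) / theta * ln 2 * INR J))) *
    (exp (eta * x) + exp (- (eta * x))).
Proof.
  intros Ht He Hk Hp HX Hd Hd2.
  assert (p0 : 0 < Cmod p) by (rewrite Hp; apply exp_pos).
  assert (l2 : 0 < ln 2) by (rewrite <- ln_1; apply ln_increasing; lra).
  set (B := Cmod (blaschke_prod (dyadic_zero J) (J * (2 * J)) (cayley p))).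
  assert (B0 : 0 <= B) by apply Cmod_ge_0.
  assert (Z1 : forall i, dyadic_zero J i =
    (1 - exp (ln 2 * (INR ((i - 1) / J) - INR J))) / (1 + exp (ln 2 * (INR ((i - 1) / J) - INR J))))
    by reflexivity.
  assert (One : forall i, Cmod (blaschke (dyadic_zero J i) (cayley p)) <= 1).
  { intros i. rewrite Z1. apply (blaschke_sector _ k p); try assumption. apply exp_pos. }
  assert (Sum : Cmod p + / Cmod p <= 2 * exp (theta * Rabs x)).
  { rewrite Hp, <- exp_Ropp. apply exp_sum_abs_le. lra. }
  assert (Up := exp_abs_le eta x).
  assert (x0 := Rabs_pos x).
  set (R0 := exp (- ((eta - theta) / theta * ln 2 * INR J))).
  assert (r0 : 0 < R0) by apply exp_pos.
  assert (dJ : 0 < d ^ (2 * J)) by (apply pow_lt; lra).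
  assert (i0 : 0 < / Cmod p) by now apply Rinv_0_lt_compat.
  assert (E0 := exp_pos (eta * Rabs x)). assert (T0 := exp_pos (theta * Rabs x)).
  assert (Main : B ^ 2 * (2 * exp (theta * Rabs x)) <= 2 * (d ^ (2 * J) + R0) * exp (eta * Rabs x)).
  { destruct (Rle_dec (INR J * ln 2) (theta * Rabs x)) as [h|h].
    - assert (B1 : B ^ 2 <= 1).
      { assert (B <= 1).
        { eapply Rle_trans; [apply (blaschke_prod_le _ _ 1 0 0); try assumption; [lra|intros; lia]|].
          rewrite pow1. lra. }
        rewrite <- (pow1 2). apply pow_incr. lra. }
      assert (T : exp (theta * Rabs x) <= R0 * exp (eta * Rabs x)).
      { unfold R0. rewrite <- exp_plus. apply exp_le.
        assert (H : (eta - theta) / theta * (INR J * ln 2) <= (eta - theta) / theta * (theta * Rabs x)).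
        { apply Rmult_le_compat_l; [|exact h]. apply Rdiv_le_0_compat; lra. }
        replace ((eta - theta) / theta * (theta * Rabs x)) with ((eta - theta) * Rabs x) in H
          by (field; lra).
        lra. }
      apply Rle_trans with (1 * (2 * exp (theta * Rabs x))); [apply Rmult_le_compat_r; lra|].
      assert (0 <= d ^ (2 * J) * exp (eta * Rabs x)) by (apply Rmult_le_pos; lra). lra.
    - assert (Jp : (1 <= J)%nat).
      { destruct J; [|lia]. exfalso. apply h. simpl. rewrite Rmult_0_l. nra. }
      set (y := theta * x / ln 2 + INR J).
      assert (Hy : 0 <= y <= INR (2 * J)).
      { rewrite mult_INR. simpl (INR 2). unfold y.
        assert (A : - INR J <= theta * x / ln 2 <= INR J).
        { assert (Ex : theta * x = theta * x / ln 2 * ln 2) by (field; lra).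
          assert (Hx : Rabs (theta * x) < INR J * ln 2)
            by (rewrite Rabs_mult, (Rabs_pos_eq theta) by lra; lra).
          destruct (Rabs_def2 _ _ Hx).
          split; apply (Rmult_le_reg_r (ln 2)); lra. }
        lra. }
      destruct (real_in_unit_interval (2 * J) y ltac:(lia) Hy) as [q [Q1 Q2]].
      assert (BJ : B <= d ^ J).
      { unfold B. replace J with (Nat.min (J * (2 * J) - J * q) J) at 4 by nia.
        apply blaschke_prod_le; [exact Hd|exact One|].
        intros i Hi. rewrite Z1. replace ((S i - 1) / J)%nat with q.
        2:{ replace (S i - 1)%nat with i by lia.
            apply (Nat.div_unique i J q (i - J * q)); lia. }
        set (s := exp (ln 2 * (INR q - INR J))).
        destruct (blaschke_sector s k p) as [_ Bs]; try assumption; [apply exp_pos|].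
        assert (Sp : s <= Cmod p <= 2 * s).
        { unfold s. rewrite <- mul_ln_2_exp, Hp. unfold y in Q2.
          assert (Ex : theta * x = theta * x / ln 2 * ln 2) by (field; lra).
          split; apply exp_le; nra. }
        specialize (Bs Sp).
        apply Rsqr_incr_0_var; [|lra]. unfold Rsqr. fold s. simpl in Bs, Hd2. lra. }
      assert (B2 : B ^ 2 <= d ^ (2 * J)).
      { rewrite Nat.mul_comm, pow_mult. apply pow_incr. lra. }
      assert (T : exp (theta * Rabs x) <= exp (eta * Rabs x)) by (apply exp_le; nra).
      apply Rle_trans with (d ^ (2 * J) * (2 * exp (eta * Rabs x))).
      + apply Rmult_le_compat; [apply pow2_ge_0|lra|exact B2|lra].
      + assert (0 <= R0 * exp (eta * Rabs x)) by (apply Rmult_le_pos; lra). lra. }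
  eapply Rle_trans; [apply Rmult_le_compat_l; [apply pow2_ge_0|exact Sum]|].
  eapply Rle_trans; [exact Main|]. apply Rmult_le_compat_l; lra.
Qed.

Lemma half_plane_power_sector (theta : R) (t : C) : 0 < theta < 1 ->
  cos (theta * (PI / 2)) * Cmod (half_plane_power theta t) <= Re (half_plane_power theta t).
Proof.
  intros Ht. rewrite Cmod_half_plane_power. unfold half_plane_power, Re. simpl fst.
  set (y := atan (Im t / fst t)).
  assert (Hy : - (PI / 2) < y < PI / 2) by (unfold y; destruct (atan_bound (Im t / fst t)); lra).
  assert (P := PI_RGT_0). rewrite Rmult_comm.
  apply Rmult_le_compat_l; [left; apply exp_pos|].
  destruct (Rle_dec 0 y) as [h|h].
  - apply cos_decr_1; nra.
  - rewrite <- (cos_neg (theta * y)). apply cos_decr_1; nra.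
Qed.

(** In the half-plane [1 - |w|^2] is [4 Re p / |1 + p|^2]. *)
Lemma inv_one_minus_cayley (k : R) (p : C) : 0 < k -> 0 < Cmod p -> k * Cmod p <= Re p ->
  / (1 - Cmod (cayley p) ^ 2) <= / (2 * k) * (Cmod p + / Cmod p).
Proof.
  intros Hk Hp HX. assert (X0 : 0 < Re p) by nra.
  assert (M := Cmod2_alt p). destruct p as [X Y]. unfold Re, Im in *. simpl in X0, HX, M.
  rewrite cayley_Cmod_sq by exact X0.
  set (r := Cmod (X, Y)) in *.
  assert (D : 0 < (1 + X) ^ 2 + Y ^ 2) by nra.
  replace (/ (1 - (1 - 4 * X / ((1 + X) ^ 2 + Y ^ 2)))) with (((1 + X) ^ 2 + Y ^ 2) / (4 * X))
    by (field; split; lra).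
  apply (Rmult_le_reg_r (4 * X * (2 * k * r))); [repeat apply Rmult_lt_0_compat; lra|].
  replace (((1 + X) ^ 2 + Y ^ 2) / (4 * X) * (4 * X * (2 * k * r)))
    with (((1 + X) ^ 2 + Y ^ 2) * (2 * k * r)) by (field; lra).
  replace (/ (2 * k) * (r + / r) * (4 * X * (2 * k * r))) with (4 * X * (r ^ 2 + 1)) by (field; lra).
  assert (Xr : X <= r) by nra.
  assert (A0 := pow2_ge_0 (1 - r)).
  assert (A : (1 + X) ^ 2 + Y ^ 2 <= 2 * (r ^ 2 + 1)) by (simpl in *; lra).
  apply Rle_trans with (2 * (r ^ 2 + 1) * (2 * k * r)).
  - apply Rmult_le_compat_r; [nra|exact A].
  - assert (0 <= (r ^ 2 + 1) * (X - k * r)) by (apply Rmult_le_pos; nra). lra.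
Qed.

(** With [u] and [v] the moduli of [1 - z] and [1 + z], in either order, the numerator of
    [(u / v) ^ eta] is at most [2]. *)
Lemma exp_eta_ln_le (eta u v : R) : 0 <= eta <= 1 -> 0 < u -> u <= 2 -> 0 < v ->
  exp (eta * (ln u - ln v)) <= 2 * Rpower v (- eta).
Proof.
  intros He Hu Hu2 Hv. unfold Rpower.
  replace (eta * (ln u - ln v)) with (eta * ln u + - eta * ln v) by ring.
  rewrite exp_plus. apply Rmult_le_compat_r; [left; apply exp_pos|].
  rewrite <- (exp_ln 2) by lra. apply exp_le.
  assert (l : ln u <= ln 2) by (apply ln_le; lra).
  assert (l2 : 0 < ln 2) by (rewrite <- ln_1; apply ln_increasing; lra).
  assert (eta * ln u <= eta * ln 2) by (apply Rmult_le_compat_l; lra). nra.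
Qed.

Lemma square_index (n : nat) : (1 <= n)%nat ->
  exists J, (J * (2 * J) < n)%nat /\ (n <= S J * (2 * S J))%nat.
Proof.
  induction n; intros H; [lia|]. destruct n as [|n].
  - exists 0%nat. lia.
  - destruct IHn as [J [H1 H2]]; [lia|].
    destruct (le_lt_dec (S (S n)) (S J * (2 * S J))) as [h|h].
    + exists J. lia.
    + exists (S J). split; [exact h|]. nia.
Qed.

(** Dividing by the Blaschke product with dyadic zeros leaves an error whose modulus is
    dominated by [exp (- c J)] times those of the fixed functions
    [(1 - z) ^ (- eta / 2)] and [(1 + z) ^ (- eta / 2)], with [theta < eta < 1]; the rank
    used is [2 J^2]. *)
Lemma lens_upper_bound (theta : R) (Ht : 0 < theta < 1) (S : H2 -> H2) :
  is_composition_operator (lens_map theta Ht) S ->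
  exists beta gamma, 0 < beta /\ 0 < gamma /\ forall n, (1 <= n)%nat ->
    approx_number S n <= gamma * exp (- beta * sqrt (INR n)).
Proof.
  intros HS. assert (P := PI_RGT_0).
  set (k := cos (theta * (PI / 2))).
  assert (Hk : 0 < k <= 1) by (split; [apply cos_gt_0; nra|apply COS_bound]).
  set (eta := (1 + theta) / 2). set (d := sqrt (1 - k / 2)).
  assert (d2 : d * d = 1 - k / 2) by (apply sqrt_sqrt; lra).
  assert (d0 : 0 < d) by (apply sqrt_lt_R0; lra).
  assert (d1 : d < 1) by nra.
  assert (ld : ln d < 0) by (rewrite <- ln_1; apply ln_increasing; lra).
  assert (l2 : 0 < ln 2) by (rewrite <- ln_1; apply ln_increasing; lra).
  set (c1 := (eta - theta) / theta * ln 2).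
  assert (c10 : 0 < c1).
  { unfold c1, eta. apply Rmult_lt_0_compat; [|exact l2]. apply Rdiv_lt_0_compat; lra. }
  set (mu := Rmin (- 2 * ln d) c1).
  assert (mu0 : 0 < mu) by (unfold mu; apply Rmin_glb_lt; lra).
  destruct (binomial_in_H2 (eta / 2)) as [G [H [HG HH]]]; [unfold eta; lra|].
  set (M := 4 / k * (H2_norm G ^ 2 + H2_norm H ^ 2) + 1).
  assert (GH : 0 <= H2_norm G ^ 2 + H2_norm H ^ 2)
    by (apply Rplus_le_le_0_compat; apply pow2_ge_0).
  assert (k4 : 0 < 4 / k) by (apply Rdiv_lt_0_compat; lra).
  assert (M0 : 0 < M) by (unfold M; nra).
  assert (Dy : forall J n, (J * (2 * J) < n)%nat ->
    approx_number S n <= sqrt M * exp (- (mu / 2) * INR J)).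
  { intros J n Hn.
    set (err := d ^ (2 * J) + exp (- (c1 * INR J))).
    assert (J0 := pos_INR J).
    assert (Herr : err <= 2 * exp (- mu * INR J)).
    { unfold err.
      assert (E1 : d ^ (2 * J) <= exp (- mu * INR J)).
      { rewrite <- (exp_ln d) by exact d0. replace (ln d) with (- (- ln d)) by ring.
        rewrite exp_neg_pow. apply exp_le. rewrite mult_INR. simpl (INR 2).
        assert (m1 : mu <= - 2 * ln d) by apply Rmin_l.
        assert (mu * INR J <= - 2 * ln d * INR J) by (apply Rmult_le_compat_r; lra). lra. }
      assert (E2 : exp (- (c1 * INR J)) <= exp (- mu * INR J)).
      { apply exp_le. assert (m1 : mu <= c1) by apply Rmin_r.
        assert (mu * INR J <= c1 * INR J) by (apply Rmult_le_compat_r; lra). lra. }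
      lra. }
    assert (err0 : 0 < err).
    { unfold err. assert (0 < d ^ (2 * J)) by now apply pow_lt.
      assert (h := exp_pos (- (c1 * INR J))). lra. }
    assert (ds : 0 <= sqrt M * exp (- (mu / 2) * INR J))
      by (apply Rmult_le_pos; [apply sqrt_pos|left; apply exp_pos]).
    apply (approx_number_le_blaschke (lens_map theta Ht) S n (J * (2 * J)) (dyadic_zero J) _ HS);
      [intros i; apply pt_lt|exact Hn|exact ds|].
    intros F g HF.
    assert (Dom : H2_norm F ^ 2 <= (2 / k * err * H2_norm g ^ 2) * (H2_norm G ^ 2 + H2_norm H ^ 2)).
    { apply domination.
      - apply Rmult_le_pos; [|apply pow2_ge_0]. apply Rmult_le_pos; [|lra].
        left. apply Rdiv_lt_0_compat; lra.
      - intros z. rewrite HF, Cmod_mult, Rpow_mult_distr.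
        set (w := lens_map theta Ht z).
        set (t := cayley (proj1_sig z)). set (p := half_plane_power theta t).
        assert (Ew : proj1_sig w = cayley p) by reflexivity.
        set (a1 := Cmod (1 - proj1_sig z)). set (a2 := Cmod (1 + proj1_sig z)).
        assert (z1 := proj2_sig z). simpl in z1.
        assert (a10 : 0 < a1) by (apply Cmod_gt_0, Re_pos_neq_0, Re_one_minus, z1).
        assert (n2 : (1 + proj1_sig z)%C <> 0) by (apply Re_pos_neq_0, Re_one_plus, z1).
        assert (a20 : 0 < a2) by now apply Cmod_gt_0.
        assert (a12 : a1 <= 2).
        { unfold a1, Cminus. eapply Rle_trans; [apply Cmod_triangle|].
          rewrite Cmod_1, Cmod_opp. lra. }
        assert (a22 : a2 <= 2).
        { unfold a2. eapply Rle_trans; [apply Cmod_triangle|]. rewrite Cmod_1. lra. }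
        assert (tE : Cmod t = a1 / a2) by (unfold t, cayley; now apply Cmod_div).
        set (x := ln a1 - ln a2).
        assert (pE : Cmod p = exp (theta * x)).
        { unfold p. rewrite Cmod_half_plane_power. unfold Rpower. now rewrite tE, ln_div. }
        assert (p0 : 0 < Cmod p) by (rewrite pE; apply exp_pos).
        assert (pX : k * Cmod p <= Re p) by now apply half_plane_power_sector.
        assert (DB := dyadic_product_bound theta eta k J p x d ltac:(lra) ltac:(unfold eta; lra)
          Hk pE pX ltac:(lra) ltac:(simpl; lra)).
        fold c1 err in DB. rewrite Ew.
        set (B := Cmod (blaschke_prod (dyadic_zero J) (J * (2 * J)) (cayley p)) ^ 2) in *.
        assert (B0 : 0 <= B) by apply pow2_ge_0.
        assert (Pt := H2_pointwise g w). rewrite Ew in Pt. unfold Rdiv in Pt.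
        assert (I1 := inv_one_minus_cayley k p ltac:(lra) p0 pX).
        assert (g0 : 0 <= H2_norm g ^ 2) by apply pow2_ge_0.
        assert (GE : Cmod (G z) ^ 2 = Rpower a1 (- eta)).
        { rewrite HG. fold a1. unfold Rpower. simpl. rewrite Rmult_1_r, <- exp_plus.
          f_equal. field. }
        assert (HE : Cmod (H z) ^ 2 = Rpower a2 (- eta)).
        { rewrite HH. fold a2. unfold Rpower. simpl. rewrite Rmult_1_r, <- exp_plus.
          f_equal. field. }
        assert (X1 : exp (eta * x) <= 2 * Cmod (H z) ^ 2)
          by (rewrite HE; apply exp_eta_ln_le; unfold eta; lra).
        assert (X2 : exp (- (eta * x)) <= 2 * Cmod (G z) ^ 2).
        { rewrite GE. replace (- (eta * x)) with (eta * (ln a2 - ln a1)) by (unfold x; ring).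
          apply exp_eta_ln_le; unfold eta; lra. }
        set (gz := Cmod (g w) ^ 2) in *. set (N := H2_norm g ^ 2) in *.
        set (V := Cmod (G z) ^ 2 + Cmod (H z) ^ 2) in *.
        assert (i2k : 0 < / (2 * k)) by (apply Rinv_0_lt_compat; lra).
        apply Rle_trans with (N * (/ (2 * k)) * (B * (Cmod p + / Cmod p))).
        + apply Rle_trans with (B * (N * (/ (2 * k) * (Cmod p + / Cmod p)))); [|right; ring].
          apply Rmult_le_compat_l; [exact B0|]. eapply Rle_trans; [exact Pt|].
          now apply Rmult_le_compat_l.
        + apply Rle_trans with (N * / (2 * k) * (2 * err * (2 * V))).
          * apply Rmult_le_compat_l; [apply Rmult_le_pos; lra|].
            eapply Rle_trans; [exact DB|]. apply Rmult_le_compat_l; [lra|]. unfold V. lra.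
          * right. field. lra. }
    apply Rsqr_incr_0_var; [|apply Rmult_le_pos; [exact ds|apply H2_norm_pos]].
    rewrite !Rsqr_pow2. eapply Rle_trans; [exact Dom|].
    rewrite !Rpow_mult_distr, pow2_sqrt by lra.
    replace (exp (- (mu / 2) * INR J) ^ 2) with (exp (- mu * INR J))
      by (simpl; rewrite Rmult_1_r, <- exp_plus; f_equal; field).
    assert (g0 : 0 <= H2_norm g ^ 2) by apply pow2_ge_0.
    replace (2 / k * err * H2_norm g ^ 2 * (H2_norm G ^ 2 + H2_norm H ^ 2))
      with (2 / k * (H2_norm G ^ 2 + H2_norm H ^ 2) * err * H2_norm g ^ 2) by ring.
    apply Rmult_le_compat_r; [exact g0|].
    assert (e0 := exp_pos (- mu * INR J)).
    assert (k2 : 4 / k = 2 * (2 / k)) by (field; lra).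
    apply Rle_trans with (2 / k * (H2_norm G ^ 2 + H2_norm H ^ 2) * (2 * exp (- mu * INR J))).
    - apply Rmult_le_compat_l; [apply Rmult_le_pos; lra|exact Herr].
    - unfold M. rewrite k2. lra. }
  exists (mu / 4), (sqrt M * exp (mu / 2)). split; [lra|]. split.
  { apply Rmult_lt_0_compat; [now apply sqrt_lt_R0|apply exp_pos]. }
  intros n Hn. destruct (square_index n Hn) as [J [J1 J2]].
  eapply Rle_trans; [apply (Dy J n J1)|]. rewrite Rmult_assoc, <- exp_plus.
  apply Rmult_le_compat_l; [apply sqrt_pos|]. apply exp_le.
  assert (r : sqrt (INR n) <= 2 * (INR J + 1)).
  { apply Rsqr_incr_0_var; [|assert (h := pos_INR J); lra].
    rewrite Rsqr_sqrt by apply pos_INR. unfold Rsqr.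
    apply le_INR in J2. rewrite !mult_INR, !S_INR in J2. simpl (INR 0) in J2.
    assert (h := pos_INR J). nra. }
  nra.
Qed.

(** * Consequences of the two bounds *)

Lemma nonneg_power_pos (x p : R) : 0 < x -> nonneg_power x p = exp (p * ln x).
Proof. intros H. unfold nonneg_power. destruct (Rlt_dec 0 x); [reflexivity|contradiction]. Qed.

Lemma is_lim_seq_inv_sqrt : is_lim_seq (fun n => / sqrt (INR n)) 0.
Proof.
  apply (is_lim_seq_ext (fun n => sqrt (/ INR n))); [intros; apply sqrt_inv|].
  replace 0 with (sqrt 0) by apply sqrt_0.
  apply (is_lim_seq_continuous sqrt); [apply continuity_pt_sqrt; lra|].
  apply (is_lim_seq_inv _ p_infty); [apply is_lim_seq_INR|discriminate].
Qed.

Lemma beta_of_bounds (S : H2 -> H2) (b c g : R) : 0 < c -> 0 < g ->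
  (forall n, (1 <= n)%nat -> c * exp (- b * sqrt (INR n)) <= approx_number S n <= g) ->
  beta_number S = Finite 1.
Proof.
  intros Hc Hg Hb. unfold beta_number. apply is_LimInf_seq_unique, is_lim_LimInf_seq.
  assert (I : is_lim_seq (fun n => / INR n) 0)
    by (apply (is_lim_seq_inv _ p_infty); [apply is_lim_seq_INR|discriminate]).
  assert (E : forall u : nat -> R, is_lim_seq u 0 -> is_lim_seq (fun n => exp (u n)) 1).
  { intros u Hu. rewrite <- exp_0. apply (is_lim_seq_continuous exp); [|exact Hu].
    apply derivable_continuous_pt, derivable_pt_exp. }
  apply (is_lim_seq_le_le_loc (fun n => exp (ln c * / INR n + (- b) * / sqrt (INR n))) _
    (fun n => exp (ln g * / INR n))).
  - exists 1%nat. intros n Hn. destruct (Hb n Hn) as [H1 H2].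
    assert (n0 : 1 <= INR n) by (apply (le_INR 1); exact Hn).
    assert (s0 : 0 < sqrt (INR n)) by (apply sqrt_lt_R0; lra).
    assert (s2 : sqrt (INR n) * sqrt (INR n) = INR n) by (apply sqrt_sqrt; lra).
    assert (e0 := exp_pos (- b * sqrt (INR n))).
    assert (p0 : 0 < c * exp (- b * sqrt (INR n))) by (apply Rmult_lt_0_compat; lra).
    assert (i0 : 0 < / INR n) by (apply Rinv_0_lt_compat; lra).
    rewrite nonneg_power_pos by lra. split; apply exp_le.
    + apply ln_le in H1; [|exact p0]. rewrite ln_mult, ln_exp in H1 by lra.
      replace (ln c * / INR n + - b * / sqrt (INR n))
        with (/ INR n * (ln c + - b * sqrt (INR n))).
      * apply Rmult_le_compat_l; lra.
      * rewrite Rmult_plus_distr_l. f_equal; [ring|].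
        set (r := sqrt (INR n)) in *. rewrite <- s2. field. lra.
    + rewrite Rmult_comm. apply Rmult_le_compat_r; [lra|]. apply ln_le; lra.
  - apply E. replace (Finite 0) with (Finite (ln c * 0 + - b * 0)) by (f_equal; ring).
    apply is_lim_seq_plus'; apply (is_lim_seq_scal_l _ _ (Finite 0)); [exact I|].
    exact is_lim_seq_inv_sqrt.
  - apply E. replace (Finite 0) with (Finite (ln g * 0)) by (f_equal; ring).
    now apply (is_lim_seq_scal_l _ _ (Finite 0)).
Qed.

Lemma ex_series_inv_sq : ex_series (fun n => / (INR n + 1) ^ 2).
Proof.
  apply (ex_series_bounded _ 2).
  - intros n. left. apply Rinv_0_lt_compat, pow_lt. assert (h := pos_INR n). lra.
  - intros n. apply Rle_trans with (2 - / (INR n + 1)).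
    + induction n.
      * rewrite sum_O. simpl. right. field.
      * rewrite sum_n_S_R, S_INR. assert (h := pos_INR n).
        assert (/ (INR n + 1 + 1) ^ 2 <= / (INR n + 1) - / (INR n + 1 + 1)); [|lra].
        replace (/ (INR n + 1) - / (INR n + 1 + 1)) with (/ ((INR n + 1) * (INR n + 1 + 1)))
          by (field; lra).
        apply Rinv_le_contravar; nra.
    + assert (h := pos_INR n). assert (0 < / (INR n + 1)) by (apply Rinv_0_lt_compat; lra). lra.
Qed.

Lemma schatten_of_bound (S : H2 -> H2) (beta gamma p : R) : is_linear S ->
  0 < beta -> 0 < gamma -> 0 < p ->
  (forall n, (1 <= n)%nat -> approx_number S n <= gamma * exp (- beta * sqrt (INR n))) ->
  in_schatten p S.
Proof.
  intros LS Hb Hg Hp H. split; [exact LS|].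
  set (q := p * beta). assert (q0 : 0 < q) by (apply Rmult_lt_0_compat; lra).
  apply ex_series_le_R with (fun n => exp (p * ln gamma) * (256 / q ^ 4) * / (INR n + 1) ^ 2).
  2:{ apply (ex_series_scal_l (V := R_NormedModule) (exp (p * ln gamma) * (256 / q ^ 4))).
      exact ex_series_inv_sq. }
  intros n. assert (n0 := pos_INR n).
  assert (q4 : 0 < 256 / q ^ 4) by (apply Rdiv_lt_0_compat; [lra|now apply pow_lt]).
  assert (e0 := exp_pos (p * ln gamma)).
  assert (i0 : 0 < / (INR n + 1) ^ 2) by (apply Rinv_0_lt_compat, pow_lt; lra).
  destruct (Rlt_dec 0 (approx_number S (n + 1))) as [h|h].
  2:{ unfold nonneg_power. destruct (Rlt_dec 0 (approx_number S (n + 1))); [contradiction|].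
      rewrite Rabs_R0. repeat apply Rmult_le_pos; lra. }
  rewrite nonneg_power_pos by exact h. rewrite Rabs_pos_eq by (left; apply exp_pos).
  specialize (H (n + 1)%nat ltac:(lia)). rewrite plus_INR in H. simpl (INR 1) in H.
  set (s := sqrt (INR n + 1)) in *.
  assert (s0 : 0 < s) by (apply sqrt_lt_R0; lra).
  assert (s2 : s * s = INR n + 1) by (apply sqrt_sqrt; lra).
  apply ln_le in H; [|exact h]. rewrite ln_mult, ln_exp in H by (try apply exp_pos; lra).
  apply Rle_trans with (exp (p * ln gamma + - (q * s))).
  { apply exp_le. unfold q. apply (Rmult_le_compat_l p) in H; lra. }
  rewrite exp_plus, Rmult_assoc. apply Rmult_le_compat_l; [lra|].
  assert (Q : (q * s) ^ 4 / 256 <= exp (q * s)).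
  { assert (E : exp (q * s) = exp (q * s / 2) ^ 2)
      by (simpl; rewrite Rmult_1_r, <- exp_plus; f_equal; field).
    assert (G := exp_ge_sq (q * s / 2) ltac:(nra)).
    rewrite E. replace ((q * s) ^ 4 / 256) with (((q * s / 2) ^ 2 / 4) ^ 2) by field.
    apply pow_incr. split; [|exact G]. assert (h' := pow2_ge_0 (q * s / 2)). lra. }
  rewrite exp_Ropp, <- s2.
  assert (x0 := exp_pos (q * s)). assert (qs : 0 < q * s) by nra.
  apply (Rmult_le_reg_r (exp (q * s))); [exact x0|]. rewrite Rinv_l by lra.
  apply Rle_trans with (256 / q ^ 4 * / (s * s) ^ 2 * ((q * s) ^ 4 / 256)).
  - right. field. lra.
  - apply Rmult_le_compat_l; [|exact Q]. rewrite s2. apply Rmult_le_pos; lra.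
Qed.

Lemma not_exponential_of_bound (u : nat -> R) (b c : R) : 0 < b -> 0 < c ->
  (forall n, (1 <= n)%nat -> c * exp (- b * sqrt (INR n)) <= u n) ->
  ~ decreases_exponentially u.
Proof.
  intros Hb Hc H [K [r [Hr HK]]].
  set (L := - ln r). assert (L0 : 0 < L).
  { unfold L. assert (ln r < ln 1) by (apply ln_increasing; lra). rewrite ln_1 in H0. lra. }
  destruct (INR_unbounded (1 + (b + 1) / L + Rabs (K / c))) as [m Hm].
  assert (A1 : 0 < (b + 1) / L) by (apply Rdiv_lt_0_compat; lra).
  assert (A2 := Rle_abs (K / c)). assert (A3 := Rabs_pos (K / c)).
  assert (m1 : (1 <= m)%nat) by (apply INR_le; simpl; lra).
  (* at the squares the two bounds read c exp (- b m) <= K exp (- L m^2) *)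
  assert (B := H (m * m)%nat ltac:(nia)). assert (B' := HK (m * m)%nat ltac:(nia)).
  rewrite mult_INR, sqrt_square in B by apply pos_INR.
  rewrite <- (exp_ln r) in B' by lra. replace (ln r) with (- L) in B' by (unfold L; ring).
  rewrite exp_neg_pow, mult_INR in B'.
  assert (C1 : c * exp (- b * INR m) <= K * exp (- L * (INR m * INR m))) by lra.
  assert (e0 := exp_pos (L * (INR m * INR m))).
  apply (Rmult_le_compat_r (exp (L * (INR m * INR m)))) in C1; [|lra].
  rewrite !Rmult_assoc, <- !exp_plus in C1.
  replace (- L * (INR m * INR m) + L * (INR m * INR m)) with 0 in C1 by ring.
  rewrite exp_0, Rmult_1_r in C1.
  assert (D : INR m <= - b * INR m + L * (INR m * INR m)).
  { assert (b + 1 <= L * INR m).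
    { apply (Rmult_le_reg_r (/ L)); [now apply Rinv_0_lt_compat|].
      replace (L * INR m * / L) with (INR m) by (field; lra). unfold Rdiv in *. lra. }
    assert (h := pos_INR m). nra. }
  apply exp_le in D. assert (X := exp_ineq1_le (INR m)).
  assert (c * (1 + INR m) <= K) by nra.
  assert (1 + INR m <= K / c).
  { apply (Rmult_le_reg_l c); [exact Hc|]. replace (c * (K / c)) with K by (field; lra). exact H0. }
  lra.
Qed.

Theorem proposition6p3 (theta : R) (Htheta : 0 < theta < 1) :
  exists Cphi : H2 -> H2,
    is_composition_operator (lens_map theta Htheta) Cphi /\
    (exists b c beta gamma : R,
        0 < b /\ 0 < c /\ 0 < beta /\ 0 < gamma /\
        b = PI * sqrt (2 * (1 - theta) / theta) /\
        forall n : nat, (1 <= n)%nat ->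
          c * exp (- b * sqrt (INR n)) <= approx_number Cphi n /\
          approx_number Cphi n <= gamma * exp (- beta * sqrt (INR n))) /\
    beta_number Cphi = Finite 1 /\
    (forall p : R, 0 < p -> in_schatten p Cphi) /\
    ~ decreases_exponentially (approx_number Cphi).
Proof.
  destruct (lens_composition_operator theta Htheta) as [S HS].
  destruct (lens_lower_bound theta Htheta S HS) as [c [c0 Lo]].
  destruct (lens_upper_bound theta Htheta S HS) as [beta [gamma [b0 [g0 Up]]]].
  set (b := PI * sqrt (2 * (1 - theta) / theta)) in *.
  assert (bp : 0 < b).
  { apply Rmult_lt_0_compat; [apply PI_RGT_0|]. apply sqrt_lt_R0, Rdiv_lt_0_compat; lra. }
  exists S. split; [exact HS|]. split; [|split; [|split]].
  - exists b, c, beta, gamma. repeat split; auto.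
  - apply (beta_of_bounds S b c gamma c0 g0). intros n Hn. split; [now apply Lo|].
    eapply Rle_trans; [now apply Up|]. rewrite <- (Rmult_1_r gamma) at 2.
    apply Rmult_le_compat_l; [lra|]. rewrite <- exp_0. apply exp_le.
    assert (h := sqrt_pos (INR n)). nra.
  - intros p Hp. destruct HS as [LS _]. now apply (schatten_of_bound S beta gamma p LS).
  - now apply (not_exponential_of_bound _ b c).
Qed.
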